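(* Let $(X,d,\mu)$ be a metric-measure space with $\mathrm{diam}\,X<\infty$ and $\mu$ a doubling measure, and let $1\leq p<\infty$ and $n\geq 1$ be an integer. Suppose that $(X,d,\mu)$ supports the $p$-Poincar\'e inequality and that the Nagata dimension of $X$ satisfies $\dim_N X\leq n$. If a separable metric space $Y$ is Lipschitz $(n-1)$-connected, then the Lipschitz mappings $\mathrm{Lip}(X,Y)$ are dense in $N^{1,p}(X,Y)$.
   Context: A metric-measure space is a metric space with a Borel-regular measure $\mu$; $\mu$ is doubling if there is $C_d\ge1$ with $\mu(2B)\le C_d\mu(B)$ for every ball $B$. A Borel function $g:U\to[0,\infty]$ is an upper gradient of $u$ (with values in $\mathbb R$ or in a Banach space $(V,\|\cdot\|)$) on open $U$ if $\|u(\gamma(b))-u(\gamma(a))\|\le\int_\gamma g$ for every rectifiable curve $\gamma:[a,b]\to U$. $X$ supports the $p$-Poincar\'e inequality if there are $C_P>0$, $\sigma\ge1$ such that for every ball $B$, every $u\in L^1(\sigma B)$ and every upper gradient $g$ of $u$ on $\sigma B$: $\frac{1}{\mu(B)}\int_B|u-u_B|\,d\mu\le C_P\,(\mathrm{diam}\,B)\big(\frac{1}{\mu(\sigma B)}\int_{\sigma B}g^p\,d\mu\big)^{1/p}$, where $u_B$ is the average of $u$ on $B$ and $\sigma B$ is the concentric ball with $\sigma$ times the radius. For a Banach space $V$, $N^{1,p}(X,V)$ consists of $u\in L^p(X,V)$ having an upper gradient $g\in L^p(X)$, normed by $\|u\|_{N^{1,p}}=\|u\|_{L^p}+\inf_g\|g\|_{L^p}$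 (infimum over upper gradients; functions at distance $0$ identified). For a separable metric space $Y$, fix an isometric embedding $\lambda:Y\to V$ into a Banach space (e.g. $\ell^\infty$) and set $N^{1,p}(X,Y)=\{u:X\to Y:\lambda\circ u\in N^{1,p}(X,V)\}$ with metric $d(u,v)=\|\lambda\circ u-\lambda\circ v\|_{N^{1,p}}$. The Nagata dimension $\dim_N X$ is the least integer $n$ such that there is $C>0$ so that for every $s>0$ there is a cover $X=\bigcup_{i}A_i$ with $\mathrm{diam}\,A_i\le Cs$ for all $i$ and every ball $B(x,s)$ meeting at most $n+1$ of the sets $A_i$. A metric space $Y$ is Lipschitz $m$-connected if there is $\gamma\ge1$ such that for each $k\in\{0,1,\dots,m\}$ every $L$-Lipschitz map $f:\mathbb S^k\to Y$ has a $\gamma L$-Lipschitz extension $F:\mathbb B^{k+1}\to Y$. *)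

(* Defs.v *)
From HB Require Import structures.
From mathcomp Require Import all_boot all_order all_algebra.
From mathcomp Require Import all_classical all_reals all_analysis measurable_realfun.

Set Implicit Arguments.
Unset Strict Implicit.
Unset Printing Implicit Defensive.

Import Order.TTheory GRing.Theory Num.Theory.
Import numFieldNormedType.Exports.

Local Open Scope classical_set_scope.
Local Open Scope ring_scope.

Section Defs.
Variable R : realType.

Definition is_metric (T : Type) (d : T -> T -> R) : Prop :=
  (forall x y, 0 <= d x y) /\ (forall x y, d x y = 0 <-> x = y) /\
  (forall x y, d x y = d y x) /\ (forall x y z, d x z <= d x y + d y z).

Definition dball (T : Type) (d : T -> T -> R) (x : T) (r : R) : set T :=
  [set y | d x y < r].

Definition d_open (T : Type) (d : T -> T -> R) (U : set T) : Prop :=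
  forall x, U x -> exists2 r, 0 < r & dball d x r `<=` U.

Definition borel_sets (T : Type) (d : T -> T -> R) : set (set T) :=
  <<s d_open d >>.

Definition diamE (T : Type) (d : T -> T -> R) (A : set T) : \bar R :=
  ereal_sup [set z | exists x y, A x /\ A y /\ z = (d x y)%:E].

Definition finite_diam (T : Type) (d : T -> T -> R) : Prop :=
  exists D : R, forall x y, d x y <= D.

Definition separable (T : Type) (d : T -> T -> R) : Prop :=
  exists D : set T, countable D /\
    forall y (e : R), 0 < e -> exists z, D z /\ d y z < e.

Definition isometric_embedding (T : Type) (d : T -> T -> R)
    (V : normedModType R) (lam : T -> V) : Prop :=
  forall y z, `|lam y - lam z| = d y z.

Definition lipschitz (S T : Type) (dS : S -> S -> R) (dT : T -> T -> R)
    (f : S -> T) : Prop :=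
  exists L : R, forall x y, dT (f x) (f y) <= L * dS x y.

Section MM.
Context (dX : measure_display) (X : measurableType dX).
Variables (d : X -> X -> R) (mu : {measure set X -> \bar R}).

(* mu is (the restriction to its measurable sets of) a Borel regular
   outer measure: Borel sets are measurable, the measure is complete, and
   every measurable set is contained in a Borel set of the same measure. *)
Definition borel_regular : Prop :=
  (forall A, borel_sets d A -> measurable A) /\
  (forall N, measurable N -> mu N = 0%E -> forall A, A `<=` N -> measurable A) /\
  (forall A, measurable A -> exists B, borel_sets d B /\ A `<=` B /\ mu A = mu B).

Definition doubling : Prop :=
  (forall x r, 0 < r -> (0 < mu (dball d x r))%E /\ (mu (dball d x r) < +oo)%E) /\
  exists2 Cd : R, 1 <= Cd & forall x r, 0 < r ->
     (mu (dball d x (2 * r)) <= Cd%:E * mu (dball d x r))%E.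

Definition curve_length (gam : R -> X) (a b : R) : \bar R :=
  ereal_sup [set z | exists (k : nat) (t : nat -> R),
     t 0%N = a /\ t k = b /\ (forall i, (i < k)%N -> t i <= t i.+1) /\
     z = (\sum_(i < k) d (gam (t i)) (gam (t i.+1)))%:E].

Definition rectifiable (gam : R -> X) (a b : R) : Prop :=
  a <= b /\
  (forall t, a <= t <= b -> forall e : R, 0 < e -> exists2 del : R, 0 < del &
     forall t', a <= t' <= b -> `|t - t'| < del -> d (gam t) (gam t') < e) /\
  (curve_length gam a b < +oo)%E.

Definition borel_on (U : set X) (g : X -> \bar R) : Prop :=
  forall B : set (\bar R), measurable B -> borel_sets d (U `&` g @^-1` B).

(* g is an upper gradient of u : X -> V on U.  The line integral of g along
   a rectifiable gam : [a,b] -> U is the integral over [0, length] of g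
   composed with the arc-length parametrization gt of gam, characterized by
   gt (s_gam t) = gam t, s_gam t = length of gam on [a,t]. *)
Definition upper_gradient (V : normedModType R) (U : set X) (u : X -> V)
    (g : X -> \bar R) : Prop :=
  borel_on U g /\ (forall x, U x -> (0 <= g x)%E) /\
  forall (gam : R -> X) (a b : R), rectifiable gam a b ->
    (forall t, a <= t <= b -> U (gam t)) ->
    forall gt : R -> X,
      (forall t, a <= t <= b -> gt (fine (curve_length gam a t)) = gam t) ->
      ((`|u (gam b) - u (gam a)|)%:E <=
         \int[lebesgue_measure]_(s in `[0%R, fine (curve_length gam a b)])
            g (gt s))%E.

Definition poincare (p : R) : Prop :=
  exists2 CP : R, 0 < CP & exists2 sig : R, 1 <= sig &
  forall (x : X) (r : R), 0 < r ->
  forall u : X -> R, mu.-integrable (dball d x (sig * r)) (EFin \o u) ->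
  forall g : X -> \bar R, upper_gradient (dball d x (sig * r)) u g ->
  let B := dball d x r in
  let sB := dball d x (sig * r) in
  let uB := fine (\int[mu]_(y in B) (u y)%:E) / fine (mu B) in
  ((fine (mu B))^-1%:E * \int[mu]_(y in B) (`|u y - uB|)%:E <=
    CP%:E * diamE d B *
    poweR ((fine (mu sB))^-1%:E * \int[mu]_(y in sB) poweR (g y) p) p^-1)%E.

Definition nagata_prop (n : nat) : Prop :=
  exists2 C : R, 0 < C & forall s : R, 0 < s ->
  exists F : set (set X),
    (forall x, exists A, F A /\ A x) /\
    (forall A, F A -> forall x y, A x -> A y -> d x y <= C * s) /\
    (forall x (f : 'I_(n.+2) -> set X), injective f -> (forall i, F (f i)) ->
        exists i, f i `&` dball d x s = set0).

(* dim_N X <= n  (dim_N X is the least integer with nagata_prop) *)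
Definition nagata_dim_le (n : nat) : Prop :=
  exists m : nat, (m <= n)%N /\ nagata_prop m.

Definition strongly_measurable (V : normedModType R) (u : X -> V) : Prop :=
  exists s : nat -> X -> V,
    (forall k, finite_set (range (s k)) /\
               forall v, measurable (s k @^-1` [set v])) /\
    {ae mu, forall x, (s ^~ x) @ \oo --> u x}.

Definition Lp_normV (p : R) (V : normedModType R) (u : X -> V) : \bar R :=
  poweR (\int[mu]_x ((`|u x| `^ p)%:E)) p^-1.

Definition Lp_normE (p : R) (g : X -> \bar R) : \bar R :=
  poweR (\int[mu]_x poweR (g x) p) p^-1.

Definition in_Lp (p : R) (V : normedModType R) (u : X -> V) : Prop :=
  strongly_measurable u /\ (\int[mu]_x ((`|u x| `^ p)%:E) < +oo)%E.

Definition in_N1p (p : R) (V : normedModType R) (u : X -> V) : Prop :=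
  in_Lp p u /\ exists g, upper_gradient setT u g /\
     (\int[mu]_x poweR (g x) p < +oo)%E.

Definition N1p_norm (p : R) (V : normedModType R) (u : X -> V) : \bar R :=
  (Lp_normV p u +
   ereal_inf [set z | exists g, upper_gradient setT u g /\ z = Lp_normE p g])%E.

Definition in_N1pY (p : R) (Y : Type) (V : normedModType R) (lam : Y -> V)
    (u : X -> Y) : Prop := in_N1p p (lam \o u).

Definition N1pY_dist (p : R) (Y : Type) (V : normedModType R) (lam : Y -> V)
    (u v : X -> Y) : \bar R :=
  N1p_norm p (fun x => lam (u x) - lam (v x)).

Definition lip_dense (p : R) (Y : Type) (dY : Y -> Y -> R)
    (V : normedModType R) (lam : Y -> V) : Prop :=
  forall u : X -> Y, in_N1pY p lam u ->
  forall e : R, 0 < e ->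
  exists f : X -> Y, lipschitz d dY f /\ in_N1pY p lam f /\
    (N1pY_dist p lam u f < e%:E)%E.

End MM.

Definition eucl (k : nat) (v : 'rV[R]_k) : R :=
  Num.sqrt (\sum_(i < k) v ord0 i ^+ 2).

Definition sphere (k : nat) : set 'rV[R]_(k.+1) := [set v | eucl v = 1].
Definition cball (k : nat) : set 'rV[R]_(k.+1) := [set v | eucl v <= 1].

Definition lip_connected (Y : Type) (dY : Y -> Y -> R) (m : nat) : Prop :=
  exists2 gam : R, 1 <= gam &
  forall k : nat, (k <= m)%N ->
  forall (L : R) (f : 'rV[R]_(k.+1) -> Y),
    (forall v w, @sphere k v -> @sphere k w -> dY (f v) (f w) <= L * eucl (v - w)) ->
    exists F : 'rV[R]_(k.+1) -> Y,
      (forall v, @sphere k v -> F v = f v) /\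
      (forall v w, @cball k v -> @cball k w ->
          dY (F v) (F w) <= gam * L * eucl (v - w)).

End Defs.

(* Main.v *)
(* Let u be in N^{1,p}(X, Y) with upper gradient g. By the Poincare inequality,
   telescoping over dyadic balls, u is C t-Lipschitz off the set where some
   average of g^p exceeds t^p; by the Vitali covering argument this bad set has
   measure o(t^-p), so by inner regularity u is C t-Lipschitz on a closed set F
   with t^p mu(X \ F) -> 0.

   Since dim_N X <= n, the complement of F has a Whitney decomposition in n+1
   colours. It maps X \ F to a cubical complex of dimension at most n (points t
   with values in [0, 1], some coordinate equal to 1), whose cells can be filled
   in Y one dimension at a time by Lipschitz (n-1)-connectedness. Hence u
   restricted to F extends to a C' t-Lipschitz map f : X -> Y.

   As f = u on the closed set F, (g + C' t) 1_{X \ F} is an upper gradient of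
   u - f, and its p-energy is at most a multiple of the integral of g^p over
   X \ F plus t^p mu(X \ F), which tends to 0. *)
Require Import Defs.
From HB Require Import structures.
From mathcomp Require Import all_boot all_order all_algebra.
From mathcomp Require Import all_classical all_reals all_analysis measurable_realfun.
From mathcomp Require Import ring lra.
Set Implicit Arguments.
Unset Strict Implicit.
Unset Printing Implicit Defensive.
Import Order.TTheory GRing.Theory Num.Theory.
Import numFieldNormedType.Exports.
Local Open Scope classical_set_scope.
Local Open Scope ring_scope.

(** * Filling cubes *)

(** The target [Y] has no linear structure, so [u] itself cannot be averaged. The averages are those
    of the scalar functions dY(u, z_m), with z_m dense in [Y]. They all have the upper gradient g,
    so one bad set serves every m, and letting z_m approach u(y) recovers dY(u(x), u(y)). The
    extension from F has a uniform constant because two scales cancel: the values at the vertices of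
    the cell of x spread over about L dist(x, F), while the coordinates of the complex have
    Lipschitz constant about 1 / dist(x, F). Hence one filling map has to be Lipschitz on each cell
    with a constant proportional to the spread of that very cell. The number of colours matters: out
    of n+1 coordinates one is frozen at 1, at most n are free, and only spheres of dimension at most
    n-1 get filled. Small energy of u - f does not make its L^p norm small. For that |lam f| must be
    at most a constant times t; Chebyshev's inequality provides a point of F where |lam u| <= t, and
    the Lipschitz bound and the finite diameter carry this to all of X. *)

Section Regauge.
Variables (R : realType) (V : normedModType R).

(** A radial map: if [P] and [Q] are positively homogeneous, then [Q] at the image of [x] equals
    [P x], so the unit sphere of [P] goes to that of [Q]. *)
Definition regauge (P Q : V -> R) (x : V) : V := (P x / Q x) *: x.

(** The difference splits into the changes of [P], of [Q] and of the vector, which contribute c, c^2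
    and c. The origin, where the quotient degenerates, is treated apart through the bound c |x| on
    the image. *)
Lemma regauge_lipschitz (c : R) (P Q : V -> R) : 0 <= c ->
  (forall x, 0 <= P x <= c * `|x|) -> (forall x, `|x| <= Q x) ->
  (forall x y, `|P x - P y| <= c * `|x - y|) ->
  (forall x y, `|Q x - Q y| <= c * `|x - y|) ->
  forall x y, `|regauge P Q x - regauge P Q y| <= (c * (c + 2)) * `|x - y|.
Proof.
move=> c0 P0 Q0 Pl Ql.
have reg_le x : `|regauge P Q x| <= c * `|x|.
  have [->|x0] := eqVneq x 0; first by rewrite /regauge scaler0 normr0 mulr0.
  have Nx : 0 < `|x| by rewrite normr_gt0.
  have Qx : 0 < Q x by apply: lt_le_trans (Q0 x).
  have /andP[Px Pc] := P0 x.
  rewrite /regauge normrZ ger0_norm; last by rewrite divr_ge0 // ltW.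
  apply: le_trans Pc; rewrite mulrAC ler_pdivrMr //.
  exact: ler_wpM2l.
move=> x y; have [->|x0] := eqVneq x 0.
  rewrite {1}/regauge scaler0 !sub0r !normrN; apply: le_trans (reg_le y) _.
  by apply: ler_wpM2r => //; nra.
have [->|y0] := eqVneq y 0.
  rewrite {2}/regauge scaler0 !subr0; apply: le_trans (reg_le x) _.
  by apply: ler_wpM2r => //; nra.
have Nx : 0 < `|x| by rewrite normr_gt0.
have Ny : 0 < `|y| by rewrite normr_gt0.
have Qx : 0 < Q x by apply: lt_le_trans (Q0 x).
have Qy : 0 < Q y by apply: lt_le_trans (Q0 y).
have /andP[Px Pcx] := P0 x; have /andP[Py Pcy] := P0 y.
have -> : regauge P Q x - regauge P Q y = ((P x - P y) / Q x) *: x +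
   ((P y / Q y) * ((Q y - Q x) / Q x)) *: x + (P y / Q y) *: (x - y).
  rewrite /regauge scalerBr addrA -!scalerDl; congr (_ *: _ - _).
  by field; rewrite !gt_eqF.
have Px1 : `|x| / Q x <= 1 by rewrite ler_pdivrMr // mul1r.
have Py1 : P y / Q y <= c.
  by rewrite ler_pdivrMr //; apply: le_trans Pcy _; apply: ler_wpM2l.
have Py0 : 0 <= P y / Q y by rewrite divr_ge0 // ltW.
have nx0 : 0 <= `|x| / Q x by rewrite divr_ge0 // ltW.
have Qi : `|(Q x)^-1| = (Q x)^-1 by rewrite ger0_norm // invr_ge0 ltW.
apply: le_trans (ler_normD _ _) _.
have -> : c * (c + 2) * `|x - y| = (c * `|x - y| + c * (c * `|x - y|)) + c * `|x - y|.
  by ring.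
apply: lerD; last by rewrite normrZ ger0_norm //; apply: ler_wpM2r.
apply: le_trans (ler_normD _ _) _; apply: lerD.
  rewrite normrZ normrM Qi -mulrA [_^-1 * _]mulrC.
  rewrite -[leRHS]mulr1; apply: ler_pM => //.
rewrite normrZ !normrM Qi -/(P y / Q y) -!mulrA [_^-1 * `|x|]mulrC mulrA.
rewrite -normrM (ger0_norm Py0); apply: (ler_pM Py0 _ Py1); first exact: mulr_ge0.
rewrite -[leRHS]mulr1; apply: ler_pM => //.
by apply: le_trans (Ql _ _) _; rewrite distrC.
Qed.

End Regauge.

Section RowVectors.
Variables (R : realType) (k : nat).
Implicit Types v w : 'rV[R]_k.+1.

Lemma coord_le_norm v (i : 'I_k.+1) : `|v ord0 i| <= `|v|.
Proof.
rewrite [leRHS]mx_normrE.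
exact: (@le_bigmax _ _ _ 0 (fun ij : 'I_1 * 'I_k.+1 => `|v ij.1 ij.2|) (ord0, i)).
Qed.

Lemma norm_le_coord v (e : R) : 0 <= e ->
  (forall i, `|v ord0 i| <= e) -> `|v| <= e.
Proof.
move=> e0 H; rewrite [leLHS]mx_normrE; apply: bigmax_le => // -[i j] _ /=.
by rewrite ord1.
Qed.

Lemma norm_attained v : exists i, `|v| = `|v ord0 i|.
Proof.
have [/eqP|v0] := eqVneq (`|v|) 0.
  by rewrite normr_eq0 => /eqP ->; exists ord0; rewrite normr0 mxE normr0.
by have [[i j] /= E] := mx_norm_neq0 v0; exists j; rewrite [LHS]E ord1.
Qed.

Lemma coord_le_eucl v i : `|v ord0 i| <= eucl v.
Proof.
rewrite -sqrtr_sqr ler_wsqrtr // (bigD1 i) //= lerDl sumr_ge0 // => j _.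
exact: sqr_ge0.
Qed.

Lemma eucl_ge0 v : 0 <= eucl v. Proof. exact: sqrtr_ge0. Qed.

Lemma norm_le_eucl v : `|v| <= eucl v.
Proof. by apply: norm_le_coord; [exact: eucl_ge0 | exact: coord_le_eucl]. Qed.

Lemma sqr_eucl v : eucl v ^+ 2 = \sum_(i < k.+1) v ord0 i ^+ 2.
Proof. by rewrite sqr_sqrtr // sumr_ge0 // => j _; exact: sqr_ge0. Qed.

Lemma eucl0 : eucl (0 : 'rV[R]_k.+1) = 0.
Proof. by rewrite /eucl big1 ?sqrtr0 // => i _; rewrite mxE expr0n. Qed.

(** Multiplication by eucl v + eucl w produces a difference of squares, which is estimated
    coordinate by coordinate. *)
Lemma eucl_lipschitz v w : `|eucl v - eucl w| <= k.+1%:R * `|v - w|.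
Proof.
have a0 := eucl_ge0 v; have b0 := eucl_ge0 w.
have [s0|s0] := leP (eucl v + eucl w) 0.
  have -> : eucl v - eucl w = 0 by lra.
  by rewrite normr0 mulr_ge0.
rewrite -(ler_pM2r s0) -[X in _ * X <= _](gtr0_norm s0) -normrM -subr_sqr.
rewrite !sqr_eucl -sumrB.
apply: le_trans (ler_norm_sum _ _ _) _.
have -> : k.+1%:R * `|v - w| * (eucl v + eucl w) =
   \sum_(i < k.+1) (`|v - w| * (eucl v + eucl w)).
  by rewrite sumr_const card_ord -mulrA mulr_natl.
apply: ler_sum => i _; rewrite subr_sqr normrM; apply: ler_pM => //.
  by apply: le_trans (coord_le_norm _ i); rewrite !mxE.
by apply: le_trans (ler_normD _ _) _; apply: lerD; exact: coord_le_eucl.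
Qed.

Lemma eucl_le_norm v : eucl v <= k.+1%:R * `|v|.
Proof.
have := eucl_lipschitz v 0; rewrite eucl0 !subr0 ger0_norm //; exact: eucl_ge0.
Qed.

Lemma euclZ (a : R) v : 0 <= a -> eucl (a *: v) = a * eucl v.
Proof.
move=> a0; rewrite /eucl -[X in X * _](ger0_norm a0) -sqrtr_sqr -sqrtrM ?sqr_ge0 //.
by rewrite mulr_sumr; congr Num.sqrt; apply: eq_bigr => i _; rewrite mxE exprMn.
Qed.

End RowVectors.

Section Filling.
Variables (R : realType) (Y : Type) (dY : Y -> Y -> R).
Hypothesis dYm : is_metric dY.

(** Passes from Euclidean balls to balls of the maximum norm, which are cubes. [Phi] carries the
    latter ball to the former and [Psi] inverts it on the sphere; both have a Lipschitz constant
    that depends on m only. *)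
Lemma fill_norm_ball (m : nat) : lip_connected dY m ->
  exists2 K : R, 0 <= K & forall k, (k <= m)%N -> forall L : R, 0 <= L ->
  forall f : 'rV[R]_k.+1 -> Y,
  (forall v w, `|v| = 1 -> `|w| = 1 -> dY (f v) (f w) <= L * `|v - w|) ->
  exists F : 'rV[R]_k.+1 -> Y, (forall v, `|v| = 1 -> F v = f v) /\
   forall v w, `|v| <= 1 -> `|w| <= 1 -> dY (F v) (F w) <= K * L * `|v - w|.
Proof.
move=> [gam gam1 H]; pose c : R := m.+1%:R; pose A := c * (c + 2).
have c1 : 1 <= c by rewrite /c ler1n.
have c0 : 0 <= c := le_trans ler01 c1.
have A0 : 0 <= A by rewrite /A mulr_ge0 ?addr_ge0.
exists (gam * A * (c * A)); first by rewrite mulr_ge0 ?mulr_ge0 //; lra.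
move=> k km L L0 f fL.
have kc : k.+1%:R <= c by rewrite /c ler_nat.
pose N := fun v : 'rV[R]_k.+1 => `|v|; pose M := @eucl R k.+1.
have NP (v : 'rV[R]_k.+1) : 0 <= N v <= c * `|v|.
  by apply/andP; split; [exact: normr_ge0 | exact: (ler_peMl (normr_ge0 _) c1)].
have MP (v : 'rV[R]_k.+1) : 0 <= M v <= c * `|v|.
  rewrite eucl_ge0 /=; apply: le_trans (eucl_le_norm _) _.
  exact: ler_wpM2r.
have Nl (v w : 'rV[R]_k.+1) : `|N v - N w| <= c * `|v - w|.
  apply: le_trans (ler_dist_dist _ _) _; exact: (ler_peMl (normr_ge0 _) c1).
have Ml (v w : 'rV[R]_k.+1) : `|M v - M w| <= c * `|v - w|.
  by apply: le_trans (eucl_lipschitz _ _) _; apply: ler_wpM2r.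
pose Psi := regauge M N; pose Phi := regauge N M.
have PsiL : forall v w, `|Psi v - Psi w| <= A * `|v - w|.
  exact: regauge_lipschitz.
have PhiL : forall v w, `|Phi v - Phi w| <= A * `|v - w|.
  apply: regauge_lipschitz => //.
  exact: norm_le_eucl.
have N0 (v : 'rV[R]_k.+1) : v != 0 -> 0 < N v by rewrite normr_gt0.
have M0 (v : 'rV[R]_k.+1) : v != 0 -> 0 < M v.
  move=> v0; apply: lt_le_trans (N0 _ v0) _; exact: norm_le_eucl.
have NPsi (v : 'rV[R]_k.+1) : M v = 1 -> `|Psi v| = 1.
  move=> Mv; have v0 : v != 0.
    by apply/eqP => v0; move: Mv; rewrite v0 /M eucl0 => /esym/eqP; rewrite oner_eq0.
  have Nv := N0 _ v0.
  rewrite /Psi /regauge normrZ Mv div1r ger0_norm ?invr_ge0 ?ltW //.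
  by rewrite mulVf // gt_eqF.
have MPhi (v : 'rV[R]_k.+1) : M (Phi v) = `|v|.
  have [->|v0] := eqVneq v 0; first by rewrite /Phi /regauge scaler0 /M eucl0 normr0.
  rewrite /Phi /regauge /M euclZ; last exact: (divr_ge0 (normr_ge0 _) (eucl_ge0 _)).
  by rewrite divfK // gt_eqF // -/(M v) M0.
have PsiPhi (u : 'rV[R]_k.+1) : `|u| = 1 -> Psi (Phi u) = u.
  move: u => v.
  move=> Nv; have v0 : v != 0.
    by apply/eqP => v0; move: Nv; rewrite v0 normr0 => /esym/eqP; rewrite oner_eq0.
  have Mv := M0 _ v0.
  have E : Phi v = (M v)^-1 *: v by rewrite /Phi /regauge /N Nv div1r.
  have NE : `|Phi v| = (M v)^-1.
    by rewrite E normrZ Nv mulr1 ger0_norm // invr_ge0 ltW.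
  rewrite /Psi /regauge MPhi Nv /N NE E scalerA div1r invrK mulfV ?scale1r //.
  by rewrite gt_eqF.
have [v w v1 w1|G [Gf GL]] := H k km (L * A) (f \o Psi).
  apply: le_trans (fL _ _ (NPsi _ v1) (NPsi _ w1)) _.
  rewrite -mulrA ler_wpM2l //; apply: le_trans (PsiL _ _) _.
  by rewrite ler_wpM2l // norm_le_eucl.
exists (G \o Phi); split => [v v1 /=|v w v1 w1].
  by rewrite Gf /sphere /= ?PsiPhi //; rewrite -[eucl _]/(M _) MPhi.
apply: le_trans (GL _ _ _ _) _; rewrite /cball /= -?[eucl _]/(M _) ?MPhi //.
have -> : gam * A * (c * A) * L * `|v - w| = gam * (L * A) * (c * (A * `|v - w|)).
  by ring.
rewrite ler_wpM2l //; first by rewrite mulr_ge0 ?mulr_ge0 //; lra.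
have /andP[_ E] := MP (Phi v - Phi w); apply: le_trans E _.
by rewrite ler_wpM2l //; lra.
Qed.

Definition unit_cube k : set 'rV[R]_k := [set v | forall i, 0 <= v ord0 i <= 1].

Definition cube_bd k : set 'rV[R]_k :=
  [set v | unit_cube v /\ exists i, v ord0 i = 0 \/ v ord0 i = 1].

(** The maximum distance enters through its upper bounds [e]; the same form then applies to points
    with infinitely many coordinates. *)
Definition lip_on_bd k (L : R) (f : 'rV[R]_k -> Y) := forall v w,
  cube_bd v -> cube_bd w -> forall e : R, (forall i, `|v ord0 i - w ord0 i| <= e) ->
  dY (f v) (f w) <= L * e.

(* A filling which is optimal up to the factor K: the same F serves every
   Lipschitz constant L of f. *)
Lemma fill_cube (m : nat) : lip_connected dY m ->
  exists2 K : R, 0 <= K & forall k, (k <= m)%N -> forall f : 'rV[R]_k.+1 -> Y,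
  exists F : 'rV[R]_k.+1 -> Y, forall L : R, 0 <= L -> lip_on_bd L f ->
   (forall v, cube_bd v -> F v = f v) /\
   forall v w, unit_cube v -> unit_cube w ->
     forall e : R, (forall i, `|v ord0 i - w ord0 i| <= e) ->
     dY (F v) (F w) <= K * L * e.
Proof.
have [d0 [dE [dS dT]]] := dYm.
move=> /fill_norm_ball[K K0 H]; exists K => // k km f.
have [noL|] := pselect (forall L, 0 <= L -> ~ lip_on_bd L f).
  by exists f => L L0 /(noL _ L0).
move=> /existsNP[L1 /not_implyP[L10 /contrapT L1f]].
pose E := [set L | 0 <= L /\ lip_on_bd L f].
have infE : has_inf E by split; [exists L1 | exists 0 => L []].
(* The infimum of the admissible constants is itself admissible, so a filling made for [L0] serves
   every admissible [L]. *)
pose L0 := inf E.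
have L00 : 0 <= L0 by apply: lb_le_inf; [exists L1 | move=> L []].
have L0f : lip_on_bd L0 f.
  move=> v w bv bw e ve.
  have e0 : 0 <= e by apply: le_trans (ve ord0).
  have [e1|e1] := eqVneq e 0.
    by have := L1f v w bv bw e ve; rewrite e1 !mulr0.
  have ep : 0 < e by rewrite lt_neqAle eq_sym e1.
  rewrite -ler_pdivrMr //; apply: lb_le_inf; first by exists L1.
  by move=> L [_ /(_ v w bv bw e ve)]; rewrite -ler_pdivrMr.
pose up (u : 'rV[R]_k.+1) : 'rV[R]_k.+1 := \row_i ((u ord0 i + 1) / 2).
pose dn (v : 'rV[R]_k.+1) : 'rV[R]_k.+1 := \row_i (2 * v ord0 i - 1).
have dnK v : up (dn v) = v by apply/rowP => i; rewrite !mxE; field.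
have up_bd u : `|u| = 1 -> cube_bd (up u).
  move=> u1; have ui i : `|u ord0 i| <= 1 by rewrite -u1 coord_le_norm.
  split => [i|].
    by have := ui i; rewrite !mxE ler_norml => /andP[? ?]; apply/andP; split; lra.
  have [i E1] := norm_attained u; exists i; rewrite !mxE.
  move: E1; rewrite u1 => /esym/eqP; rewrite eqr_norml => /andP[/orP[] /eqP -> _].
    by right; lra.
  by left; lra.
have dn1 v : unit_cube v -> `|dn v| <= 1.
  move=> uv; apply: norm_le_coord => // i; rewrite mxE ler_norml.
  by have /andP[? ?] := uv i; apply/andP; split; lra.
have dn_bd v : cube_bd v -> `|dn v| = 1.
  move=> [uv [i vi]]; apply/eqP; rewrite eq_le dn1 //=.
  apply: le_trans (coord_le_norm _ i); rewrite mxE.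
  case: vi => ->; first by rewrite mulr0 sub0r normrN normr1.
  by rewrite mulr1 ger0_norm; lra.
(* [up] halves distances, hence the constant L0 / 2; [dn] doubles them again, so the factor [K] is
   kept. *)
have [||F' [F'f F'L]] := H k km (L0 / 2) _ (f \o up).
  by rewrite divr_ge0.
  move=> v w v1 w1 /=; rewrite -mulrA; apply: L0f; [exact: up_bd|exact: up_bd|].
  move=> i; rewrite !mxE -mulrBl normrM (@ger0_norm _ (2^-1)) // mulrC.
  apply: ler_wpM2l => //; apply: le_trans (coord_le_norm _ i); rewrite !mxE.
  by rewrite opprD addrACA subrr addr0.
exists (F' \o dn) => L L_ge0 Lf; split => [v bv /=|v w uv uw e ve].
  by rewrite F'f ?dn_bd //= dnK.
apply: le_trans (F'L _ _ (dn1 _ uv) (dn1 _ uw)) _.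
have L0L : L0 <= L by apply: (inf_lbound (proj2 infE)).
have e0 : 0 <= e by apply: le_trans (ve ord0).
have ne : `|dn v - dn w| <= 2 * e.
  apply: norm_le_coord; first by rewrite mulr_ge0.
  move=> i; rewrite !mxE opprB addrA subrK -mulrBr normrM ger0_norm //.
  exact: ler_wpM2l.
apply: le_trans (ler_wpM2l _ ne) _; first by rewrite mulr_ge0 ?divr_ge0.
have -> : K * (L0 / 2) * (2 * e) = K * L0 * e by field.
by rewrite ler_wpM2r // ler_wpM2l.
Qed.

End Filling.

(** * Lipschitz maps on a cubical complex, built skeleton by skeleton *)

Section Skeleton.
Variables (R : realType) (Y : Type) (dY : Y -> Y -> R).
Hypothesis dYm : is_metric dY.
Variables (I : eqType) (d0 : I) (v : I -> Y).
Implicit Types (b t : I -> R) (s : seq I).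

(* The cube with vertices indexed by I: coordinates in s are free, the others
   are frozen at the 0/1 values of b, at least one of them at 1. *)
Definition cell b s : set (I -> R) :=
  [set t | forall i, if i \in s then is_true (0 <= t i <= 1) else t i = b i].

Definition cell_supp b s i := i \in s \/ b i = 1.

Definition cell_ok b s := [/\ uniq s, forall i, i \notin s -> b i = 0 \/ b i = 1 &
  exists2 i, i \notin s & b i = 1].

Definition cell_spread b s (W : R) := forall i j,
  cell_supp b s i -> cell_supp b s j -> dY (v i) (v j) <= W.

(** Both bounds scale with the spread [W] of the single cell. The second one, closeness to the
    vertex values, is what compares opposite faces in the induction. *)
Definition skeleton_map (k : nat) (C : R) (h : (I -> R) -> Y) :=
  forall b s W, cell_ok b s -> (size s <= k)%N -> cell_spread b s W ->
  (forall t t', cell b s t -> cell b s t' ->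
     forall e : R, (forall i, `|t i - t' i| <= e) -> dY (h t) (h t') <= C * W * e) /\
  (forall t i, cell b s t -> cell_supp b s i -> dY (h t) (v i) <= C * W).

(** A cell without free coordinates is a single 0/1 point; any index with value 1 may supply the
    value of [h], since two such choices differ by at most [W]. *)
Lemma skeleton_map0 : exists h, skeleton_map 0 1 h.
Proof.
have [dge [dE [dS dT]]] := dYm.
have [h hP] : {h : (I -> R) -> Y & forall t, (exists i, t i = 1) ->
    exists2 i, t i = 1 & h t = v i}.
  apply: (@choice _ _ (fun t y => (exists i, t i = 1) -> exists2 i, t i = 1 & y = v i)).
  move=> t; have [[i ti]|n] := pselect (exists i, t i = 1).
    by exists (v i) => _; exists i.
  by exists (v d0) => /n.
exists h => b s W [us b01 [i0 i0s bi0]]; rewrite leqn0 => /nilP s0 sp.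
subst s; have tb t : cell b [::] t -> t = b by move=> bt; apply/funext => i; exact: bt.
split=> [t t' /tb -> /tb -> e te|t i /tb -> si].
  rewrite (proj2 (dE _ _) (erefl _)) mul1r mulr_ge0 //.
    by apply: le_trans (dge _ _) (sp i0 i0 _ _); right.
  by apply: le_trans (te i0).
by have [|j bj ->] := hP b; [exists i0 | rewrite mul1r; apply: sp => //; right].
Qed.

(** The boundary map of a cell has constant 2 C W, so its filling has constant K (2 C) W. The extra
    C is the distance from a face to the vertex values. *)
Lemma skeleton_mapS (k : nat) (K C : R) (h : (I -> R) -> Y) : 0 <= K -> 0 <= C ->
  (forall f : 'rV[R]_k.+1 -> Y,
  exists F : 'rV[R]_k.+1 -> Y, forall L : R, 0 <= L -> lip_on_bd dY L f ->
   (forall v, cube_bd v -> F v = f v) /\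
   forall v w, unit_cube v -> unit_cube w ->
     forall e : R, (forall i, `|v ord0 i - w ord0 i| <= e) ->
     dY (F v) (F w) <= K * L * e) ->
  skeleton_map k C h -> exists h', skeleton_map k.+1 (K * (2 * C) + C) h'.
Proof.
have [dge [dE [dS dT]]] := dYm.
move=> K0 C0 fillK Hh.
have [FF FFP] := choice fillK.
(* One fixed enumeration for each finite set of free coordinates, so that the filling depends on the
   cell and not on the list presenting it. *)
have [en enP] : {en : set I -> seq I & forall A, (exists s, uniq s /\ forall i, i \in s <-> A i) ->
    uniq (en A) /\ forall i, i \in en A <-> A i}.
  apply: (@choice _ _ (fun A s => (exists s, uniq s /\ forall i, i \in s <-> A i) ->
    uniq s /\ forall i, i \in s <-> A i)) => A.
  have [[s sP]|n] := pselect (exists s, uniq s /\ forall i, i \in s <-> A i).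
    by exists s.
  by exists [::] => /n.
pose free t := [set i | 0 < t i < 1].
pose phi b s (x : 'rV[R]_k.+1) : I -> R :=
  fun i => if i \in s then x ord0 (inord (index i s)) else b i.
pose psi s t : 'rV[R]_k.+1 := \row_j t (nth d0 s j).
(* Free coordinates are reset to 0, so that all points of an open cell hand the same map to [FF]. *)
pose base t : I -> R := fun i => if `[< free t i >] then 0 else t i.
pose h' t := if `[< size (en (free t)) = k.+1 /\ uniq (en (free t)) /\
                   forall i, i \in en (free t) <-> free t i >]
  then FF (h \o phi (base t) (en (free t))) (psi (en (free t)) t) else h t.
have free_sub b s t : cell_ok b s -> cell b s t -> free t `<=` [set` s].
  move=> [us b01 _] bt i fi /=; apply: contrapT => /negP ni.
  have := bt i; rewrite (negbTE ni) => E; move: fi; rewrite /free /= E.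
  by have [->|->] := b01 _ ni; rewrite ltxx ?andbF.
have h'low b s t : cell_ok b s -> cell b s t ->
    ((size s <= k)%N \/ (size s = k.+1 /\ exists2 i, i \in s & ~ free t i)) -> h' t = h t.
  move=> ok bt S; rewrite /h'; case: asboolP => // -[sz [u mem]]; exfalso.
  have sub : {subset en (free t) <= s}.
    by move=> i /mem fi; exact: (free_sub _ _ _ ok bt i fi).
  case: S => [sk|[sk [i si nf]]].
    have := uniq_leq_size u sub; rewrite sz => /leq_trans /(_ sk).
    by rewrite ltnn.
  have [_ eqm] := uniq_min_size u sub (eq_leq (etrans sk (esym sz))).
  by apply: nf; apply/mem; rewrite eqm.
have W0 b s W : cell_ok b s -> cell_spread b s W -> 0 <= W.
  by move=> [_ _ [i _ bi]] sp; apply: le_trans (dge _ _) (sp i i _ _); right.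
exists h' => b s W ok sk sp; have Wge := W0 _ _ _ ok sp.
have CC : C <= K * (2 * C) + C by rewrite lerDr mulr_ge0 // mulr_ge0.
move: sk; rewrite leq_eqVlt => /orP[/eqP sk|]; last first.
  rewrite ltnS => sk; have [H1 H2] := Hh b s W ok sk sp; split.
    move=> t t' bt bt' e te.
    have [i0 _ _] : exists2 i, i \notin s & b i = 1 by case: ok.
    rewrite (h'low _ _ _ ok bt) ?(h'low _ _ _ ok bt'); try by left.
    apply: le_trans (H1 _ _ bt bt' e te) _; rewrite -!mulrA ler_wpM2r //.
    by rewrite mulr_ge0 //; exact: le_trans (te i0).
  move=> t i bt si; rewrite (h'low _ _ _ ok bt); last by left.
  by apply: le_trans (H2 _ _ bt si) _; rewrite ler_wpM2r.
have [us b01 [i0 i0s bi0]] := ok.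
pose s0 := en [set` s]; pose b0 i : R := if i \in s then 0 else b i.
have [us0 ms0] : uniq s0 /\ forall i, i \in s0 <-> i \in s.
  by apply: (enP [set` s]); exists s.
have eqs i : (i \in s0) = (i \in s) by apply/idP/idP => /ms0.
have sz0 : size s0 = k.+1.
  by rewrite -sk; apply: perm_size; apply: uniq_perm => // i; rewrite eqs.
have idx (i : I) : i \in s0 -> nth d0 s0 (@inord k (index i s0)) = i.
  by move=> si; rewrite inordK ?nth_index // -sz0 index_mem.
have idx2 (a : 'I_k.+1) : @inord k (index (nth d0 s0 a) s0) = a.
  by rewrite index_uniq ?sz0 // inord_val.
have memn (a : 'I_k.+1) : nth d0 s0 a \in s0 by rewrite mem_nth // sz0.
have phipsi t : cell b s t -> phi b0 s0 (psi s0 t) = t.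
  move=> bt; apply/funext => i; rewrite /phi eqs; case: ifPn => si.
    by rewrite mxE idx // eqs.
  by have := bt i; rewrite (negbTE si) /b0 (negbTE si).
have psiu t : cell b s t -> unit_cube (psi s0 t).
  by move=> bt a; have := bt (nth d0 s0 a); rewrite -eqs memn mxE.
have phicell (x : 'rV[R]_k.+1) : unit_cube x -> cell b s (phi b0 s0 x).
  move=> ux i; rewrite /phi /b0 eqs; case: (boolP (i \in s)) => si; [exact: ux | by []].
pose bb (a : 'I_k.+1) (al : R) i := if i == nth d0 s0 a then al else b0 i.
pose ss (a : 'I_k.+1) := rem (nth d0 s0 a) s0.
have szs a : (size (ss a) <= k)%N by rewrite size_rem ?memn // sz0.
have mss a i : (i \in ss a) = (i != nth d0 s0 a) && (i \in s).
  by rewrite mem_rem_uniq // inE -eqs.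
have face_ok a al : al = 0 \/ al = 1 -> cell_ok (bb a al) (ss a).
  move=> al01; split; first exact: rem_uniq.
    move=> i; rewrite mss /bb; case: eqP => //= _ ni.
    by rewrite /b0 (negbTE ni); exact: b01.
  exists i0; first by rewrite mss (negbTE i0s) andbF.
  rewrite /bb /b0 (negbTE i0s); case: eqP => // E.
  by move: i0s; rewrite E -eqs memn.
have face_supp a al i : al = 0 \/ al = 1 -> cell_supp (bb a al) (ss a) i -> cell_supp b s i.
  move=> al01; rewrite /cell_supp mss /bb /b0; case: eqP => [->|_] /=.
    by left; rewrite -eqs memn.
  by case: (i \in s) => /=; [left | right; case: H].
have face_spread a al : al = 0 \/ al = 1 -> cell_spread (bb a al) (ss a) W.
  by move=> al01 i j si sj; apply: sp; apply: face_supp; eassumption.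
have face_cell (a : 'I_k.+1) (al : R) (x : 'rV[R]_k.+1) : unit_cube x -> x ord0 a = al -> cell (bb a al) (ss a) (phi b0 s0 x).
  move=> ux xa i; rewrite mss /bb; case: eqP => [->|_] /=.
    by rewrite /phi memn idx2.
  by have := phicell _ ux i; rewrite /b0; case: ifP.
have phi_dist (x y : 'rV[R]_k.+1) (e : R) : (forall i, `|x ord0 i - y ord0 i| <= e) ->
    forall i, `|phi b0 s0 x i - phi b0 s0 y i| <= e.
  move=> xy i; rewrite /phi; case: ifP => // _.
  by rewrite subrr normr0; exact: le_trans (xy ord0).
have face_lip (a : 'I_k.+1) (x y : 'rV[R]_k.+1) (e : R) : (x ord0 a = 0 \/ x ord0 a = 1) -> unit_cube x -> unit_cube y ->
    x ord0 a = y ord0 a -> (forall i, `|x ord0 i - y ord0 i| <= e) ->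
    dY (h (phi b0 s0 x)) (h (phi b0 s0 y)) <= C * W * e.
  move=> x01 ux uy xy xye.
  have [H1 _] := Hh _ _ _ (face_ok a _ x01) (szs a) (face_spread a _ x01).
  by apply: H1; [exact: face_cell | exact: face_cell | exact: phi_dist].
have face_far (a : 'I_k.+1) (x : 'rV[R]_k.+1) : (x ord0 a = 0 \/ x ord0 a = 1) -> unit_cube x ->
    dY (h (phi b0 s0 x)) (v i0) <= C * W.
  move=> x01 ux.
  have [_ H2] := Hh _ _ _ (face_ok a _ x01) (szs a) (face_spread a _ x01).
  apply: H2; first exact: face_cell.
  right; rewrite /bb /b0 (negbTE i0s); case: eqP => // E.
  by move: i0s; rewrite E -eqs memn.
have CW0 : 0 <= C * W by rewrite mulr_ge0.
(* Points of a common face cost C W e. If [x] and [y] have different a-th coordinates, both 0 or 1,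
   then e >= 1 and the detour through [v i0] costs 2 C W. Otherwise [z], which is [x] with the c-th
   coordinate of [y], shares a face with each of them. *)
have bdlip : lip_on_bd dY (2 * C * W) (h \o phi b0 s0).
  move=> x y [ux [a xa]] [uy [c yc]] e xye /=.
  have e0 : 0 <= e by apply: le_trans (xye ord0).
  have [xya|xya] := eqVneq (x ord0 a) (y ord0 a).
    apply: le_trans (face_lip a x y e _ _ _ _ _) _ => //.
    by rewrite -!mulrA ler_peMl ?mulr_ge0 // ler1n.
  have [ya|ya] := pselect (y ord0 a = 0 \/ y ord0 a = 1).
    have e1 : 1 <= e.
      apply: le_trans (xye a).
      by case: xa ya xya => -> [] ->; rewrite ?eqxx // ?sub0r ?normrN ?subr0 normr1.
    apply: le_trans (dT _ (v i0) _) _; rewrite [X in _ + X]dS.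
    apply: le_trans (lerD (face_far a x xa ux) (face_far a y ya uy)) _.
    have -> : C * W + C * W = 2 * C * W * 1 by ring.
    by rewrite ler_wpM2l // -mulrA mulr_ge0.
  have ac : a != c by apply: contra_notN ya => /eqP ->.
  pose z : 'rV[R]_k.+1 := \row_j if j == c then y ord0 c else x ord0 j.
  have zc : z ord0 c = y ord0 c by rewrite mxE eqxx.
  have za : z ord0 a = x ord0 a by rewrite mxE (negbTE ac).
  have uz : unit_cube z by move=> j; rewrite mxE; case: ifP.
  apply: le_trans (dT _ (h (phi b0 s0 z)) _) _.
  have -> : 2 * C * W * e = C * W * e + C * W * e by ring.
  apply: lerD.
    apply: (face_lip a) => // j; rewrite mxE; case: eqP => [->|_] //.
    by rewrite subrr normr0.
  apply: (face_lip c) => //; first by rewrite zc.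
  by move=> j; rewrite mxE; case: eqP => [->|_] //; rewrite subrr normr0.
have L0 : 0 <= 2 * C * W by rewrite -mulrA mulr_ge0.
have [Fbd Flip] := FFP (h \o phi b0 s0) _ L0 bdlip.
(* The formula holds on the closed cell: inside by the definition of [h'], on the boundary because
   there the filling agrees with [h]. *)
have h'E t : cell b s t -> h' t = FF (h \o phi b0 s0) (psi s0 t).
  move=> bt; have [[i si nf]|full] := pselect (exists2 i, i \in s & ~ free t i).
    rewrite (h'low _ _ _ ok bt); last by right; split => //; exists i.
    rewrite Fbd /= ?phipsi //; split; first exact: psiu.
    exists (inord (index i s0)); rewrite mxE idx ?eqs //.
    have := bt i; rewrite si => /andP[t0 t1].
    move: nf; rewrite /free /=; move: t0 t1.
    rewrite le_eqVlt => /orP[/eqP <-|t0]; first by left.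
    by rewrite le_eqVlt => /orP[/eqP ->|t1]; [right | rewrite t0 t1].
  have fs : free t = [set` s].
    apply/seteqP; split; first exact: (free_sub _ _ _ ok bt).
    by move=> i /= si; apply: contrapT => nf; apply: full; exists i.
  rewrite /h' fs -/s0 asboolT //.
  have -> // : base t = b0; apply/funext => i; rewrite /base fs /b0 asboolb.
  by have := bt i; case: ifP.
split=> [t t' bt bt' e te|t i bt si].
  have e0 : 0 <= e by apply: le_trans (te i0).
  rewrite !h'E //; apply: le_trans (Flip _ _ (psiu _ bt) (psiu _ bt') e _) _.
    by move=> j; rewrite !mxE.
  apply: ler_wpM2r => //; rewrite [(_ + C) * W]mulrDl; have -> : K * (2 * C * W) = K * (2 * C) * W by ring.
  by rewrite lerDl.
(* The face where a free coordinate equals 1 keeps every index of the support, so [z] on it is close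
   to [v i]; a face with value 0 would lose one index. *)
pose z : 'rV[R]_k.+1 := \row_j if j == ord0 then 1 else psi s0 t ord0 j.
have uz : unit_cube z.
  by move=> j; rewrite mxE; case: ifP => // _; [rewrite ler01 lexx | exact: psiu].
have z0 : z ord0 ord0 = 1 by rewrite mxE eqxx.
have bz : cube_bd z by split => //; exists ord0; right.
apply: le_trans (dT _ (h (phi b0 s0 z)) _) _.
rewrite [(_ + C) * W]mulrDl h'E //; apply: lerD.
  rewrite -[h _]/((h \o phi b0 s0) z) -(Fbd _ bz).
  apply: le_trans (Flip _ _ (psiu _ bt) uz 1 _) _.
    move=> j; rewrite [z _ _]mxE; case: eqP => [->|_]; last by rewrite subrr normr0.
    by have /andP[? ?] := psiu _ bt ord0; rewrite ler_norml; apply/andP; split; lra.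
  by have -> : K * (2 * C * W) * 1 = K * (2 * C) * W by ring.
have o1 : z ord0 ord0 = 0 \/ z ord0 ord0 = 1 by right.
have [_ H2] := Hh _ _ _ (face_ok ord0 _ o1) (szs ord0) (face_spread ord0 _ o1).
apply: H2; first exact: face_cell.
rewrite /cell_supp mss /bb z0; case: eqP => [_|ne] /=; first by right.
rewrite /b0; case: si => [-> |bi]; first by left.
by case: ifP; [left | right].
Qed.

End Skeleton.

(** Passing from dimension k to k+1 fills spheres of dimension k, so [n] steps use only k <= n-1.
    The constant does not depend on the index type, hence not on the decomposition to which it is
    applied. *)
Lemma skeleton_extension (R : realType) (Y : Type) (dY : Y -> Y -> R) (n : nat) :
  is_metric dY -> lip_connected dY n.-1 ->
  exists2 C : R, 0 <= C & forall (I : eqType) (d0 : I) (v : I -> Y),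
  exists h, skeleton_map dY v n C h.
Proof.
move=> dYm /(fill_cube dYm)[K K0 HK].
suff H k : (k <= n)%N -> exists2 C : R, 0 <= C & forall (I : eqType) (d0 : I) (v : I -> Y),
    exists h, skeleton_map dY v k C h by exact: H.
elim: k => [_|k IH kn].
  by exists 1 => // I d0 v; exact: skeleton_map0.
have [C C0 HC] := IH (ltnW kn).
exists (K * (2 * C) + C); first by rewrite addr_ge0 // mulr_ge0 // mulr_ge0.
move=> I d0 v; have [h hP] := HC I d0 v.
apply: (skeleton_mapS dYm d0 K0 C0 _ hP); apply: HK.
by rewrite -ltnS; apply: leq_trans kn (leqSpred n).
Qed.

(** * Coloured covers and Whitney decompositions *)

Section SetDistance.
Variables (R : realType) (X : Type) (d : X -> X -> R).
Hypothesis dm : is_metric d.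
Implicit Types (A : set X) (x y : X).

Definition set_dist A x : R := inf [set d x a | a in A].

Lemma set_dist_has_inf A x : A !=set0 -> has_inf [set d x a | a in A].
Proof.
move=> [a Aa]; split; first by exists (d x a); exists a.
by exists 0 => _ [b _ <-]; case: dm.
Qed.

Lemma set_dist_le A x a : A a -> set_dist A x <= d x a.
Proof.
move=> Aa; apply: inf_lbound; last by exists a.
by case: (@set_dist_has_inf A x) => //; exists a.
Qed.

Lemma set_dist_ge0 A x : A !=set0 -> 0 <= set_dist A x.
Proof.
move=> [a Aa]; apply: lb_le_inf; first by exists (d x a); exists a.
by move=> _ [b _ <-]; case: dm.
Qed.

Lemma set_dist_adherent A x (e : R) : A !=set0 -> 0 < e ->
  exists2 a, A a & d x a < set_dist A x + e.
Proof.
move=> A0 e0; have [_ [a Aa <-] lt] := inf_adherent e0 (set_dist_has_inf x A0).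
by exists a.
Qed.

Lemma set_dist_lipschitz A x y : A !=set0 -> set_dist A x <= d x y + set_dist A y.
Proof.
move=> A0; apply/ler_addgt0Pr => e e0.
have [a Aa lt] := set_dist_adherent y A0 e0.
have [_ [_ [_ dT]]] := dm.
have := set_dist_le x Aa; have := dT x y a; lra.
Qed.

Lemma set_dist_gt0 A x : A !=set0 -> d_open d (~` A) -> ~ A x -> 0 < set_dist A x.
Proof.
move=> [a Aa] oA /oA[r r0 rA]; apply: lt_le_trans r0 _.
apply: lb_le_inf; first by exists (d x a); exists a.
move=> _ [b Ab <-]; rewrite leNgt; apply/negP => lt.
exact: (rA b).
Qed.

End SetDistance.

Section Colouring.
Variables (R : realType) (X : Type) (d : X -> X -> R).

(* A cover by n+1 families of pieces, encoded by the domain D j of the j-th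
   colour together with a label lab j which is constant exactly on pieces. *)
Definition colourable (n : nat) (C : R) := forall s : R, 0 < s ->
  exists (D : nat -> set X) (lab : nat -> X -> set (set X)),
  [/\ forall x, exists2 j, (j <= n)%N & D j x,
      forall j x y, D j x -> D j y -> lab j x = lab j y -> d x y <= C * s &
      forall j x y, D j x -> D j y -> lab j x <> lab j y -> s <= d x y].

End Colouring.

(* The piece of colour j through x is determined by the set of members of the
   cover meeting the ball B(x, (j+1)s), provided B(x, (j+2)s) meets no others;
   by pigeonhole this happens for some j <= n. *)
Lemma nagata_colourable (R : realType) (dX : measure_display)
    (X : measurableType dX) (d : X -> X -> R) (n : nat) :
  is_metric d -> nagata_prop d n -> exists2 C : R, 0 < C & colourable d n C.
Proof.
move=> [d0 [dE [dS dT]]] [C C0 H]; pose n2 : R := n.+2%:R.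
exists (2 * n2 + C * n2); first by rewrite addr_gt0 // mulr_gt0.
move=> s s0; have [|F [Fc [Fd Fm]]] := H (n2 * s); first by rewrite mulr_gt0.
pose N (r : R) x := [set B | F B /\ exists2 y, B y & d x y < r].
have Nmono r r' x y : r + d x y <= r' -> N r x `<=` N r' y.
  move=> rr B [FB [z Bz xz]]; split => //; exists z => //.
  have := dT y x z; have := dS x y; lra.
have dxx x : d x x = 0 by apply/dE.
exists (fun j => [set x | (j <= n)%N /\ N (j.+1%:R * s) x = N (j.+2%:R * s) x]).
exists (fun j x => N (j.+1%:R * s) x); split.
- move=> x; apply: contrapT => nex.
  (* If every colour failed at [x], each of n+1 successive radii would reach a new member of the
     cover. With the member containing [x] (index 0, as nothing is met at radius 0) these are n+2
     distinct sets meeting one ball. *)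
  have ch i : exists B, (i <= n.+1)%N ->
      N (i.+1%:R * s) x B /\ ~ N (i%:R * s) x B.
    case: i => [|j].
      have [A [FA Ax]] := Fc x; exists A => _; split.
        by split => //; exists x => //; rewrite dxx mul1r.
      by rewrite mul0r => -[_ [y _]]; rewrite ltNge d0.
    have [jn|jn] := leqP j n; last by exists set0; rewrite ltnNge jn.
    have ne : N (j.+1%:R * s) x <> N (j.+2%:R * s) x.
      by move=> E; apply: nex; exists j => //; split.
    apply: contrapT => nB; apply: ne; apply/seteqP; split.
      by apply: Nmono; rewrite dxx addr0 (ler_pM2r s0) ler_nat.
    move=> B NB; apply: contrapT => nNB; apply: nB.
    by exists B => _.
  have [g gP] := choice ch.
  pose f (i : 'I_n.+2) := g i.
  have Nle i j : (i <= j)%N -> N (i%:R * s) x `<=` N (j%:R * s) x.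
    by move=> ij; apply: Nmono; rewrite dxx addr0 (ler_pM2r s0) ler_nat.
  have fP (i : 'I_n.+2) : N (i.+1%:R * s) x (f i) /\ ~ N (i%:R * s) x (f i).
    by apply: gP; rewrite -ltnS.
  have lem (i j : 'I_n.+2) : (i < j)%N -> f i <> f j.
    move=> ij E; have [_ nf] := fP j; apply: nf; rewrite -E.
    by apply: (Nle _ _ ij); case: (fP i).
  have inj : injective f.
    move=> i j E; apply: val_inj => /=; apply: contrapT => /eqP.
    rewrite neq_ltn => /orP[/lem|/lem]; first by rewrite E.
    by apply; rewrite E.
  have [|i E] := Fm x f inj; first by move=> i; have [[]] := fP i.
  have [[_ [y fy xy]] _] := fP i.
  suff : (f i `&` dball d x (n2 * s)) y by rewrite E.
  split => //=; apply: lt_le_trans xy _.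
  by rewrite /n2 (ler_pM2r s0) ler_nat ltn_ord.
- move=> j x y /= [jn Nx] [_ Ny] Nxy; have [B [FB Bx]] := Fc x.
  have [_ [z Bz yz]] : N (j.+1%:R * s) y B.
    rewrite -Nxy; split => //; exists x => //; rewrite dxx mulr_gt0 //.
  have jn2 : j.+1%:R * s <= n2 * s.
    by rewrite /n2 (ler_pM2r s0) ler_nat ltnS leqW.
  have := Fd _ FB _ _ Bx Bz; have := dT x z y; have := dS y z.
  have : 0 <= n2 * s by rewrite mulr_ge0 // ltW.
  have -> : (2 * n2 + C * n2) * s = 2 * (n2 * s) + C * (n2 * s) by ring.
  move=> *; lra.
- move=> j x y /= [jn Nx] [_ Ny] Nxy; rewrite leNgt; apply/negP => dxy; apply: Nxy.
  have jE : j.+2%:R * s = j.+1%:R * s + s by rewrite -[j.+2]addn1 natrD mulrDl mul1r.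
  apply/seteqP; split.
    by rewrite Ny; apply: Nmono; rewrite jE lerD2l ltW.
  by rewrite Nx; apply: Nmono; rewrite jE lerD2l dS ltW.
Qed.

Section Whitney.
Variables (R : realType) (X : Type) (d : X -> X -> R).
Hypothesis dm : is_metric d.
Variables (Dm : R).
Hypothesis diam : forall x y, d x y <= Dm.

Lemma dyadic_band (r : R) : 0 < r -> r <= Dm ->
  exists j, Dm / 2 ^+ j < 2 * r /\ r <= Dm / 2 ^+ j.
Proof.
move=> r0 rD; have D0 : 0 < Dm by apply: lt_le_trans rD.
have ex : exists j, Dm / 2 ^+ j < 2 * r.
  have [m Hm] : exists m : nat, Dm / r < m%:R.
    by exists (Num.bound (Dm / r)); apply: archi_boundP; rewrite divr_ge0 // ltW.
  exists m; rewrite ltr_pdivrMr ?exprn_gt0 //.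
  have m2 : m%:R <= 2 ^+ m :> R by rewrite -natrX ler_nat ltnW // ltn_expl.
  move: Hm; rewrite ltr_pdivrMr // => /lt_le_trans; apply.
  have : m%:R * r <= 2 ^+ m * r by rewrite ler_wpM2r // ltW.
  have : 0 <= 2 ^+ m * r by rewrite mulr_ge0 ?exprn_ge0 // ltW.
  by lra.
case: (ex_minnP ex) => j jP jmin; exists j; split => //.
case: j jP jmin => [|j] jP jmin; first by rewrite expr0 divr1.
rewrite leNgt; apply/negP => lt; suff: (j < j)%N by rewrite ltnn.
apply: jmin; move: lt; rewrite exprS invfM mulrCA; lra.
Qed.

(* Bands {rho ~ Dm/2^j} with j even are coloured at scale Dm/2^j, those with
   j odd at the much smaller scale be*Dm/2^j; an odd piece lying close to an
   even piece of the same colour is glued to it. This keeps the number of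
   colours at n+1. *)
Lemma whitney_colouring (n : nat) (C : R) : 0 < C -> colourable d n C ->
  exists K c : R, [/\ 0 < K, 0 < c & forall A : set X, A !=set0 -> d_open d (~` A) ->
  exists (D : nat -> set X) (lab : nat -> X -> nat * set (set X)),
  [/\ forall x, ~ A x -> exists2 j, (j <= n)%N & D j x,
     forall j x y, ~ A x -> ~ A y -> D j x -> D j y -> lab j x = lab j y ->
       d x y <= K * set_dist d A x &
     forall j x y, ~ A x -> ~ A y -> D j x -> D j y -> lab j x <> lab j y ->
       c * set_dist d A x <= d x y]].
Proof.
have [d0 [dE [dS dT]]] := dm.
(* Chosen so that an odd piece, together with a gap of a third of its scale, has size at most rho /
   4: gluing moves points only slightly. *)
move=> C0 colC; pose be : R := (8 * (C + 1))^-1.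
have be0 : 0 < be by rewrite invr_gt0; lra.
have beC : be * (8 * (C + 1)) = 1 by rewrite /be mulVf // gt_eqF //; lra.
have be1 : be <= 1 / 8 by nra.
have beC' : be * C <= 1 / 8 by nra.
exists (1 + 4 * C), (be / 4); split; [lra | lra |].
move=> A A0 oA; pose rho := set_dist d A.
have rho0 x : ~ A x -> 0 < rho x by exact: set_dist_gt0.
have rhoL x y : rho x <= d x y + rho y by exact: set_dist_lipschitz.
have [a0 Aa0] := A0.
have [bnd bndP] : {bnd : X -> nat & forall x, ~ A x ->
    Dm / 2 ^+ bnd x < 2 * rho x /\ rho x <= Dm / 2 ^+ bnd x}.
  apply: (@choice _ _ (fun x j => ~ A x -> Dm / 2 ^+ j < 2 * rho x /\ rho x <= Dm / 2 ^+ j)).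
  move=> x; have [Ax|nAx] := pselect (A x); first by exists 0%N.
  have [|j jP] := dyadic_band (rho0 _ nAx); last by exists j.
  by apply: le_trans (diam x a0); exact: set_dist_le.
pose sc (j : nat) := (if odd j then be else 1) * (Dm / 2 ^+ j).
have [[x0 nAx0]|allA] := pselect (exists x0, ~ A x0); last first.
  by exists (fun=> setT), (fun=> fun=> (0%N, set0)); split => [x nA|k x y nA|k x y nA]; exfalso; apply: allA; exists x.
have D0 : 0 < Dm.
  apply: lt_le_trans (diam x0 a0); apply: lt_le_trans (rho0 _ nAx0) _.
  exact: set_dist_le.
have sc0 j : 0 < sc j.
  by rewrite mulr_gt0 ?divr_gt0 ?exprn_gt0 //; case: odd.
have [DD DDP] := choice (fun j => colC _ (sc0 j)).
have [LL LLP] := choice DDP.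
pose D k x := DD (bnd x) k x.
pose rl k x := (bnd x, LL (bnd x) k x).
have scle x : ~ A x -> sc (bnd x) <= 2 * rho x.
  move=> /bndP[b1 b2]; rewrite /sc; have := rho0 x.
  case: odd => ?; last by lra.
  nra.
have scodd x : ~ A x -> odd (bnd x) -> sc (bnd x) <= 2 * be * rho x /\ be * rho x <= sc (bnd x).
  by move=> /bndP[b1 b2] ob; rewrite /sc ob; split; nra.
have rl_same k x y : D k x -> D k y -> rl k x = rl k y -> d x y <= C * sc (bnd x).
  move=> Dx Dy [bE lE]; have [_ H _] := LLP (bnd x).
  by move: Dy lE; rewrite /D -bE => Dy lE; apply: H Dx Dy lE.
(* Different bands of equal parity are at least two indices apart; then [rho] differs by a factor 2
   and the points are far from each other, [rho] being 1-Lipschitz. *)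
have rl_diff k x y : ~ A x -> ~ A y -> odd (bnd x) = odd (bnd y) ->
    D k x -> D k y -> rl k x <> rl k y ->
    (if odd (bnd x) then be else 1 / 2) * rho x <= d x y.
  move=> Ax Ay; have [Bx1 Bx2] := bndP _ Ax; have [By1 By2] := bndP _ Ay.
  have rx := rho0 _ Ax; have ry := rho0 _ Ay.
  have fac (b : bool) : (if b then be else 1 / 2) <= 1 / 2 by case: b; lra.
  have [bE|bN] := eqVneq (bnd x) (bnd y).
    move=> _ Dx Dy rN; have [_ _ H] := LLP (bnd x).
    have {}H : sc (bnd x) <= d x y.
      apply: (H k) => //; first by rewrite bE.
      by move=> E; apply: rN; rewrite /rl E bE.
    apply: le_trans H; rewrite /sc; case: (odd _); nra.
  move=> oE _ _ _.
  suff H : rho x / 2 <= d x y.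
    by apply: le_trans H; have := fac (odd (bnd x)); nra.
  have pow i j : (i.+2 <= j)%N -> Dm / 2 ^+ j <= (Dm / 2 ^+ i) / 4.
    move=> ij; rewrite -(subnKC ij) exprD !exprS.
    have -> : Dm / 2 ^+ i / 4 = Dm / (2 ^+ i * 4) by rewrite invfM mulrA.
    rewrite ler_pM2l //.
    rewrite lef_pV2 ?posrE ?mulr_gt0 ?exprn_gt0 //.
    have p1 : 1 <= 2 ^+ (j - i.+2) :> R by apply: exprn_ege1; lra.
    have p2 : 0 < 2 ^+ i :> R by rewrite exprn_gt0.
    by nra.
  have gap i j : odd i = odd j -> (i < j)%N -> (i.+2 <= j)%N.
    move=> o; rewrite leq_eqVlt => /orP[/eqP E|//].
    by move: o; rewrite -E /=; case: odd.
  move: bN; rewrite neq_ltn => /orP[lt|lt].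
    have := pow _ _ (gap _ _ oE lt); have := rhoL x y; lra.
  have := pow _ _ (gap _ _ (esym oE) lt); have := rhoL y x; have := dS x y; lra.
(* Gluing is decided once per odd piece: [at_] picks one nearby even point for its label and [e]
   sends the whole piece there, so equal raw labels remain equal. *)
pose att k l y := [/\ odd l.1, ~ A y, D k y, ~~ odd (bnd y) &
   exists x', [/\ ~ A x', D k x', rl k x' = l & d x' y < sc l.1 / 3]].
have [at_ atP] : {at_ : nat -> nat * set (set X) -> option X & forall k l,
    (if at_ k l is Some y then att k l y else forall y, ~ att k l y)}.
  have ch (k : nat) : exists f : nat * set (set X) -> option X, forall l,
    (if f l is Some y then att k l y else forall y, ~ att k l y).
    have [|f fP] := @choice _ _ (fun l (o : option X) =>
      if o is Some y then att k l y else forall y, ~ att k l y); last by exists f.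
    move=> l; have [[y Hy]|n0] := pselect (exists y, att k l y); first by exists (Some y).
    by exists None => y Hy; apply: n0; exists y.
  exact: (choice ch).
pose e k x := if at_ k (rl k x) is Some y then y else x.
have e_even k x : ~~ odd (bnd x) -> e k x = x.
  move=> ev; rewrite /e; have := atP k (rl k x); case: (at_ _ _) => // y [].
  by rewrite /= (negbTE ev).
have eP k x : ~ A x -> D k x ->
    [/\ ~ A (e k x), D k (e k x), d x (e k x) <= rho x / 4 &
     (e k x = x \/ (odd (bnd x) /\ ~~ odd (bnd (e k x))))].
  move=> Ax Dx; have rx := rho0 _ Ax.
  rewrite /e; have := atP k (rl k x); case: (at_ _ _) => [y|_]; last first.
    split => //; last by left.
    by rewrite (proj2 (dE x x)) //; lra.
  move=> [/= ob Ay Dy ey [x' [Ax' Dx' rE dy]]]; split => //; last by right.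
  have := rl_same k x x' Dx Dx' (esym rE); have := dT x x' y.
  by have [] := scodd _ Ax ob; nra.
exists D, (fun k x => rl k (e k x)); split.
- move=> x _; have [H _ _] := LLP (bnd x); exact: H.
- move=> k x y Ax Ay Dx Dy E; rewrite -/rho.
  have [Aex Dex dex _] := eP k x Ax Dx; have [Aey Dey dey _] := eP k y Ay Dy.
  have H1 := rl_same k _ _ Dex Dey E; have H2 := scle _ Aex.
  have H3 := rhoL (e k x) x; have H4 := rhoL y x.
  have H5 := dT x (e k x) y; have H6 := dT (e k x) (e k y) y.
  have H7 := dS y x; have H8 := dS (e k x) x; have H9 := dS (e k y) y.
  have H10 : C * sc (bnd (e k x)) <= C * (2 * rho (e k x)) by rewrite ler_pM2l.
  have rx := rho0 _ Ax.
  have H11 : C * rho (e k x) <= C * (5 / 4 * rho x) by rewrite ler_pM2l //; lra.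
  have H12 : 0 <= C * rho x by rewrite mulr_ge0 // ltW.
  lra.
(* An even [x] too close to the odd piece of [y] forces that piece to be attached to some [z]. As
   the labels differ, [x] and [z] lie in distinct even pieces, at distance at least rho x / 2, while
   the chain x, y, y', z is shorter. *)
have main k x y : ~ A x -> ~ A y -> D k x -> D k y -> rl k (e k x) <> rl k (e k y) ->
    ~~ odd (bnd x) -> odd (bnd y) -> be / 3 * rho y <= d x y.
  move=> Ax Ay Dx Dy + ox oy; rewrite (e_even k x) // => rN.
  have [sc1 sc2] := scodd _ Ay oy.
  have ry := rho0 _ Ay.
  rewrite leNgt; apply/negP => dlt.
  have dlt3 : d x y < sc (bnd y) / 3 by lra.
  have := atP k (rl k y); move: rN; rewrite /e.
  case: (at_ _ _) => [z|] rN; last first.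
    move=> /(_ x); apply; split => //.
    by exists y; split => //; rewrite dS.
  move=> [/= _ Az Dz oz [y' [Ay' Dy' ry' dy'z]]].
  have H1 := rl_same k y y' Dy Dy' (esym ry').
  have := rl_diff k x z Ax Az _ Dx Dz rN; rewrite (negbTE ox) (negbTE oz) => /(_ erefl) H2.
  have H3 := dT x y z; have H4 := dT y y' z; have H5 := rhoL y x; have H6 := dS x y.
  nra.
move=> k x y Ax Ay Dx Dy rN; rewrite -/rho.
have rx := rho0 _ Ax; have ry := rho0 _ Ay.
have [ox|ox] := boolP (odd (bnd x)); have [oy|oy] := boolP (odd (bnd y)).
- suff: be * rho x <= d x y by nra.
  have := rl_diff k x y Ax Ay; rewrite ox oy; apply => //.
  move=> rE; apply: rN; rewrite /e rE; case: (at_ _ _) => //.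
- have := main k y x Ay Ax Dy Dx (fun E => rN (esym E)) oy ox.
  by rewrite dS; nra.
- have := main k x y Ax Ay Dx Dy rN ox oy.
  by have := rhoL x y; nra.
- have := rl_diff k x y Ax Ay; rewrite (negbTE ox) (negbTE oy).
  move: rN; rewrite !e_even // => rN /(_ erefl Dx Dy rN); nra.
Qed.

End Whitney.

(** * Lipschitz extension *)

Section Clamp.
Variable R : realType.

Definition clamp (a : R) : R := Num.min 1 (Num.max 0 a).

Lemma clamp_itv a : 0 <= clamp a <= 1.
Proof. by rewrite /clamp le_min ge_min le_max !lexx ler01. Qed.

Lemma clamp_gt0 a : 0 < clamp a -> 0 < a.
Proof. by rewrite /clamp lt_min lt_max ltxx => /andP[]. Qed.

Lemma clamp_le0 a : a <= 0 -> clamp a = 0.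
Proof. by move=> a0; rewrite /clamp (max_idPl a0); apply: min_r; exact: ler01. Qed.

Lemma clamp_ge1 a : 1 <= a -> clamp a = 1.
Proof.
move=> a1; apply/min_idPl; apply: le_trans a1 _.
by rewrite le_max lexx orbT.
Qed.

Lemma clamp_lipschitz a b : `|clamp a - clamp b| <= `|a - b|.
Proof.
wlog ab : a b / a <= b.
  move=> H; have [/H//|/ltW/H] := leP a b.
  by rewrite distrC [leRHS]distrC.
have cab : clamp a <= clamp b.
  by rewrite /clamp le_min2 // le_max2.
rewrite distrC [leRHS]distrC !ger0_norm ?subr_ge0 //.
rewrite /clamp; case: (leP 0 a) => a0; case: (leP 0 b) => b0;
  case: (leP 1 a) => a1; case: (leP 1 b) => b1; case: (leP (1 : R) 0) => c1; lra.
Qed.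

(** Both clamps vanish when both ratios are at least 2. Otherwise u or w is below a quarter of its
    r, which controls the error made by changing the denominator. *)
Lemma clamp_ratio_lipschitz (eps del u w rx ry : R) :
  0 < eps -> eps <= 1 / 8 -> 0 < rx -> 0 < ry -> 0 <= del -> del <= rx / 4 ->
  0 <= u -> 0 <= w -> u <= del + w -> w <= del + u ->
  rx <= del + ry -> ry <= del + rx ->
  `|clamp (2 - u / (eps * rx)) - clamp (2 - w / (eps * ry))| <= 4 * del / (eps * rx).
Proof.
move=> e0 e8 rx0 ry0 del0 delx u0 w0 uw wu r1 r2.
have erx : 0 < eps * rx by rewrite mulr_gt0.
have ery : 0 < eps * ry by rewrite mulr_gt0.
have [[ux wy]|nn] := pselect (2 * (eps * rx) <= u /\ 2 * (eps * ry) <= w).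
  have E1 : 2 <= u / (eps * rx) by rewrite ler_pdivlMr.
  have E2 : 2 <= w / (eps * ry) by rewrite ler_pdivlMr.
  by rewrite (clamp_le0 (a := 2 - _)) ?(clamp_le0 (a := 2 - _)) ?subr_le0 // subrr normr0 divr_ge0 ?mulr_ge0 // ltW.
apply: le_trans (clamp_lipschitz _ _) _.
have -> : 2 - u / (eps * rx) - (2 - w / (eps * ry)) =
    (w * rx - u * ry) / ry / (eps * rx).
  by field; rewrite !gt_eqF.
rewrite normrM [`|_^-1|]gtr0_norm ?invr_gt0 //.
rewrite ler_pM2r ?invr_gt0 // normrM [`|_^-1|]gtr0_norm ?invr_gt0 //.
rewrite ler_pdivrMr // ler_norml.
have ex : eps * rx <= 1 / 8 * rx by rewrite ler_pM2r.
have ey : eps * ry <= 1 / 8 * ry by rewrite ler_pM2r.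
have yx : 3 / 4 * rx <= ry by lra.
have p1 : del * rx <= del * (4 / 3 * ry) by rewrite ler_wpM2l //; lra.
have [ux|ux] := ltP u (2 * (eps * rx)).
  have q1 : u * del <= 1 / 4 * rx * del by rewrite ler_wpM2r //; lra.
  have q2 : `|u * (rx - ry)| <= u * del.
    by rewrite normrM ger0_norm // ler_wpM2l // ler_norml; apply/andP; split; lra.
  have q3 : `|(w - u) * rx| <= del * rx.
    rewrite normrM (ger0_norm (ltW rx0)) ler_wpM2r ?(ltW rx0) //.
    by rewrite ler_norml; apply/andP; split; lra.
  move: q2 q3; rewrite !ler_norml => /andP[? ?] /andP[? ?].
  by apply/andP; split; lra.
have wy : w < 2 * (eps * ry) by rewrite ltNge; apply/negP => wy; apply: nn.
have q1 : w * del <= 1 / 4 * ry * del by rewrite ler_wpM2r //; lra.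
have q2 : `|w * (rx - ry)| <= w * del.
  by rewrite normrM ger0_norm // ler_wpM2l // ler_norml; apply/andP; split; lra.
have q3 : `|(w - u) * ry| <= del * ry.
  rewrite normrM (ger0_norm (ltW ry0)) ler_wpM2r ?(ltW ry0) //.
  by rewrite ler_norml; apply/andP; split; lra.
have q4 : 0 <= del * ry by rewrite mulr_ge0 // ltW.
move: q2 q3; rewrite !ler_norml => /andP[? ?] /andP[? ?].
by apply/andP; split; lra.
Qed.

End Clamp.

Section LipschitzExtension.
Variables (R : realType) (X : Type) (d : X -> X -> R).
Hypothesis dm : is_metric d.
Variables (Dm : R).
Hypothesis diam : forall x y, d x y <= Dm.
Variables (Y : Type) (dY : Y -> Y -> R).
Hypothesis dYm : is_metric dY.

(* Points off A are mapped to the nerve of a Whitney colouring of the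
   complement by the functions t x i = clamp (2 - dist(x, B_i)/(eps * dist(x,A))),
   and then to Y by the skeleton extension of i |-> f (a_i), a_i a point of A
   near the piece B_i. Two close points are compared through min (t x) (t y). *)
Lemma lipschitz_extension (n : nat) (C : R) : 0 < C -> colourable d n C ->
  lip_connected dY n.-1 ->
  exists2 K : R, 0 <= K & forall A : set X, A !=set0 -> d_open d (~` A) ->
  forall (f : X -> Y) (L : R), 0 <= L ->
    (forall x y, A x -> A y -> dY (f x) (f y) <= L * d x y) ->
  exists F : X -> Y, (forall x, A x -> F x = f x) /\
    forall x y, dY (F x) (F y) <= K * L * d x y.
Proof.
have [d0 [dE [dS dT]]] := dm; have [dY0 [dYE [dYS dYT]]] := dYm.
move=> C0 colC /(skeleton_extension dYm)[Ch Ch0 skel].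
have [Kw [c [Kw0 c0 whit]]] := whitney_colouring dm diam C0 colC.
(* Small against both 1 and c: two pieces of one colour, about c rho apart, cannot both come within
   2 eps rho of the same point. *)
pose eps : R := c / (8 * (1 + c)).
have e0 : 0 < eps by rewrite divr_gt0 // mulr_gt0 //; lra.
have eE : eps * (8 * (1 + c)) = c by rewrite /eps divfK // gt_eqF // mulr_gt0 //; lra.
have e8 : eps <= 1 / 8 by nra.
have ec : eps <= c / 8 by nra.
clearbody eps.
(* C2 rho x bounds the distance from [x] to the points [a i] of positive weight; C3 is the resulting
   Lipschitz constant between [x] and points of [A]. *)
pose C2 : R := 3 + 4 * Kw; pose C3 : R := 2 * Ch * C2 + C2 + 1.
have C20 : 0 <= C2 by rewrite /C2; lra.
have ChC20 : 0 <= Ch * C2 by rewrite mulr_ge0.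
have C30 : 0 <= C3 by rewrite /C3; lra.
have ei0 : 0 < eps^-1 by rewrite invr_gt0.
exists (C3 * (8 / eps + 1) + 16 * Ch * C2 / eps).
  have h1 : 0 <= C3 * eps^-1 by rewrite mulr_ge0 // ltW.
  have h2 : 0 <= Ch * C2 * eps^-1 by rewrite mulr_ge0 // ltW.
  lra.
move=> A A0 oA f L L0 fL; pose rho := set_dist d A.
have rho0 x : ~ A x -> 0 < rho x by exact: set_dist_gt0.
have rhoL x y : rho x <= d x y + rho y by exact: set_dist_lipschitz.
have dxx x : d x x = 0 by apply/dE.
have [D [lab [cov same diff]]] := whit A A0 oA.
pose I : eqType := (nat * (nat * set (set X)))%type.
pose B (i : I) : set X := [set x | [/\ ~ A x, (i.1 <= n)%N, D i.1 x & lab i.1 x = i.2]].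
(* An empty piece has [set_dist] equal to 0, the infimum of the empty set, and would receive weight
   1 everywhere; hence the case distinction. *)
pose t x (i : I) : R := if `[< B i !=set0 >]
  then clamp (2 - set_dist d (B i) x / (eps * rho x)) else 0.
have [a aP] : {a : I -> X & forall i, B i !=set0 ->
    A (a i) /\ exists2 z, B i z & d z (a i) <= 2 * rho z}.
  apply: (@choice _ _ (fun i a => B i !=set0 ->
    A a /\ exists2 z, B i z & d z a <= 2 * rho z)) => i.
  have [[z Bz]|nB] := pselect (B i !=set0); last by have [a Aa] := A0; exists a => /nB.
  have [nz _ _ _] := Bz.
  have [a Aa lt] := set_dist_adherent dm z A0 (rho0 _ nz).
  by exists a => _; split => //; exists z => //; rewrite -/rho in lt *; lra.
have [h hP] := skel I (0%N, (0%N, set0)) (f \o a).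
have t01 x i : 0 <= t x i <= 1.
  by rewrite /t; case: asboolP => _; [exact: clamp_itv | rewrite lexx ler01].
have tgt x i : ~ A x -> 0 < t x i -> exists2 y, B i y & d x y < 2 * eps * rho x.
  move=> Ax; rewrite /t; case: asboolP => [Bi /clamp_gt0|_]; last by rewrite ltxx.
  have er : 0 < eps * rho x by rewrite mulr_gt0 ?rho0.
  rewrite subr_gt0 ltr_pdivrMr // => lt.
  have g0 : 0 < 2 * (eps * rho x) - set_dist d (B i) x by rewrite subr_gt0.
  have [y By lty] := set_dist_adherent dm x Bi g0.
  by exists y => //; lra.
have teq1 x y i : ~ A y -> B i x -> d x y <= eps * rho y -> t y i = 1.
  move=> Ay Bx dxy; rewrite /t asboolT; last by exists x.
  have er : 0 < eps * rho y by rewrite mulr_gt0 ?rho0.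
  apply: clamp_ge1; suff: set_dist d (B i) y / (eps * rho y) <= 1 by lra.
  rewrite ler_pdivrMr // mul1r; apply: le_trans dxy.
  by rewrite dS; exact: set_dist_le.
have tuniq x i j : ~ A x -> 0 < t x i -> 0 < t x j -> i.1 = j.1 -> i = j.
  move=> Ax ti tj ij; have [y By dy] := tgt _ _ Ax ti; have [z Bz dz] := tgt _ _ Ax tj.
  have [Ay _ Dy ly] := By; have [Az _ Dz lz] := Bz.
  have rx := rho0 _ Ax.
  case: (pselect (i.2 = j.2)) => [|ne]; first by case: i j ij {ti tj By Bz dy dz Dy ly Dz lz} => ? ? [? ?] /= -> ->.
  exfalso; have := diff i.1 y z Ay Az Dy; rewrite ij in ly *; rewrite ly lz => /(_ Dz ne).
  rewrite -/rho; have := rhoL x y; have := dT y x z; have := dS x y => H1 H2 H3 H4.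
  have H5 : eps * rho x <= c / 8 * rho x by rewrite ler_pM2r.
  have H6 : eps * rho x <= 1 / 8 * rho x by rewrite ler_pM2r.
  have H7 : c * (3 / 4 * rho x) <= c * rho y by rewrite ler_pM2l //; lra.
  have H8 : 0 < c * rho x by rewrite mulr_gt0.
  lra.
have anear x i : ~ A x -> 0 < t x i -> A (a i) /\ d x (a i) <= C2 * rho x.
  move=> Ax ti; have [y By dy] := tgt _ _ Ax ti.
  have [Aa [z Bz dz]] : A (a i) /\ exists2 z, B i z & d z (a i) <= 2 * rho z.
    by apply: aP; exists y.
  split=> //; have rx := rho0 _ Ax.
  have [Ay _ Dy ly] := By; have [Az _ Dz lz] := Bz.
  have := same i.1 y z Ay Az Dy Dz; rewrite ly lz -/rho => /(_ erefl) dyz.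
  have H1 := rhoL y x; have H2 := rhoL z y; have H3 := dT x y (a i); have H4 := dT y z (a i).
  have H5 : eps * rho x <= 1 / 8 * rho x by rewrite ler_pM2r.
  have H6 := dS x y; have H7 := dS y z.
  have H8 : Kw * rho y <= Kw * (5 / 4 * rho x) by rewrite ler_pM2l //; lra.
  have H9 : 0 < Kw * rho x by rewrite mulr_gt0.
  rewrite /C2; lra.
(* Each of the n+1 colours has at most one positive index, and [i0] uses up one colour; at most [n]
   indices stay free. *)
have supp x i0 : ~ A x -> t x i0 = 1 -> exists s : seq I,
    [/\ uniq s, i0 \notin s, (size s <= n)%N, forall i, 0 < t x i -> i = i0 \/ i \in s &
        forall i, i \in s -> 0 < t x i].
  move=> Ax ti0.
  have [l lP] : {l : nat -> nat * set (set X) & forall k,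
      (exists l, 0 < t x (k, l)) -> 0 < t x (k, l k)}.
    apply: (@choice _ _ (fun k l => (exists l, 0 < t x (k, l)) -> 0 < t x (k, l))) => k.
    have [[l Hl]|no] := pselect (exists l, 0 < t x (k, l)); first by exists l.
    by exists (0%N, set0) => /no.
  pose ks := [seq k <- rem i0.1 (iota 0 n.+1) | 0 < t x (k, l k)].
  have ile i : 0 < t x i -> (i.1 <= n)%N by move=> /(tgt _ _ Ax)[y []].
  have inj : injective (fun k => (k, l k) : I) by move=> k k' [].
  have memks k : (k \in ks) = [&& 0 < t x (k, l k), k != i0.1 & (k <= n)%N].
    by rewrite mem_filter mem_rem_uniq ?iota_uniq // inE mem_iota.
  exists [seq ((k, l k) : I) | k <- ks]; split.
  - by rewrite map_inj_uniq // filter_uniq // rem_uniq // iota_uniq.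
  - apply/mapP => -[k]; rewrite memks => /and3P[_ /eqP ne _] E.
    by apply: ne; rewrite E.
  - rewrite size_map; apply: leq_trans (size_subseq (filter_subseq _ _)) _.
    rewrite size_rem ?size_iota // mem_iota /= add0n ltnS ile // ti0 ltr01 //.
  - move=> i ti; have [E|ne] := eqVneq i.1 i0.1.
      by left; apply: (tuniq x) => //; rewrite ti0 ltr01.
    right; apply/mapP; exists i.1.
      by rewrite memks ne ile // !andbT; apply: lP; exists i.2; case: (i) ti.
    apply: (tuniq x) => //; apply: lP; exists i.2; by case: (i) ti.
  - by move=> i /mapP[k]; rewrite memks => /and3P[tk _ _] ->.
have key x i0 : ~ A x -> t x i0 = 1 ->
    dY (h (t x)) (f (a i0)) <= Ch * (2 * C2 * L * rho x) /\
    forall z, (forall i, 0 <= z i <= t x i) -> z i0 = 1 -> forall e : R,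
     (forall i, `|t x i - z i| <= e) ->
     dY (h (t x)) (h z) <= Ch * (2 * C2 * L * rho x) * e.
  move=> Ax ti0; have [s [us i0s sn mem smem]] := supp _ _ Ax ti0.
  have rx := rho0 _ Ax.
  pose b (i : I) : R := if i == i0 then 1 else 0.
  have ok : cell_ok b s.
    split => //; first by move=> i _; rewrite /b; case: eqP; [right | left].
    by exists i0 => //; rewrite /b eqxx.
  have sp : cell_spread dY (f \o a) b s (2 * C2 * L * rho x).
    have pos i : cell_supp b s i -> 0 < t x i.
      rewrite /cell_supp /b => -[/smem//|]; case: eqP => [-> _|_ /eqP].
        by rewrite ti0.
      by rewrite eq_sym oner_eq0.
    move=> i j /pos ti /pos tj /=.
    have [Ai di] := anear _ _ Ax ti; have [Aj dj] := anear _ _ Ax tj.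
    apply: le_trans (fL _ _ Ai Aj) _.
    have -> : 2 * C2 * L * rho x = L * (C2 * rho x + C2 * rho x) by ring.
    apply: ler_wpM2l => //.
    by have := dT (a i) x (a j); have := dS x (a i); lra.
  have [H1 H2] := hP b s _ ok sn sp.
  have inc z : (forall i, 0 <= z i <= t x i) -> z i0 = 1 -> cell b s z.
    move=> z01 zi0 i; case: ifPn => [_|si].
      have /andP[? ?] := z01 i; have /andP[? ?] := t01 x i.
      by apply/andP; split => //; lra.
    rewrite /b; case: eqP => [->//|ne].
    have : ~~ (0 < t x i).
      by apply/negP => /mem[//|]; rewrite (negbTE si).
    by have /andP[? ?] := z01 i; rewrite -leNgt => ?; lra.
  have ct : cell b s (t x).
    by apply: inc => // i; rewrite lexx andbT; case/andP: (t01 x i).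
  split; first by apply: H2 => //; right; rewrite /b eqxx.
  by move=> z z01 zi0 e ze; apply: H1 => //; exact: inc.
have inB x : ~ A x -> exists i, B i x.
  by move=> Ax; have [j jn Dj] := cov x Ax; exists (j, lab j x).
have tlip x y i : ~ A x -> ~ A y -> d x y <= rho x / 4 ->
    `|t x i - t y i| <= 4 * d x y / (eps * rho x).
  move=> Ax Ay dxy; have rx := rho0 _ Ax; have ry := rho0 _ Ay.
  have dxy0 := d0 x y.
  have erx : 0 < eps * rho x by rewrite mulr_gt0.
  have ery : 0 < eps * rho y by rewrite mulr_gt0.
  have rhs0 : 0 <= 4 * d x y / (eps * rho x) by rewrite divr_ge0 ?mulr_ge0 // ltW.
  rewrite /t; case: asboolP => [Bi|_]; last by rewrite subrr normr0.
  set u := set_dist d (B i) x; set w := set_dist d (B i) y.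
  have u0 : 0 <= u by exact: set_dist_ge0.
  have w0 : 0 <= w by exact: set_dist_ge0.
  have uw : u <= d x y + w by exact: set_dist_lipschitz.
  have wu : w <= d x y + u by rewrite dS; exact: set_dist_lipschitz.
  have r1 := rhoL x y; have r2 := rhoL y x; rewrite (dS y x) in r2.
  by apply: clamp_ratio_lipschitz.
exists (fun x => if `[< A x >] then f x else h (t x)); split.
  by move=> x Ax; rewrite asboolT.
have toA x b : ~ A x -> A b -> dY (h (t x)) (f b) <= C3 * L * d x b.
  move=> Ax Ab; have [i Bi] := inB _ Ax.
  have rx := rho0 _ Ax.
  have ti : t x i = 1.
    by apply: (teq1 x) => //; rewrite dxx mulr_ge0 // ltW.
  have [H1 _] := key _ _ Ax ti.
  have [Aa da] : A (a i) /\ d x (a i) <= C2 * rho x by apply: anear; rewrite ?ti.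
  have rb : rho x <= d x b by exact: set_dist_le.
  have H2 := dYT (h (t x)) (f (a i)) (f b); have H3 := fL _ _ Aa Ab.
  have H4 : L * d (a i) b <= L * (C2 * rho x + d x b).
    by rewrite ler_wpM2l //; have := dT (a i) x b; have := dS x (a i); lra.
  have H5 : L * (C2 * rho x + d x b) <= L * (C2 * d x b + d x b).
    by rewrite ler_wpM2l // lerD2r ler_wpM2l.
  have H6 : Ch * (2 * C2 * L * rho x) <= Ch * (2 * C2 * L * d x b).
    by rewrite !ler_wpM2l // !mulr_ge0.
  by rewrite /C3; lra.
pose K : R := C3 * (8 / eps + 1) + 16 * Ch * C2 / eps; rewrite -/K.
have K1 : C3 <= K.
  have h1 : 0 <= C3 * eps^-1 by rewrite mulr_ge0 // ltW.
  have h2 : 0 <= Ch * C2 * eps^-1 by rewrite mulr_ge0 // ltW.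
  rewrite /K; lra.
have K0 : 0 <= K by apply: le_trans K1.
have fLK x y : L * d x y <= K * L * d x y.
  rewrite -mulrA ler_peMl ?mulr_ge0 //; apply: le_trans K1.
  by rewrite /C3 lerDr addr_ge0 // !mulr_ge0.
have off x y : ~ A x -> ~ A y -> rho y <= rho x -> dY (h (t x)) (h (t y)) <= K * L * d x y.
  move=> Ax Ay ryx; have rx := rho0 _ Ax; have ry := rho0 _ Ay.
  have dxy0 := d0 x y.
  have p1 : 0 <= Ch * C2 / eps by rewrite divr_ge0 ?mulr_ge0 // ltW.
  (* Distant points are joined through a point of [A] within 2 rho x of [x]. For close points the
     piece of [x] has weight 1 at both, so the minimum of the two weight functions lies in the cell
     of each. *)
  have [far|near] := leP (eps / 2 * rho x) (d x y).
    have [b Ab lt] := set_dist_adherent dm x A0 rx.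
    rewrite -/rho in lt.
    have H1 := toA _ _ Ax Ab; have H2 := toA _ _ Ay Ab.
    have H3 := dYT (h (t x)) (f b) (h (t y)); rewrite (dYS (f b)) in H3.
    have H4 : rho x <= 2 / eps * d x y.
      by rewrite -ler_pdivrMl ?divr_gt0 // invf_div.
    have H5 : d x b + d y b <= (8 / eps + 1) * d x y.
      have := dT y x b; have := dS x y.
      have -> : (8 / eps + 1) * d x y = 4 * (2 / eps * d x y) + d x y by ring.
      by lra.
    have H6 : C3 * L * (d x b + d y b) <= C3 * L * ((8 / eps + 1) * d x y).
      by rewrite ler_wpM2l // mulr_ge0.
    have H7 : C3 * L * ((8 / eps + 1) * d x y) <= K * L * d x y.
      have -> : K * L * d x y = C3 * L * ((8 / eps + 1) * d x y) +
         16 * (Ch * C2 / eps) * (L * d x y) by rewrite /K; ring.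
      by rewrite lerDl; apply: mulr_ge0; apply: mulr_ge0.
    have := dYT (h (t x)) (f b) (h (t y)); rewrite (dYS (f b)); lra.
  have [i Bi] := inB _ Ax.
  have ex : eps * rho x <= 1 / 8 * rho x by rewrite ler_pM2r.
  have ti : t x i = 1.
    by apply: (teq1 x) => //; rewrite dxx mulr_ge0 // ltW.
  have r1 := rhoL x y.
  have er : eps * (1 / 2 * rho x) <= eps * rho y by rewrite ler_pM2l //; lra.
  have tyi : t y i = 1 by apply: (teq1 x) => //; lra.
  pose z j := Num.min (t x j) (t y j).
  pose e := 4 * d x y / (eps * rho x).
  have e_ge0 : 0 <= e by rewrite divr_ge0 ?mulr_ge0 // ltW.
  have tl j : `|t x j - t y j| <= e by apply: tlip => //; lra.
  have zi : z i = 1 by rewrite /z ti tyi minxx.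
  have z0 j : 0 <= z j by rewrite le_min; have /andP[-> _] := t01 x j; case/andP: (t01 y j).
  have [_ /(_ z _ zi e) H1] := key _ _ Ax ti; have [_ /(_ z _ zi e) H2] := key _ _ Ay tyi.
  have {}H1 : dY (h (t x)) (h z) <= Ch * (2 * C2 * L * rho x) * e.
    apply: H1 => j; first by rewrite z0 ge_min lexx.
    apply: le_trans (tl j); rewrite /z; case: (leP (t x j) (t y j)) => _ //.
    by rewrite subrr normr0.
  have {}H2 : dY (h (t y)) (h z) <= Ch * (2 * C2 * L * rho y) * e.
    apply: H2 => j; first by rewrite z0 ge_min lexx orbT.
    apply: le_trans (tl j); rewrite /z; case: (leP (t x j) (t y j)) => _; last by rewrite subrr normr0.
    by rewrite distrC.
  have H3 : Ch * (2 * C2 * L * rho y) * e <= Ch * (2 * C2 * L * rho x) * e.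
    by rewrite ler_wpM2r // ler_wpM2l // ler_wpM2l // !mulr_ge0.
  have H4 := dYT (h (t x)) (h z) (h (t y)); rewrite (dYS (h z)) in H4.
  (* The factor rho x of the spread cancels against the 1 / rho x in the Lipschitz bound for the
     weights. *)
  have H5 : Ch * (2 * C2 * L * rho x) * e = 8 * (Ch * C2 / eps) * (L * d x y).
    by rewrite /e; field; rewrite !gt_eqF.
  have H6 : K * L * d x y = C3 * (8 / eps + 1) * (L * d x y) +
       16 * (Ch * C2 / eps) * (L * d x y) by rewrite /K; ring.
  have H7 : 0 <= C3 * (8 / eps + 1) * (L * d x y).
    by rewrite !mulr_ge0 // addr_ge0 // divr_ge0 // ltW.
  lra.
move=> x y; case: asboolP => Ax; case: asboolP => Ay.
- exact: le_trans (fL _ _ Ax Ay) (fLK x y).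
- rewrite dYS dS; apply: le_trans (toA _ _ Ay Ax) _.
  by rewrite -!mulrA ler_wpM2r // mulr_ge0.
- apply: le_trans (toA _ _ Ax Ay) _.
  by rewrite -!mulrA ler_wpM2r // mulr_ge0.
- have [le|/ltW le] := leP (rho y) (rho x); first exact: off.
  by rewrite dYS dS; exact: off.
Qed.

End LipschitzExtension.

(** * Curves and upper gradients *)

(** Lebesgue measure equals its image under a translation, by uniqueness from the values on
    half-open intervals. *)
Lemma ge0_integral_shift (R : realType) (c x y : R) (g : R -> \bar R) :
  measurable_fun `[x, y] g -> (forall s, s \in `[x, y] -> (0 <= g s)%E) ->
  (\int[lebesgue_measure]_(s in `[(x - c)%R, (y - c)%R]) g (s + c)%R =
   \int[lebesgue_measure]_(s in `[x, y]) g s)%E.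
Proof.
move=> mg g0.
pose phi (s : measurableTypeR R) : measurableTypeR R := s + c.
have mphi : measurable_fun setT phi by apply: measurable_funD.
pose nu : {measure set (measurableTypeR R) -> \bar R} :=
  measure_function_pushforward__canonical__measure_function_Measure
    (@lebesgue_measure R) mphi.
have nuE (A : set (measurableTypeR R)) : measurable A -> lebesgue_measure A = nu A.
  apply: lebesgue_measure_unique => I [[a b]] /= _ <-.
  rewrite /nu /= /pushforward /=.
  have -> : phi @^-1` `]a, b] = `]a - c, b - c]%classic.
    apply/seteqP; split => s /=; rewrite /phi !in_itv /=.
      by move=> /andP[? ?]; apply/andP; split; lra.
    by move=> /andP[? ?]; apply/andP; split; lra.
  rewrite !lebesgue_measure_itv /= !lte_fin ltrD2r -!EFinD.
  by case: ifP => // _; congr (_%:E); lra.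
rewrite [RHS](eq_measure_integral nu); last by move=> A mA _; exact: nuE.
rewrite [RHS]ge0_integral_pushforward //; last 1 first.
  by move=> s; rewrite inE; exact: g0.
have -> // : phi @^-1` `[x, y] = `[x - c, y - c]%classic.
apply/seteqP; split => s /=; rewrite /phi !in_itv /=.
  by move=> /andP[? ?]; apply/andP; split; lra.
by move=> /andP[? ?]; apply/andP; split; lra.
Qed.

Section CurveLength.
Context (R : realType) (dX : measure_display) (X : measurableType dX).
Variables (d : X -> X -> R).
Hypothesis dm : is_metric d.
Variable gam : R -> X.
Implicit Types (s : seq R) (a b c x y z t : R).

Fixpoint poly_length c s : R :=
  if s is t :: s' then d (gam c) (gam t) + poly_length t s' else 0.

Definition partition a b s := path <=%R a s /\ last a s = b.

Lemma poly_length_ge0 c s : 0 <= poly_length c s.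
Proof.
by elim: s c => //= t s IH c; rewrite addr_ge0 //; case: dm.
Qed.

Lemma poly_length_cat c s1 s2 :
  poly_length c (s1 ++ s2) = poly_length c s1 + poly_length (last c s1) s2.
Proof. by elim: s1 c => [|t s1 IH] c /=; rewrite ?add0r // IH addrA. Qed.

Lemma partition_cat a b c s1 s2 : partition a b s1 -> partition b c s2 ->
  partition a c (s1 ++ s2).
Proof.
by move=> [p1 <-] [p2 <-]; split; [rewrite cat_path p1 | rewrite last_cat].
Qed.

Lemma partition_le a b s : partition a b s -> a <= b.
Proof.
move=> [p <-]; elim: s a p => //= t s IH a /andP[at_ p].
exact: le_trans at_ (IH _ p).
Qed.

Lemma curve_lengthE a b : curve_length d gam a b =
  ereal_sup [set (poly_length a s)%:E | s in partition a b].
Proof.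
rewrite /curve_length; congr ereal_sup; apply/seteqP; split => z /=.
  move=> [k [t [<- [<- [tm ->]]]]].
  suff [s ps E] : exists2 s, partition (t 0%N) (t k) s &
    poly_length (t 0%N) s = \sum_(i < k) d (gam (t i)) (gam (t i.+1)).
    by exists s => //; rewrite E.
  elim: k t tm => [|k IH] t tm; first by exists [::]; rewrite ?big_ord0.
  have [i ik|s [ps ls] E] := IH (fun i => t i.+1); first exact: (tm i.+1).
  exists (t 1%N :: s); last by rewrite /= E big_ord_recl.
  by split => //=; rewrite ps tm.
move=> [s [ps ls] <-] {z}.
suff [k [t [t0 [tk [tm E]]]]] : exists k (t : nat -> R), t 0%N = a /\ t k = last a s /\
    (forall i, (i < k)%N -> t i <= t i.+1) /\
    poly_length a s = \sum_(i < k) d (gam (t i)) (gam (t i.+1)).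
  by exists k, t; rewrite t0 tk ls E.
elim: s a {ls} ps => [|t0 s IH] a /=.
  by exists 0%N, (fun=> a); rewrite big_ord0.
move=> /andP[at0 /IH[k [t [t0E [tk [tm E]]]]]].
exists k.+1, (fun i => if i is j.+1 then t j else a); split => //; split => //.
split; first by case=> [_|i]; [rewrite t0E | rewrite ltnS; exact: tm].
by rewrite big_ord_recl E t0E.
Qed.

Lemma poly_length_split a b s y : partition a b s -> a <= y -> y <= b ->
  exists s1 s2, [/\ partition a y s1, partition y b s2 &
    poly_length a s <= poly_length a s1 + poly_length y s2].
Proof.
have [d0 [dE [dS dT]]] := dm.
move=> [ps <-] {b}; elim: s a ps => [|t s IH] a /=.
  move=> _ ay ya; have -> : y = a by apply/eqP; rewrite eq_le ay ya.
  by exists [::], [::]; rewrite addr0.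
move=> /andP[at_ ps] ay yl.
have [yt|ty] := leP y t.
  exists [:: y], (t :: s); split => /=; first by split => //=; rewrite ay.
    by split => //=; rewrite yt.
  by rewrite addr0 addrA lerD2r.
have [s1 [s2 [[p1 l1] p2 le]]] := IH t ps (ltW ty) yl.
exists (t :: s1), s2; split => //; first by split => //=; rewrite at_.
by rewrite /= -addrA lerD2l.
Qed.

(** With a' the first partition point other than [a], inserting [x] splits a single edge. This
    isolates the contribution near [a], for the continuity of arc length. *)
Lemma poly_length_right a b s : partition a b s -> a < b ->
  exists2 a', a < a' <= b & forall x, a <= x <= a' ->
   exists2 s', partition x b s' & poly_length a s <= d (gam a) (gam x) + poly_length x s'.
Proof.
have [d0 [dE [dS dT]]] := dm.
move=> [ps <-] {b}; elim: s a ps => [|t s IH] a /=; first by rewrite ltxx.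
move=> /andP[at_ ps] al; have [Eat|nat_] := eqVneq a t.
  rewrite -Eat in ps al *; have [a' aa' H] := IH a ps al; exists a' => // x /H[s' p' le].
  by exists s' => //; rewrite (proj2 (dE _ _)) // add0r.
have lat : a < t by rewrite lt_neqAle nat_.
exists t; first by rewrite lat; apply: (@partition_le _ _ s).
move=> x /andP[ax xt]; exists (t :: s); first by split => //=; rewrite xt.
by rewrite /= addrA lerD2r.
Qed.

Lemma poly_length_left a b s : partition a b s -> a < b ->
  exists2 b', a <= b' < b & forall x, b' <= x <= b ->
   exists2 s', partition a x s' & poly_length a s <= poly_length a s' + d (gam x) (gam b).
Proof.
have [d0 [dE [dS dT]]] := dm.
move=> [ps <-] {b}; elim/last_ind: s ps => [|s t IH]; first by rewrite /= ltxx.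
rewrite rcons_path last_rcons -cats1 poly_length_cat /= addr0 => /andP[ps lt] at_.
have [Elt|nlt] := eqVneq (last a s) t.
  rewrite -Elt in at_ *; have [b' bb' H] := IH ps at_; exists b' => // x /H[s' p' le].
  by exists s' => //; rewrite (proj2 (dE (gam (last a s)) _)) // addr0.
have llt : last a s < t by rewrite lt_neqAle nlt.
exists (last a s); first by rewrite llt andbT; apply: (@partition_le _ _ s).
move=> x /andP[lx xt]; exists (s ++ [:: x]).
  by split; [rewrite cat_path ps /= lx | rewrite last_cat].
by rewrite poly_length_cat /= addr0 -addrA lerD2l.
Qed.

Variables (a b : R).
Hypothesis rect : rectifiable d gam a b.

Definition clen x y : R := fine (curve_length d gam x y).

Lemma poly_length_le_curve x y s : partition x y s ->
  ((poly_length x s)%:E <= curve_length d gam x y)%E.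
Proof. by move=> ps; rewrite curve_lengthE; apply: ereal_sup_ubound; exists s. Qed.

Lemma curve_length_fin x y : a <= x -> x <= y -> y <= b ->
  curve_length d gam x y = (clen x y)%:E.
Proof.
move=> ax xy yb; rewrite /clen fineK // ge0_fin_numE; last first.
  apply: le_trans (poly_length_le_curve (s := [:: y]) _); last by split => //=; rewrite xy.
  by rewrite lee_fin poly_length_ge0.
have [_ [_]] := rect; apply: le_lt_trans; rewrite curve_lengthE.
apply: ge_ereal_sup => _ [s ps <-].
have ps2 : partition a b ((x :: s) ++ [:: b]).
  apply: partition_cat (_ : partition a y (x :: s)) _.
    by case: ps => p1 p2; split => //=; rewrite ax.
  by split => //=; rewrite yb.
apply: le_trans (poly_length_le_curve ps2); rewrite lee_fin poly_length_cat /=.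
have := poly_length_ge0 (last x s) [:: b]; have [+ _] := dm => /(_ (gam a) (gam x)) /=.
lra.
Qed.

Lemma poly_length_le x y s : a <= x -> y <= b -> partition x y s ->
  poly_length x s <= clen x y.
Proof.
move=> ax yb ps; have xy := partition_le ps.
by rewrite -lee_fin -curve_length_fin //; exact: poly_length_le_curve.
Qed.

Lemma clen_le x y M : a <= x -> x <= y -> y <= b ->
  (forall s, partition x y s -> poly_length x s <= M) -> clen x y <= M.
Proof.
move=> ax xy yb H; rewrite -lee_fin -curve_length_fin // curve_lengthE.
by apply: ge_ereal_sup => _ [s ps <-]; rewrite lee_fin; exact: H.
Qed.

Lemma dist_le_clen x y : a <= x -> x <= y -> y <= b -> d (gam x) (gam y) <= clen x y.
Proof.
move=> ax xy yb; have := @poly_length_le x y [:: y] ax yb.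
by rewrite /= addr0; apply; split => //=; rewrite xy.
Qed.

Lemma clen_ge0 x y : a <= x -> x <= y -> y <= b -> 0 <= clen x y.
Proof.
by move=> ax xy yb; apply: le_trans (dist_le_clen ax xy yb); case: dm.
Qed.

Lemma clen_add x y z : a <= x -> x <= y -> y <= z -> z <= b ->
  clen x z = clen x y + clen y z.
Proof.
move=> ax xy yz zb; have xz := le_trans xy yz.
have ay := le_trans ax xy; have yb := le_trans yz zb.
apply/eqP; rewrite eq_le; apply/andP; split.
  apply: clen_le => // s ps.
  have [s1 [s2 [p1 p2 le]]] := poly_length_split ps xy yz.
  by apply: le_trans le _; apply: lerD; apply: poly_length_le.
rewrite -lerBrDr; apply: clen_le => // s1 p1.
rewrite lerBrDl -lerBrDr; apply: clen_le => // s2 p2.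
rewrite lerBrDr addrC; have := poly_length_le ax zb (partition_cat p1 p2).
by rewrite poly_length_cat; have [_ ->] := p1.
Qed.

Lemma clenxx x : a <= x -> x <= b -> clen x x = 0.
Proof.
move=> ax xb; have := clen_add ax (lexx x) (lexx x) xb; lra.
Qed.

(** A polygon nearly as long as the curve on [x, b] loses at most d(gam x, gam y) when its start
    moves to y; by additivity little length is left on [x, y]. *)
Lemma clen_right x (e : R) : a <= x -> x < b -> 0 < e ->
  exists2 x', x < x' <= b & forall y, x <= y <= x' -> clen x y <= e.
Proof.
move=> ax xb e0; have [ab [cont _]] := rect.
have e2 : 0 < e / 2 by rewrite divr_gt0.
have [del del0 Hdel] : exists2 del : R, 0 < del &
     forall t', a <= t' <= b -> `|x - t'| < del -> d (gam x) (gam t') < e / 2.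
  by apply: cont => //; rewrite ax ltW.
have [s ps lt] : exists2 s, partition x b s & clen x b - e / 2 < poly_length x s.
  apply: contrapT => no; suff : clen x b <= clen x b - e / 2 by lra.
  apply: clen_le => //; first exact: ltW.
  by move=> s ps; rewrite leNgt; apply/negP => lt; apply: no; exists s.
have [a' /andP[xa' a'b] H] := poly_length_right ps xb.
exists (Num.min a' (x + del / 2)).
  by rewrite lt_min xa' ge_min a'b /= ltrDl divr_gt0.
move=> y /andP[xy]; rewrite le_min => /andP[ya' yd].
have [|s' ps' le] := H y; first by rewrite xy.
have yb : y <= b by exact: le_trans a'b.
have := poly_length_le (le_trans ax xy) (lexx b) ps'.
have := clen_add ax xy yb (lexx b).
have : d (gam x) (gam y) < e / 2.
  apply: Hdel; first by rewrite (le_trans ax xy) yb.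
  by rewrite distrC ger0_norm; lra.
lra.
Qed.

Lemma clen_left x (e : R) : a < x -> x <= b -> 0 < e ->
  exists2 x', a <= x' < x & forall y, x' <= y <= x -> clen y x <= e.
Proof.
move=> ax xb e0; have [ab [cont _]] := rect; have [d0 [dE [dS dT]]] := dm.
have e2 : 0 < e / 2 by rewrite divr_gt0.
have [del del0 Hdel] : exists2 del : R, 0 < del &
     forall t', a <= t' <= b -> `|x - t'| < del -> d (gam x) (gam t') < e / 2.
  by apply: cont => //; rewrite ltW.
have [s ps lt] : exists2 s, partition a x s & clen a x - e / 2 < poly_length a s.
  apply: contrapT => no; suff : clen a x <= clen a x - e / 2 by lra.
  apply: clen_le => //; first exact: ltW.
  by move=> s ps; rewrite leNgt; apply/negP => lt; apply: no; exists s.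
have [a' /andP[aa' a'x] H] := poly_length_left ps ax.
exists (Num.max a' (x - del / 2)).
  by rewrite gt_max a'x le_max aa' /= ltrBlDr ltrDl divr_gt0.
move=> y /andP[]; rewrite ge_max => /andP[ya' yd] yx.
have [|s' ps' le] := H y; first by rewrite ya'.
have ay : a <= y by exact: le_trans ya'.
have := poly_length_le (lexx a) (le_trans yx xb) ps'.
have := clen_add (lexx a) ay yx xb.
have : d (gam x) (gam y) < e / 2.
  apply: Hdel; first by rewrite ay (le_trans yx).
  by rewrite ger0_norm; lra.
rewrite dS; lra.
Qed.

(** Intermediate value theorem for arc length, from its one-sided continuity at a supremum. It shows
    that [gt] is prescribed on all of [0, length]. *)
Lemma clen_surj (sig : R) : 0 <= sig <= clen a b ->
  exists2 t, a <= t <= b & clen a t = sig.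
Proof.
move=> /andP[s0 sl]; have [ab _] := rect.
pose S := [set t | a <= t <= b /\ clen a t <= sig].
have Sa : S a by split; [rewrite lexx ab | rewrite clenxx].
have supS : has_sup S by split; [exists a | exists b => t [/andP[]]].
pose t := sup S.
have at_ : a <= t by apply: sup_ubound => //; case: supS.
have tb : t <= b by apply: ge_sup; [exists a | move=> x [/andP[]]].
exists t; first by rewrite at_.
apply/eqP; rewrite eq_le; apply/andP; split.
  have [->|ta] := eqVneq t a; first by rewrite clenxx.
  have lat : a < t by rewrite lt_neqAle eq_sym ta.
  apply/ler_addgt0Pr => e e0.
  have [x' /andP[ax' x't] H] := clen_left lat tb e0.
  have tx' : 0 < t - x' by rewrite subr_gt0.
  have [y [/andP[ay yb] Sy] lt] := sup_adherent tx' supS.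
  have yt : y <= t by apply: sup_ubound => //; [case: supS | split => //; rewrite ay].
  have x'y : x' <= y by move: lt; rewrite -/t; lra.
  have := clen_add (lexx a) ay yt tb.
  by have := H y; rewrite x'y yt => /(_ isT); lra.
have [->//|tnb] := eqVneq t b.
have ltb : t < b by rewrite lt_neqAle tnb.
apply/ler_addgt0Pr => e e0.
have [x' /andP[tx' x'b] H] := clen_right at_ ltb e0.
have nS : ~ S x'.
  move=> Sx'; have : x' <= t by apply: sup_ubound => //; case: supS.
  by rewrite leNgt tx'.
have ax' := le_trans at_ (ltW tx').
have : sig < clen a x'.
  by rewrite ltNge; apply/negP => le; apply: nS; split => //; rewrite ax'.
have := clen_add (lexx a) at_ (ltW tx') x'b.
by have := H x'; rewrite (ltW tx') lexx => /(_ isT); lra.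
Qed.

End CurveLength.

Section UpperGradient.
Context (R : realType) (dX : measure_display) (X : measurableType dX).
Variables (d : X -> X -> R).
Hypothesis dm : is_metric d.

(** A copy of [X] with the Borel sets only: the measurable sets of [X] may form a larger class,
    while upper gradients must be Borel. *)
Definition borelType := g_sigma_algebraType (d_open d).
HB.instance Definition _ := Measurable.on borelType.

Lemma borel_onT (g : X -> \bar R) :
  borel_on d setT g <-> measurable_fun setT (g : borelType -> \bar R).
Proof.
split=> [H _ B mB|H B mB]; first exact: H.
exact: H.
Qed.

Lemma borel_open (U : set X) : d_open d U -> borel_sets d U.
Proof. by move=> oU; apply: sub_sigma_algebra. Qed.

Section ArcLength.
Variables (gam : R -> X) (a b : R) (gt : R -> X).
Hypothesis rect : rectifiable d gam a b.
Hypothesis gtE : forall t, a <= t <= b -> gt (fine (curve_length d gam a t)) = gam t.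

Let ab : a <= b. Proof. by case: rect. Qed.
Let ell := clen d gam a b.

Lemma arc_lipschitz s s' : 0 <= s -> s <= s' -> s' <= ell -> d (gt s) (gt s') <= s' - s.
Proof.
move=> s0 ss' s'l.
have [t /andP[a_t tb] tE] : exists2 t, a <= t <= b & clen d gam a t = s.
  by apply: (clen_surj dm rect); rewrite s0 (le_trans ss').
have [t' /andP[at' t'b] tE'] : exists2 t, a <= t <= b & clen d gam a t = s'.
  by apply: (clen_surj dm rect); rewrite (le_trans s0).
rewrite -{1}tE -{1}tE' !gtE ?a_t ?at' //.
have [le|/ltW le] := leP t t'.
  have := clen_add dm rect (lexx a) a_t le t'b.
  have := dist_le_clen dm rect a_t le t'b; lra.
have := clen_add dm rect (lexx a) at' le tb.
have := dist_le_clen dm rect at' le tb; have := clen_ge0 dm rect at' le tb.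
have [_ [_ [dS _]]] := dm; rewrite dS; lra.
Qed.

(** Since [gt] is 1-Lipschitz on the interval, the preimage of an open set is the trace of an open
    set of the line. *)
Lemma arc_measurable : measurable_fun `[0, ell] (gt : R -> borelType).
Proof.
apply: measurability (erefl : @measurable _ borelType = <<s d_open d >>) _.
move=> _ [U oU <-].
pose O := [set s : R | exists s0 r, [/\ 0 <= s0 <= ell, dball d (gt s0) r `<=` U & `|s - s0| < r]].
have -> : `[0, ell] `&` gt @^-1` U = `[0, ell] `&` O.
  apply/seteqP; split => s /= [sl Us]; split => //.
    have [r r0 rU] := oU _ Us; exists s, r; split => //.
    by rewrite subrr normr0.
  have [s0 [r [/andP[s00 s0l] rU lt]]] := Us.
  apply: rU => /=; apply: le_lt_trans lt.
  move: sl; rewrite in_itv /= => /andP[s_0 s_l].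
  have [le|/ltW le] := leP s s0.
    have [_ [_ [dS _]]] := dm; rewrite dS; apply: le_trans (arc_lipschitz s_0 le s0l) _.
    by rewrite -[X in X <= _]opprB ler_normr lexx orbT.
  apply: le_trans (arc_lipschitz s00 le s_l) _; exact: ler_norm.
apply: measurableI => //; apply: open_measurable.
rewrite openE => s [s0 [r [s0l rU lt]]]; rewrite /interior.
have e0 : 0 < r - `|s - s0| by rewrite subr_gt0.
apply/nbhs_ballP; exists (r - `|s - s0|) => //= z; rewrite /ball /= => zs.
exists s0, r; split => //.
have := ler_distD s z s0; rewrite [`|z - s|]distrC; lra.
Qed.

Lemma arc_comp_measurable (g : X -> \bar R) x y : borel_on d setT g ->
  a <= x -> x <= y -> y <= b ->
  measurable_fun `[clen d gam a x, clen d gam a y] (g \o gt).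
Proof.
move=> /borel_onT mg ax xy yb.
have mgt : measurable_fun `[0, ell] (g \o gt).
  exact: (measurableT_comp mg arc_measurable).
apply: measurable_funS mgt => //; apply: subset_itv; rewrite bnd_simp.
  by apply: (clen_ge0 dm rect) => //; exact: le_trans yb.
rewrite /ell (clen_add dm rect (lexx a) (le_trans ax xy) yb) // lerDl.
by apply: (clen_ge0 dm rect) => //; exact: le_trans xy.
Qed.

(** A translate of [gt] is the arc-length parametrization of the subcurve, and the integral is
    translated back. *)
Lemma upper_gradient_arc (V : normedModType R) (u : X -> V) (g : X -> \bar R) x y :
  upper_gradient d setT u g -> a <= x -> x <= y -> y <= b ->
  ((`|u (gam y) - u (gam x)|)%:E <=
    \int[lebesgue_measure]_(s in `[clen d gam a x, clen d gam a y]) g (gt s))%E.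
Proof.
move=> [bg [g0 ug]] ax xy yb.
have rxy : rectifiable d gam x y.
  have [_ [cont fin]] := rect; split => //; split.
    move=> t /andP[xt ty] e e0.
    have [|del del0 H] := cont t _ e e0; first by rewrite (le_trans ax) // (le_trans ty).
    exists del => // t' /andP[xt' ty']; apply: H.
    by rewrite (le_trans ax) // (le_trans ty').
  by rewrite (curve_length_fin dm rect ax xy yb) ltry.
have := ug gam x y rxy _ (fun s => gt (s + clen d gam a x)).
rewrite -/(clen d gam x y) => H; apply: le_trans (H _ _) _ => //.
  move=> t /andP[xt ty]; rewrite -/(clen d gam x t) addrC.
  rewrite -(clen_add dm rect (lexx a) ax xt (le_trans ty yb)) gtE //.
  by rewrite (le_trans ax) // (le_trans ty).
rewrite -(ge0_integral_shift (clen d gam a x)) //; last 2 first.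
- exact: arc_comp_measurable.
- by move=> s _; exact: g0.
have -> : clen d gam a x - clen d gam a x = 0 by rewrite subrr.
by rewrite (clen_add dm rect (lexx a) ax xy yb) addrAC subrr add0r.
Qed.

Lemma first_hit (F : set X) : d_open d (~` F) -> (exists2 t, a <= t <= b & F (gam t)) ->
  exists t, [/\ a <= t <= b, F (gam t) & forall t', a <= t' < t -> ~ F (gam t')].
Proof.
move=> oF [t1 t1ab Ft1]; pose S := [set t | a <= t <= b /\ F (gam t)].
have infS : has_inf S by split; [exists t1 | exists a => t [/andP[]]].
have a_t : a <= inf S by apply: lb_le_inf; [exists t1 | move=> t [/andP[]]].
have lb t : S t -> inf S <= t by move=> St; apply: inf_lbound => //; case: infS.
have tb : inf S <= b by apply: le_trans (lb _ (conj t1ab Ft1)) _; case/andP: t1ab.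
exists (inf S); split; first by rewrite a_t.
  apply: contrapT => /oF[r r0 rF]; have [_ [cont _]] := rect.
  have [|del del0 H] := cont (inf S) _ r r0; first by rewrite a_t.
  have [t [tab Ft] lt] := inf_adherent del0 infS.
  have := lb _ (conj tab Ft) => le.
  by apply: (rF (gam t)) => //=; apply: H => //; rewrite distrC ger0_norm; lra.
move=> t /andP[a_t' tlt] Ft; have : S t by split => //; rewrite a_t' (le_trans (ltW tlt)).
by move=> /lb; rewrite leNgt tlt.
Qed.

Lemma last_hit (F : set X) : d_open d (~` F) -> (exists2 t, a <= t <= b & F (gam t)) ->
  exists t, [/\ a <= t <= b, F (gam t) & forall t', t < t' <= b -> ~ F (gam t')].
Proof.
move=> oF [t1 t1ab Ft1]; pose S := [set t | a <= t <= b /\ F (gam t)].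
have supS : has_sup S by split; [exists t1 | exists b => t [/andP[]]].
have tb : sup S <= b by apply: ge_sup; [exists t1 | move=> t [/andP[]]].
have ub t : S t -> t <= sup S by move=> St; apply: sup_ubound => //; case: supS.
have a_t : a <= sup S by apply: le_trans (ub _ (conj t1ab Ft1)); case/andP: t1ab.
exists (sup S); split; first by rewrite a_t.
  apply: contrapT => /oF[r r0 rF]; have [_ [cont _]] := rect.
  have [|del del0 H] := cont (sup S) _ r r0; first by rewrite a_t.
  have [t [tab Ft] lt] := sup_adherent del0 supS.
  have := ub _ (conj tab Ft) => le.
  by apply: (rF (gam t)) => //=; apply: H => //; rewrite ger0_norm; lra.
move=> t /andP[tlt tb'] Ft; have : S t by split => //; rewrite tb' (le_trans _ (ltW tlt)).
by move=> /ub; rewrite leNgt tlt.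
Qed.

End ArcLength.

(* A curve is cut at its first and last hitting times of the closed set F, where
   u - f vanishes; the middle part does not contribute. *)
Lemma upper_gradient_off_closed (V : normedModType R) (u f : X -> V)
    (g : X -> \bar R) (L : R) (F : set X) :
  0 <= L -> (forall x y, `|f x - f y| <= L * d x y) ->
  d_open d (~` F) -> (forall x, F x -> u x = f x) ->
  upper_gradient d setT u g ->
  upper_gradient d setT (fun x => u x - f x)
    (fun x => if `[< F x >] then 0%E else (g x + L%:E)%E).
Proof.
move=> L0 fL oF uf ug; have [bg [g0 _]] := ug.
pose h x := if `[< F x >] then 0%E else (g x + L%:E)%E.
rewrite -[X in upper_gradient _ _ _ X]/h.
have mg : measurable_fun setT (g : borelType -> \bar R) by apply/borel_onT.
have mF : measurable (F : set borelType).
  by rewrite -[F]setCK; apply: measurableC; exact: borel_open.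
have h0 x : (0 <= h x)%E.
  by rewrite /h; case: asboolP => // _; rewrite adde_ge0 ?lee_fin //; exact: g0.
have bh : borel_on d setT h.
  apply/borel_onT; apply: measurable_fun_ifT => //.
    apply: (measurable_fun_bool true); rewrite setTI.
    by have -> : (fun x : borelType => `[< F x >]) @^-1` [set true] = F;
      [apply/seteqP; split => x /=; [move/asboolP | move=> ?; apply/asboolP] | exact: mF].
  by apply: emeasurable_funD.
split => //; split => // gam a b rect _ gt gtE.
have [ab _] := rect.
have seg x y : a <= x -> x <= y -> y <= b -> (forall t, x < t < y -> ~ F (gam t)) ->
  ((`|(u (gam y) - f (gam y)) - (u (gam x) - f (gam x))|)%:E <=
    \int[lebesgue_measure]_(s in `[clen d gam a x, clen d gam a y]) h (gt s))%E.
  move=> ax xy yb noF; have ay := le_trans ax xy; have xb := le_trans xy yb.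
  set p := clen d gam a x; set q := clen d gam a y.
  have pq : q = p + clen d gam x y by apply: (clen_add dm rect).
  have c0 : 0 <= clen d gam x y by apply: (clen_ge0 dm rect).
  have sub : `]p, q[ `<=` `[p, q]%classic by apply: subset_itvW.
  have mgq := arc_comp_measurable rect gtE bg ax xy yb.
  have mhq := arc_comp_measurable rect gtE bh ax xy yb.
  (* The endpoints may lie on [F], where [h] is 0 and not g + L; dropping them leaves the integral
     unchanged. *)
  rewrite (integral_itv_bndoo true false); last by apply: measurable_funS mhq.
  rewrite [leRHS](_ : _ = (\int[lebesgue_measure]_(s in `]p, q[) (g (gt s) + L%:E))%E); last first.
    apply: eq_integral => s; rewrite inE /= in_itv /= => /andP[ps sq].
    have [t /andP[a_t tb] tE] : exists2 t, a <= t <= b & clen d gam a t = s.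
      apply: (clen_surj dm rect); apply/andP; split.
        by apply: le_trans (ltW ps); apply: (clen_ge0 dm rect).
      have := clen_add dm rect (lexx a) ay yb (lexx b).
      have := clen_ge0 dm rect ay yb (lexx b); rewrite -/q; lra.
    rewrite /h asboolF // -tE gtE ?a_t //; apply: noF; apply/andP; split.
      rewrite ltNge; apply/negP => tx; have := clen_add dm rect (lexx a) a_t tx xb.
      have := clen_ge0 dm rect a_t tx xb; rewrite tE -/p; lra.
    rewrite ltNge; apply/negP => yt; have := clen_add dm rect (lexx a) ay yt tb.
    have := clen_ge0 dm rect ay yt tb; rewrite tE -/q; lra.
  rewrite -(integral_itv_bndoo true false); last first.
    by apply: emeasurable_funD => //; apply: measurable_funS mgq.
  rewrite ge0_integralD //; last first.
    by move=> s _; exact: g0.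
  rewrite integral_cst //= lebesgue_measure_itv /= lte_fin.
  have -> : (L%:E * (if (p < q)%R then q%:E - p%:E else 0) = (L * clen d gam x y)%:E)%E.
    case: ifP => [_|]; first by rewrite -EFinB -EFinM; congr (_%:E); rewrite pq; ring.
    move/negbT; rewrite -leNgt => qp; have -> : clen d gam x y = 0 by lra.
    by rewrite mulr0 mule0.
  apply: (@le_trans _ _ ((`|u (gam y) - u (gam x)|)%:E + (L * clen d gam x y)%:E)%E).
    rewrite -EFinD lee_fin.
    have -> : u (gam y) - f (gam y) - (u (gam x) - f (gam x)) =
        (u (gam y) - u (gam x)) - (f (gam y) - f (gam x)).
      by rewrite !opprD !opprK addrACA.
    apply: le_trans (ler_normB _ _) _; rewrite lerD2l.
    apply: le_trans (fL _ _) _; apply: ler_wpM2l => //.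
    have [_ [_ [dS _]]] := dm; rewrite dS; exact: (dist_le_clen dm rect).
  apply: leeD => //; exact: (upper_gradient_arc rect gtE ug ax xy yb).
rewrite -/(clen d gam a b) -[X in `[X, _]](clenxx dm rect (lexx a) ab).
have [hit|nohit] := pselect (exists2 t, a <= t <= b & F (gam t)); last first.
  apply: seg => // t /andP[/ltW a_t /ltW tb] Ft; apply: nohit; exists t => //.
  by rewrite a_t.
have [x [/andP[ax xb] Fx xP]] := first_hit rect oF hit.
have [y [/andP[ay yb] Fy yP]] := last_hit rect oF hit.
have xy : x <= y.
  by rewrite leNgt; apply/negP => yx; apply: (xP y) => //; rewrite ay.
have H1 : (forall t, a < t < x -> ~ F (gam t)).
  by move=> t /andP[a_t tx]; apply: xP; rewrite ltW.
have H2 : (forall t, y < t < b -> ~ F (gam t)).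
  by move=> t /andP[yt tb]; apply: yP; rewrite yt ltW.
have {}H1 := seg a x (lexx a) ax xb H1.
have {}H2 := seg y b ay yb (lexx b) H2.
rewrite (uf _ Fx) subrr sub0r in H1; rewrite (uf _ Fy) subrr subr0 in H2.
have mh := arc_comp_measurable rect gtE bh (lexx a) ab (lexx b).
have la := clenxx dm rect (lexx a) ab.
have lx := clen_ge0 dm rect (lexx a) ax xb.
have lxy := clen_add dm rect (lexx a) ax xy yb.
have lyb := clen_add dm rect (lexx a) ay yb (lexx b).
have c1 := clen_ge0 dm rect ax xy yb; have c2 := clen_ge0 dm rect ay yb (lexx b).
(* Open on the right, so that [A] and [B] are disjoint even if the two hitting times coincide. *)
set A := `[clen d gam a a, clen d gam a x[%classic.
set B := `[clen d gam a y, clen d gam a b]%classic.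
have mA : measurable A by exact: measurable_itv.
have mB : measurable B by exact: measurable_itv.
have AB : A `|` B `<=` `[clen d gam a a, clen d gam a b]%classic.
  rewrite subUset; split; apply: subset_itv; rewrite bnd_simp; lra.
apply: (@le_trans _ _ (\int[lebesgue_measure]_(s in A `|` B) h (gt s))%E); last first.
  by apply: ge0_subset_integral => //; exact: measurableU.
rewrite ge0_integral_setU //; first last.
- rewrite disj_set2E; apply/eqP/seteqP; split => // s [].
  by rewrite /A /B /= !in_itv /= => /andP[? ?] /andP[? ?]; lra.
- exact: (measurable_funS _ AB mh).
apply: (@le_trans _ _ ((`|u (gam b) - f (gam b)|)%:E + (`|u (gam a) - f (gam a)|)%:E)%E).
  by rewrite -EFinD lee_fin; exact: ler_normB.
rewrite addeC; apply: leeD => //.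
rewrite normrN in H1; apply: le_trans H1 _.
rewrite integral_itv_bndo_bndc //; apply: measurable_funS mh => //.
by move=> s As; apply: AB; left.
Qed.

End UpperGradient.

(** * Doubling measures and the Poincare inequality *)

Section AbsoluteContinuity.
Context (R : realType) (dX : measure_display) (X : measurableType dX).
Variable mu : {measure set X -> \bar R}.

(** Absolute continuity of the integral, applied to [fine \o G] because [G] is finite only almost
    everywhere. *)
Lemma ge0_integral_small (G : X -> \bar R) : measurable_fun setT G ->
  (forall x, (0 <= G x)%E) -> (\int[mu]_x G x < +oo)%E -> forall e : R, 0 < e ->
  exists2 del : R, 0 < del & forall A, measurable A -> (mu A < del%:E)%E ->
    (\int[mu]_(x in A) G x < e%:E)%E.
Proof.
move=> mG G0 Gfin e e0.
have iG : mu.-integrable setT G.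
  apply/integrableP; split => //; by under eq_integral do rewrite gee0_abs //.
have mfG : measurable_fun setT (fine \o G) by exact: measurableT_comp.
have ae : ae_eq mu setT G (EFin \o (fine \o G)).
  apply: filterS (integrable_ae measurableT iG) => x H xT.
  by rewrite /= fineK //; exact: H.
have ifG : mu.-integrable setT (EFin \o (fine \o G)).
  apply/integrableP; split; first exact/measurable_EFinP.
  rewrite (_ : (\int[mu]_x _ = \int[mu]_x G x)%E) //.
  apply: ge0_ae_eq_integral => //; first by apply: measurableT_comp => //; exact/measurable_EFinP.
  by apply: filterS ae => x Hx xT; rewrite [in RHS]Hx //= ger0_norm // fine_ge0.
have [del [del0 H]] := integral_normr_continuous ifG e0.
exists del => // A mA Ad; have := H A mA Ad; rewrite /Rintegral => lt.
have GA : (\int[mu]_(x in A) G x = \int[mu]_(x in A) (`|(fine \o G) x|)%:E)%E.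
  apply: ge0_ae_eq_integral => //; [exact: measurable_funTS | |].
    by apply/measurable_EFinP; apply: measurableT_comp => //; exact: measurable_funTS.
  by apply: filterS ae => x Hx Ax; rewrite Hx //= ger0_norm // fine_ge0.
rewrite GA -[X in (X < _)%E]fineK ?lte_fin //.
rewrite ge0_fin_numE; last by apply: integral_ge0 => x _; rewrite lee_fin.
rewrite -GA; apply: le_lt_trans Gfin; exact: ge0_subset_integral.
Qed.

End AbsoluteContinuity.

Section Doubling.
Context (R : realType) (dX : measure_display) (X : measurableType dX).
Variables (d : X -> X -> R) (mu : {measure set X -> \bar R}).
Hypothesis dm : is_metric d.
Hypothesis borel_meas : forall A, borel_sets d A -> measurable A.
Variables (Dm Cd : R).
Hypothesis Dm0 : 0 < Dm.
Hypothesis diam : forall x y, d x y <= Dm.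
Hypothesis mu_ball : forall x r, 0 < r ->
  (0 < mu (dball d x r))%E /\ (mu (dball d x r) < +oo)%E.
Hypothesis Cd1 : 1 <= Cd.
Hypothesis mu_doubling : forall x r, 0 < r ->
  (mu (dball d x (2 * r)) <= Cd%:E * mu (dball d x r))%E.
Implicit Types (x y z : X) (r : R).

Lemma dball_open x r : d_open d (dball d x r).
Proof.
have [d0 [dE [dS dT]]] := dm.
move=> y; rewrite {1}/dball /= => xy; exists (r - d x y); first by rewrite subr_gt0.
by move=> z; rewrite /dball /= => yz; have := dT x y z; lra.
Qed.

Lemma dball_measurable x r : measurable (dball d x r).
Proof. by apply: borel_meas; apply: borel_open; exact: dball_open. Qed.
Hint Resolve dball_measurable : core.

Lemma dball_center x r : 0 < r -> dball d x r x.
Proof. by move=> r0; have [_ [dE _]] := dm; rewrite /dball /= (proj2 (dE x x)). Qed.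

Lemma dball_sub x y r r' : d x y + r <= r' -> dball d y r `<=` dball d x r'.
Proof.
have [d0 [dE [dS dT]]] := dm.
by move=> le z; rewrite /dball /= => yz; have := dT x y z; lra.
Qed.

Definition vol x r : R := fine (mu (dball d x r)).

Lemma volE x r : 0 < r -> mu (dball d x r) = (vol x r)%:E.
Proof.
by move=> /(mu_ball x)[p0 pf]; rewrite /vol fineK // ge0_fin_numE // ltW.
Qed.

Lemma vol_gt0 x r : 0 < r -> 0 < vol x r.
Proof. by move=> r0; rewrite -lte_fin -volE //; case: (mu_ball x r0). Qed.

Lemma vol_le x y r r' : 0 < r -> d y x + r <= r' -> vol x r <= vol y r'.
Proof.
have [d0 [dE [dS dT]]] := dm.
move=> r0 le; have r'0 : 0 < r' by have := d0 y x; lra.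
rewrite -lee_fin -!volE //; apply: le_measure; rewrite ?inE //.
exact: dball_sub.
Qed.

Lemma vol_double x r k : 0 < r -> vol x (2 ^+ k * r) <= Cd ^+ k * vol x r.
Proof.
move=> r0; elim: k => [|k IH]; first by rewrite !expr0 !mul1r.
rewrite !exprS -!mulrA.
have kr : 0 < 2 ^+ k * r by rewrite mulr_gt0 // exprn_gt0.
apply: (@le_trans _ _ (Cd * vol x (2 ^+ k * r))).
  rewrite -lee_fin EFinM -!volE ?mulr_gt0 //; exact: mu_doubling.
by apply: ler_wpM2l => //; apply: le_trans Cd1.
Qed.

Definition total : R := fine (mu setT).

Lemma ball_total x r : Dm < r -> dball d x r = setT.
Proof. by move=> Dr; apply/seteqP; split => // y _ /=; apply: le_lt_trans Dr. Qed.

Lemma totalE : mu setT = total%:E.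
Proof.
rewrite /total -(@ball_total point (Dm + 1)) ?ltrDl // volE //.
by rewrite addr_gt0.
Qed.

Lemma total_gt0 : 0 < total.
Proof.
rewrite /total -(@ball_total point (Dm + 1)) ?ltrDl // -/(vol _ _).
by rewrite vol_gt0 // addr_gt0.
Qed.

Lemma mu_fin (A : set X) : measurable A -> (mu A < +oo)%E.
Proof.
move=> mA; apply: (@le_lt_trans _ _ (mu setT)); last by rewrite totalE ltry.
by apply: le_measure; rewrite ?inE.
Qed.

Lemma sum_integral_disjoint (I : eqType) (s : seq I) (B : I -> set X) (f : X -> \bar R) :
  (forall i, measurable (B i)) -> uniq s ->
  (forall i j, i \in s -> j \in s -> i != j -> B i `&` B j = set0) ->
  measurable_fun setT f -> (forall x, (0 <= f x)%E) ->
  (\sum_(i <- s) \int[mu]_(x in B i) f x =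
   \int[mu]_(x in \big[setU/set0]_(i <- s) B i) f x)%E.
Proof.
move=> mB us dis mf f0; rewrite ge0_integral_bigsetU //.
  by apply/trivIsetP => i j /= si sj ij; exact: dis.
exact: measurable_funTS.
Qed.

Lemma sum_vol_disjoint (I : eqType) (s : seq I) (c : I -> X) (r : I -> R) :
  uniq s -> (forall i, 0 < r i) ->
  (forall i j, i \in s -> j \in s -> i != j ->
     dball d (c i) (r i) `&` dball d (c j) (r j) = set0) ->
  (\sum_(i <- s) vol (c i) (r i))%:E = mu (\big[setU/set0]_(i <- s) dball d (c i) (r i)).
Proof.
move=> us r0 dis; rewrite -[RHS]mul1e -integral_cst; last exact: bigsetU_measurable.
rewrite -[RHS](@sum_integral_disjoint _ _ (fun i => dball d (c i) (r i))) //.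
rewrite -sumEFin; apply: eq_bigr => i _.
by rewrite -volE // integral_cst // mul1e.
Qed.

Definition separated r (s : seq X) := uniq s /\
  forall z z', z \in s -> z' \in s -> z != z' -> r <= d z z'.

Lemma separated_sum r s : 0 < r -> separated r s ->
  \sum_(z <- s) vol z (r / 2) <= total.
Proof.
have [d0 [dE [dS dT]]] := dm.
move=> r0 [us sep]; rewrite -lee_fin (@sum_vol_disjoint X s id (fun=> r / 2)) //.
- rewrite -totalE; apply: le_measure; rewrite ?inE //; exact: bigsetU_measurable.
- by move=> _; rewrite divr_gt0.
- move=> z z' zs zs' zz'; apply/seteqP; split => // x [] /= xz xz'.
  by have := sep z z' zs zs' zz'; have := dT z x z'; have := dS z' x; rewrite /dball /= in xz xz'; lra.
Qed.

(** A separated family of maximal size. Sizes are bounded: by doubling each ball of radius r / 2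
    carries a fixed fraction of the total mass, and these balls are disjoint. *)
Lemma net_exists r : 0 < r -> exists s : seq X, separated r s /\
  forall x, exists2 z, z \in s & d x z < r.
Proof.
have [d0 [dE [dS dT]]] := dm.
move=> r0.
have r2 : 0 < r / 2 by rewrite divr_gt0.
have [k kP] : exists k : nat, Dm < 2 ^+ k * (r / 2).
  have [m Hm] : exists m : nat, Dm / (r / 2) < m%:R.
    by exists (Num.bound (Dm / (r / 2))); apply: archi_boundP; rewrite divr_ge0 // ltW.
  exists m; rewrite -ltr_pdivrMr //; apply: lt_le_trans Hm _.
  by rewrite -natrX ler_nat ltnW // ltn_expl.
have lower z : total <= Cd ^+ k * vol z (r / 2).
  apply: le_trans (vol_double z k r2).
  by rewrite /vol ball_total.
have bound s : separated r s -> (size s)%:R <= Cd ^+ k.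
  move=> sep; have := separated_sum r0 sep => H.
  have Ck : 0 <= Cd ^+ k by rewrite exprn_ge0 //; apply: le_trans Cd1.
  rewrite -(ler_pM2r total_gt0); apply: le_trans (ler_wpM2l Ck H).
  have -> : (size s)%:R * total = \sum_(z <- s) total.
    by rewrite big_const_seq count_predT iter_addr_0 mulr_natl.
  rewrite mulr_sumr big_seq [leRHS]big_seq.
  by apply: ler_sum => z _; exact: lower.
pose P m := `[< exists2 s, separated r s & size s = m >].
have exP : exists m, P m by exists 0%N; apply/asboolP; exists [::].
have ubP m : P m -> (m <= Num.bound (Cd ^+ k))%N.
  move=> /asboolP[s /bound sb <-]; rewrite -(@ler_nat R) ltW //.
  apply: le_lt_trans sb _; apply: archi_boundP.
  by rewrite exprn_ge0 //; apply: le_trans Cd1.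
case: (ex_maxnP exP ubP) => m /asboolP[s [us sep] sm] mmax.
exists s; split => // x; apply: contrapT => nx.
have far z : z \in s -> r <= d x z.
  by move=> zs; rewrite leNgt; apply/negP => lt; apply: nx; exists z.
suff : (m < m)%N by rewrite ltnn.
apply: mmax; apply/asboolP; exists (x :: s); last by rewrite /= sm.
split => /=.
  rewrite us andbT; apply/negP => xs; have := far x xs.
  by rewrite (proj2 (dE x x)) // leNgt r0.
move=> z z'; rewrite !inE => /orP[/eqP ->|zs] /orP[/eqP ->|zs'] //.
- by rewrite eqxx.
- by move=> _; exact: far.
- by move=> _; rewrite dS; exact: far.
- exact: sep.
Qed.

(** Sets are examined in order of increasing index, which will mean decreasing radius; a discarded
    one meets a kept one at least as large. *)
Lemma greedy_disjoint (c : nat * X -> set X) (l : seq (nat * X)) :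
  (forall p, c p !=set0) -> pairwise (fun p q => p.1 <= q.1)%N l -> exists s,
  [/\ uniq s, {subset s <= l},
      forall p q, p \in s -> q \in s -> p != q -> c p `&` c q = set0 &
      forall p, p \in l -> exists q, [/\ q \in s, (q.1 <= p.1)%N & c q `&` c p !=set0]].
Proof.
move=> c0; elim/last_ind: l => [|l p IH]; first by exists [::].
rewrite pairwise_rcons => /andP[/allP lp /IH[s [us sub dis cov]]].
have [[q qs qp]|no] := pselect (exists2 q, q \in s & c q `&` c p !=set0).
  exists s; split => //; first by move=> x /sub xl; rewrite mem_rcons inE xl orbT.
  move=> x; rewrite mem_rcons inE => /orP[/eqP ->|/cov//].
  by exists q; split => //; apply: lp; exact: sub.
have dp q : q \in s -> c q `&` c p = set0.
  by move=> qs; apply/seteqP; split => // x qpx; apply: no; exists q => //; exists x.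
exists (p :: s); split.
- rewrite /= us andbT; apply/negP => ps; have [x px] := c0 p.
  by have := dp p ps; rewrite setIid => E; rewrite E in px.
- move=> x; rewrite inE mem_rcons inE => /orP[->//|/sub ->]; exact: orbT.
- move=> x y; rewrite !inE => /orP[/eqP ->|xs] /orP[/eqP ->|ys] //.
  + by rewrite eqxx.
  + by move=> _; rewrite setIC; exact: dp.
  + by move=> _; exact: dp.
  + exact: dis.
- move=> x; rewrite mem_rcons inE => /orP[/eqP ->|/cov[q [qs qx cqx]]].
    by exists p; rewrite inE eqxx leqnn setIid; split.
  by exists q; rewrite inE qs orbT; split.
Qed.

Lemma mu_bigsetU_le (I : Type) (s : seq I) (B : I -> set X) :
  (forall i, measurable (B i)) ->
  (mu (\big[setU/set0]_(i <- s) B i) <= \sum_(i <- s) mu (B i))%E.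
Proof.
move=> mB; elim: s => [|i s IH]; first by rewrite !big_nil measure0.
have mU : measurable (\big[setU/set0]_(i <- s) B i) by exact: bigsetU_measurable.
rewrite !big_cons; apply: (le_trans (measureU2 mu (mB i) mU)).
by apply: leeD.
Qed.

Definition rad (i : nat) : R := Dm / 2 ^+ i.

Lemma rad_gt0 i : 0 < rad i. Proof. by rewrite divr_gt0 // exprn_gt0. Qed.
Hint Resolve rad_gt0 : core.

Lemma radS i : rad i = 2 * rad i.+1.
Proof. by rewrite /rad exprS; field; rewrite expf_neq0. Qed.

Lemma rad_le i j : (i <= j)%N -> rad j <= rad i.
Proof.
move=> ij; rewrite /rad ler_pM2l // lef_pV2 ?posrE ?exprn_gt0 //.
by apply: (ler_weXn2l _ ij); rewrite ler1n.
Qed.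

Variable N : nat -> seq X.
Hypothesis N_sep : forall i, separated (rad i) (N i).
Hypothesis N_cover : forall i x, exists2 z, z \in N i & d z x < rad i.

(** * The set where averages of the energy density are large *)

Section BadBalls.
Variables (kap : R) (G : X -> \bar R).
Hypothesis kap1 : 1 <= kap.
Hypothesis mG : measurable_fun setT G.
Hypothesis G0 : forall x, (0 <= G x)%E.
Hypothesis Gfin : (\int[mu]_x G x < +oo)%E.

Let kap0 : 0 < kap. Proof. exact: lt_le_trans kap1. Qed.
Let kr0 i : 0 < kap * rad i. Proof. by rewrite mulr_gt0. Qed.

Definition bad_ball (T : R) (i : nat) (z : X) : Prop :=
  (T%:E * mu (dball d z (kap * rad i)) < \int[mu]_(y in dball d z (kap * rad i)) G y)%E.

Definition bad_set (T : R) : set X :=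
  [set x | exists i z, [/\ z \in N i, bad_ball T i z & d z x < rad i]].

Fixpoint bad_list (T : R) (k : nat) : seq (nat * X) :=
  if k is k'.+1 then bad_list T k' ++ [seq (k', z) | z <- N k' & `[< bad_ball T k' z >]]
  else [::].

Lemma mem_bad_list T k p : (p \in bad_list T k) <->
  [/\ (p.1 < k)%N, p.2 \in N p.1 & bad_ball T p.1 p.2].
Proof.
elim: k => [|k IH]; first by split => // -[].
rewrite /= mem_cat; split.
  move=> /orP[/IH[p1 p2 p3]|/mapP[z]]; first by split => //; exact: ltnW.
  by rewrite mem_filter => /andP[/asboolP bz zN] ->.
move=> [p1 p2 p3]; move: p1; rewrite ltnS leq_eqVlt => /orP[/eqP E|lt].
  apply/orP; right; apply/mapP; exists p.2; last by rewrite -E; case: (p).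
  by rewrite mem_filter -E p2 andbT; apply/asboolP.
by apply/orP; left; apply/IH.
Qed.

Lemma bad_list_sorted T k : pairwise (fun p q => p.1 <= q.1)%N (bad_list T k).
Proof.
elim: k => //= k IH; rewrite pairwise_cat IH /=; apply/andP; split.
  apply/allrelP => p q /mem_bad_list[pk _ _] /mapP[z _ ->]; exact: ltnW.
rewrite pairwise_map; elim: [seq z <- N k | `[< bad_ball T k z >]] => //= z s IHs.
by rewrite IHs andbT; apply/allP => y _ /=.
Qed.

Definition bad_part T k := \big[setU/set0]_(p <- bad_list T k) dball d p.2 (rad p.1).

Lemma bad_part_measurable T k : measurable (bad_part T k).
Proof. exact: bigsetU_measurable. Qed.

Lemma bad_partP T k x : bad_part T k x <->
  exists i z, [/\ (i < k)%N, z \in N i, bad_ball T i z & d z x < rad i].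
Proof.
rewrite /bad_part -bigcup_seq; split.
  by move=> [[i z] /= /mem_bad_list[ik zN bz] xz]; exists i, z.
by move=> [i [z [ik zN bz xz]]]; exists (i, z) => //=; apply/mem_bad_list.
Qed.

Lemma bad_setE T : bad_set T = \bigcup_k bad_part T k.
Proof.
apply/seteqP; split => x.
  by move=> [i [z [zN bz xz]]]; exists i.+1 => //; apply/bad_partP; exists i, z.
by move=> [k _ /bad_partP[i [z [ik zN bz xz]]]]; exists i, z.
Qed.

Lemma bad_set_measurable T : measurable (bad_set T).
Proof. by rewrite bad_setE; apply: bigcupT_measurable => k; exact: bad_part_measurable. Qed.

(* Vitali covering argument along the dyadic scales, largest balls first. *)
Lemma bad_part_small T k (e del : R) : 0 < T -> 0 <= e ->
  (forall A, measurable A -> (mu A < del%:E)%E -> (\int[mu]_(x in A) G x < e%:E)%E) ->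
  (\int[mu]_x G x < (T * del)%:E)%E ->
  (T%:E * mu (bad_part T k) <= (Cd ^+ 2 * e)%:E)%E.
Proof.
have [d0 [dE [dS dT]]] := dm.
move=> T0 e0 small Tdel.
pose c (p : nat * X) := dball d p.2 (kap * rad p.1).
have [|s [us sub dis cov]] := greedy_disjoint (c := c) _ (bad_list_sorted T k).
  by move=> p; exists p.2; apply: dball_center.
pose W := \big[setU/set0]_(q <- s) c q.
have mc q : measurable (c q) by exact: dball_measurable.
have mW : measurable W by exact: bigsetU_measurable.
have WG : (\sum_(q <- s) \int[mu]_(x in c q) G x = \int[mu]_(x in W) G x)%E.
  exact: sum_integral_disjoint.
have volW : (\sum_(q <- s) vol q.2 (kap * rad q.1))%:E = mu W.
  apply: (@sum_vol_disjoint _ s snd (fun q => kap * rad q.1)) => //.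
have TW : (T%:E * mu W <= \int[mu]_(x in W) G x)%E.
  rewrite -volW -WG -EFinM mulr_sumr -sumEFin big_seq [leRHS]big_seq.
  apply: lee_sum => q /sub /mem_bad_list[_ _ /ltW].
  by rewrite volE // EFinM.
have WGfin : (\int[mu]_(x in W) G x <= \int[mu]_x G x)%E.
  exact: ge0_subset_integral.
(* The total energy alone bounds T mu W by a constant. Since [W] is thereby small, absolute
   continuity bounds the energy on [W] itself by e: this upgrades O(1/T) to o(1/T). *)
have muW : (mu W < del%:E)%E.
  have := le_lt_trans (le_trans TW WGfin) Tdel.
  by rewrite -volW -EFinM !lte_fin ltr_pM2l.
(* A point of a discarded ball is within three radii of the centre of a kept one; the factor 4
   amounts to two doublings. *)
have sube : bad_part T k `<=` \big[setU/set0]_(q <- s) dball d q.2 (2 ^+ 2 * (kap * rad q.1)).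
  move=> x /bad_partP[i [z [ik zN bz xz]]].
  have [|q [qs qi [y [qy zy]]]] := cov (i, z); first by apply/mem_bad_list.
  rewrite -bigcup_seq; exists q => //=.
  have := rad_le qi; rewrite /= => ri.
  have H1 : kap * rad i <= kap * rad q.1 by rewrite ler_pM2l.
  have H2 : rad i <= kap * rad i by rewrite ler_peMl // ltW.
  rewrite /c /dball /= in qy zy *.
  have := dT q.2 y x; have := dT y z x; have := dS y z; have := rad_gt0 i; lra.
apply: (@le_trans _ _ (T%:E * (Cd ^+ 2 * \sum_(q <- s) vol q.2 (kap * rad q.1))%:E)%E).
  apply: lee_wpmul2l; first by rewrite lee_fin ltW.
  apply: le_trans (le_measure _ _ _ sube) _; rewrite ?inE.
  - exact: bad_part_measurable.
  - exact: bigsetU_measurable.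
  apply: le_trans (mu_bigsetU_le _ _) _ => //.
  rewrite mulr_sumr -sumEFin; apply: lee_sum => q _.
  by rewrite volE ?mulr_gt0 // lee_fin; exact: vol_double.
rewrite -EFinM mulrCA EFinM; apply: (@le_trans _ _ ((Cd ^+ 2)%:E * \int[mu]_(x in W) G x)%E).
  apply: lee_wpmul2l; last by rewrite EFinM volW.
  by rewrite lee_fin exprn_ge0 //; apply: le_trans Cd1.
rewrite [leRHS]EFinM; apply: lee_wpmul2l; last by apply: ltW; exact: small.
by rewrite lee_fin exprn_ge0 //; apply: le_trans Cd1.
Qed.

Lemma bad_set_small (e : R) : 0 < e -> exists2 T0 : R, 0 < T0 &
  forall T, T0 <= T -> (T%:E * mu (bad_set T) <= e%:E)%E.
Proof.
move=> e0; have C0 : 0 < Cd ^+ 2 by rewrite exprn_gt0 //; apply: lt_le_trans Cd1.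
have e'0 : 0 < e / Cd ^+ 2 by rewrite divr_gt0.
have [del del0 small] := ge0_integral_small mG G0 Gfin e'0.
pose g := fine (\int[mu]_x G x).
have gE : (\int[mu]_x G x)%E = g%:E.
  by rewrite /g fineK // ge0_fin_numE //; exact: integral_ge0.
have g0 : 0 <= g by apply: fine_ge0; exact: integral_ge0.
exists (g / del + 1); first by rewrite ltr_wpDl // divr_ge0 // ltW.
move=> T TT0.
have T0 : 0 < T by apply: lt_le_trans TT0; rewrite ltr_wpDl // divr_ge0 // ltW.
have part k : (mu (bad_part T k) <= (e / T)%:E)%E.
  have := @bad_part_small T k _ _ T0 (ltW e'0) small.
  rewrite gE lte_fin -ltr_pdivrMr // [Cd ^+ 2 * _]mulrCA mulfV ?gt_eqF // mulr1.
  have lt : g / del < T by lra.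
  move=> /(_ lt); have := mu_fin (bad_part_measurable T k).
  rewrite -ge0_fin_numE //; case: (mu _) => // m _.
  by rewrite -EFinM !lee_fin ler_pdivlMr // mulrC.
suff : (mu (bad_set T) <= (e / T)%:E)%E.
  have := mu_fin (bad_set_measurable T).
  rewrite -ge0_fin_numE //; case: (mu _) => // m _.
  by rewrite -EFinM !lee_fin ler_pdivlMr // mulrC.
have cv : mu \o bad_part T @ \oo --> mu (\bigcup_k bad_part T k).
  apply: nondecreasing_cvg_mu.
  - by move=> k; exact: bad_part_measurable.
  - by rewrite -bad_setE; exact: bad_set_measurable.
  - move=> k l kl; apply/subsetPset => x /bad_partP[i [z [ik zN bz xz]]].
    by apply/bad_partP; exists i, z; split => //; exact: leq_trans kl.
rewrite bad_setE -(cvg_lim _ cv) //; apply: lime_le; first by apply/cvg_ex; eexists; exact: cv.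
by apply: nearW => k; exact: part.
Qed.

End BadBalls.

(** * Telescoping of averages by the Poincare inequality *)

Section PoincareChain.
Variables (p CP sig : R).
Hypothesis p1 : 1 <= p.
Hypothesis CP0 : 0 < CP.
Hypothesis sig1 : 1 <= sig.
Hypothesis poin : forall (x : X) (r : R), 0 < r ->
  forall u : X -> R, mu.-integrable (dball d x (sig * r)) (EFin \o u) ->
  forall g : X -> \bar R, upper_gradient d (dball d x (sig * r)) u g ->
  let B := dball d x r in
  let sB := dball d x (sig * r) in
  let uB := fine (\int[mu]_(y in B) (u y)%:E) / fine (mu B) in
  ((fine (mu B))^-1%:E * \int[mu]_(y in B) (`|u y - uB|)%:E <=
    CP%:E * diamE d B *
    poweR ((fine (mu sB))^-1%:E * \int[mu]_(y in sB) poweR (g y) p) p^-1)%E.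
Variables (g : X -> \bar R).
Hypothesis Gfin : (\int[mu]_x poweR (g x) p < +oo)%E.
Let G x := poweR (g x) p.
(** Averages at scale i run over balls of radius 5 rad i. Such a ball contains the ball of the next
    scale, of radius 5/2 rad i, around any centre within 5/2 rad i. The factor [sig] is the
    enlargement in the Poincare inequality. *)
Let kap : R := sig * 5.
Variable t : R.
Hypothesis t0 : 0 < t.
Notation T := (t `^ p).
Notation good_ball i z := (~ bad_ball kap G T i z).
Notation bad := (bad_set kap G T).

Lemma upper_gradient_restrict (V : normedModType R) (u : X -> V) (U : set X) :
  d_open d U -> upper_gradient d setT u g -> upper_gradient d U u g.
Proof.
move=> oU [bg [g0 H]]; split; [|split].
- move=> B mB; have oT : d_open d setT by move=> x _; exists 1.
  have /borel_onT mg : measurable_fun setT (g : borelType d -> \bar R) by apply/borel_onT.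
  have mU : measurable (U : set (borelType d)) by exact: borel_open.
  have mgB : measurable (g @^-1` B : set (borelType d)).
    by have := mg B mB; rewrite setTI.
  exact: (measurableI _ _ mU mgB).
- by move=> x _; exact: g0.
- by move=> gam a b rect _ gt gtE; exact: H.
Qed.

Lemma diam_ball_le x r : 0 < r -> (0 <= diamE d (dball d x r) <= (2 * r)%:E)%E.
Proof.
have [d0 [dE [dS dT]]] := dm.
move=> r0; apply/andP; split.
  apply: ereal_sup_ubound; exists x, x; rewrite (proj2 (dE x x)) //.
  by split; [exact: dball_center | split => //; exact: dball_center].
apply: ge_ereal_sup => _ [y [z [xy [xz ->]]]]; rewrite lee_fin.
by rewrite /dball /= in xy xz; have := dT y x z; have := dS x y; lra.
Qed.

Section Oscillation.
Variable u : X -> R.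
Hypothesis iu : mu.-integrable setT (EFin \o u).
Hypothesis ug : upper_gradient d setT u g.

Definition uavg x r : R := fine (\int[mu]_(y in dball d x r) (u y)%:E) / vol x r.

Definition osc x r : \bar R := \int[mu]_(y in dball d x r) (`|u y - uavg x r|)%:E.

Let mu_ : measurable_fun setT u.
Proof. by apply/measurable_EFinP; case/integrableP: iu. Qed.

Lemma osc_le x r : 0 < r ->
  (\int[mu]_(y in dball d x (sig * r)) G y <= T%:E * mu (dball d x (sig * r)))%E ->
  (osc x r <= (2 * CP * r * t * vol x r)%:E)%E.
Proof.
move=> r0 GT.
have sr0 : 0 < sig * r by rewrite mulr_gt0 //; apply: lt_le_trans sig1.
have p0 : 0 < p by apply: lt_le_trans p1.
have iB : mu.-integrable (dball d x (sig * r)) (EFin \o u) by exact: integrableS iu.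
have ugB : upper_gradient d (dball d x (sig * r)) u g.
  by apply: upper_gradient_restrict => //; exact: dball_open.
have := poin r0 iB ugB; rewrite /= -/(vol x r) -/(vol x (sig * r)) -/(uavg x r) -/(osc x r) => H.
have v0 := vol_gt0 x r0; have sv0 := vol_gt0 x sr0.
have /andP[D0 Dle] := diam_ball_le x r0.
have inner : (0 <= (vol x (sig * r))^-1%:E * \int[mu]_(y in dball d x (sig * r)) poweR (g y) p <= T%:E)%E.
  apply/andP; split.
    apply: mule_ge0; first by rewrite lee_fin invr_ge0 ltW.
    by apply: integral_ge0 => y _; exact: poweR_ge0.
  rewrite muleC lee_pdivrMr // -volE //.
have pw : (poweR ((vol x (sig * r))^-1%:E * \int[mu]_(y in dball d x (sig * r)) poweR (g y) p) p^-1
    <= t%:E)%E.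
  have -> : t%:E = poweR T%:E p^-1.
    by rewrite poweR_EFin -powRrM mulfV ?gt_eqF // powRr1 // ltW.
  have /andP[i0 iT] := inner.
  apply: gt0_ler_poweR => //; first by rewrite invr_ge0 ltW.
    by rewrite in_itv /= i0 leey.
  by rewrite in_itv /= lee_fin powR_ge0 leey.
have {}H : ((vol x r)^-1%:E * osc x r <= (2 * CP * r * t)%:E)%E.
  apply: le_trans H _; rewrite -muleA.
  have -> : 2 * CP * r * t = CP * (2 * r * t) by ring.
  rewrite EFinM; apply: lee_wpmul2l; first by rewrite lee_fin ltW.
  by rewrite EFinM; apply: lee_pmul => //; exact: poweR_ge0.
move: H; rewrite muleC lee_pdivrMr //.
Qed.

Lemma uavg_close x y r s M : 0 < r -> 0 < s -> dball d y s `<=` dball d x r ->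
  (osc x r <= M%:E)%E -> `|uavg y s - uavg x r| * vol y s <= M.
Proof.
move=> r0 s0 sub oM; set c := uavg x r; have v0 := vol_gt0 y s0.
have iB : mu.-integrable (dball d y s) (EFin \o u) by exact: integrableS iu.
have ic : mu.-integrable (dball d y s) (EFin \o cst c).
  apply/integrableP; split; first by apply/measurable_EFinP; exact: measurable_cst.
  rewrite (_ : (\int[mu]_(z in _) _ = \int[mu]_(z in dball d y s) cst (`|c|%:E) z)%E) //.
  by rewrite integral_cst // volE // -EFinM ltry.
have E : (\int[mu]_(z in dball d y s) (u z - c)%:E = ((uavg y s - c) * vol y s)%:E)%E.
  under eq_integral do rewrite EFinB.
  rewrite (integralB_EFin _ iB ic) //.
  have -> : (\int[mu]_(z in dball d y s) (cst c z)%:E = (c * vol y s)%:E)%E.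
    rewrite -[LHS]/(\int[mu]_(z in dball d y s) cst c%:E z)%E integral_cst //.
    by rewrite volE // -EFinM.
  rewrite -[X in (X - _)%E]fineK; last exact: (integrable_fin_num _ iB).
  by rewrite -EFinB mulrBl /uavg divfK // gt_eqF.
rewrite -lee_fin -(gtr0_norm v0) -normrM; apply: le_trans oM.
have -> : ((`|(uavg y s - c) * vol y s|)%:E = `|(((uavg y s - c) * vol y s)%:E)|)%E by [].
rewrite -E; apply: le_trans (le_abse_integral _ _ _) _ => //.
  by apply/measurable_EFinP; apply: measurable_funB => //; exact: measurable_funTS.
apply: ge0_subset_integral => //.
apply/measurable_EFinP; apply: measurableT_comp => //.
by apply: measurable_funB => //; exact: measurable_funTS.
Qed.

Definition net_avg i z : R := uavg z (5 * rad i).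

Lemma net_osc_le i z : good_ball i z ->
  (osc z (5 * rad i) <= (10 * CP * rad i * t * vol z (5 * rad i))%:E)%E.
Proof.
move=> gb; have r0 : 0 < 5 * rad i by rewrite mulr_gt0.
have -> : 10 * CP * rad i * t = 2 * CP * (5 * rad i) * t by ring.
apply: osc_le => //; rewrite mulrA leNgt; apply/negP => lt; exact: gb.
Qed.

(** The 10 bounds the diameter of a ball of radius 5 rad i in units of rad i; Cd^2 compares the
    volumes of consecutive balls. *)
Definition chainK : R := 10 * CP * Cd ^+ 2.

Lemma net_avg_step i z z' : good_ball i z -> d z z' <= 5 / 2 * rad i ->
  `|net_avg i.+1 z' - net_avg i z| <= chainK * rad i * t.
Proof.
have [d0 [dE [dS dT]]] := dm.
move=> gb zz'; have ri := rad_gt0 i; have ri1 := rad_gt0 i.+1; have rS := radS i.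
have r5 : 0 < 5 * rad i by rewrite mulr_gt0.
have r51 : 0 < 5 * rad i.+1 by rewrite mulr_gt0.
have v0 := vol_gt0 z' r51.
have sub : dball d z' (5 * rad i.+1) `<=` dball d z (5 * rad i).
  by apply: dball_sub; lra.
have := uavg_close r5 r51 sub (net_osc_le gb).
rewrite -/(net_avg _ _) -/(net_avg _ _) => H.
have volz : vol z (5 * rad i) <= Cd ^+ 2 * vol z' (5 * rad i.+1).
  apply: le_trans (vol_double z' 2 r51); apply: vol_le => //.
  have E4 : 2 ^+ 2 = 4 :> R by ring.
  by rewrite dS E4; lra.
rewrite -(ler_pM2r v0); apply: le_trans H _.
have -> : chainK * rad i * t * vol z' (5 * rad i.+1) =
  10 * CP * rad i * t * (Cd ^+ 2 * vol z' (5 * rad i.+1)) by rewrite /chainK; ring.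
by apply: ler_wpM2l => //; rewrite ltW // !mulr_gt0.
Qed.

Lemma bad_setN x i z : ~ bad x -> z \in N i -> d z x < rad i -> good_ball i z.
Proof. by move=> nb zN zx bz; apply: nb; exists i, z. Qed.

Definition avg_cvg x := forall e : R, 0 < e -> exists i0, forall i z, (i0 <= i)%N ->
  z \in N i -> d z x < rad i -> `|u x - net_avg i z| <= e.

(* This replaces the Lebesgue differentiation theorem: off the bad set the
   Poincare inequality bounds the L^1 distance between u and its averages at
   scale rad i by a multiple of rad i, which is summable. *)
Lemma avg_cvg_ae : {ae mu, forall x, ~ bad x -> avg_cvg x}.
Proof.
pose gN i := [seq z <- N i | ~~ `[< bad_ball kap G T i z >]].
pose B i z := dball d z (rad i).
have mB i z : measurable (B i z) by exact: dball_measurable.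
pose h i z := (fun y => (`|u y - net_avg i z|)%:E) \_ (B i z).
pose f i x : \bar R := (\sum_(z <- gN i) h i z x)%E.
have h0 i z x : (0 <= h i z x)%E by apply: erestrict_ge0 => y _; rewrite lee_fin.
have mh i z : measurable_fun setT (h i z).
  apply/(measurable_restrictT _ (dball_measurable z (rad i))).
  apply/measurable_EFinP; apply: measurableT_comp => //.
  by apply: measurable_funB => //; exact: measurable_funTS.
have f0 i x : (0 <= f i x)%E by apply: sume_ge0.
have mf i : measurable_fun setT (f i) by exact: emeasurable_sum.
(* The balls of radius rad i / 2 around net points are disjoint, so their volumes add up to at most
   [total]; four doublings of this radius exceed 5 rad i. *)
pose K := 10 * CP * t * (Cd ^+ 4 * total).
have intf i : (\int[mu]_x f i x <= (K * rad i)%:E)%E.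
  rewrite ge0_integral_sum //.
  have ri := rad_gt0 i.
  have r5 : 0 < 5 * rad i by rewrite mulr_gt0.
  have r2 : 0 < rad i / 2 by rewrite divr_gt0.
  apply: (@le_trans _ _ (\sum_(z <- gN i) (10 * CP * rad i * t * (Cd ^+ 4 * vol z (rad i / 2)))%:E)%E).
    rewrite big_seq [leRHS]big_seq; apply: lee_sum => z.
    rewrite mem_filter => /andP[/asboolPn gb zN].
    rewrite -integral_mkcond.
    apply: (@le_trans _ _ (osc z (5 * rad i))).
      apply: ge0_subset_integral => //.
        apply/measurable_EFinP; apply: measurableT_comp => //.
        by apply: measurable_funB => //; exact: measurable_funTS.
      apply: dball_sub; have [_ [dE _]] := dm; rewrite (proj2 (dE z z)) //; lra.
    apply: le_trans (net_osc_le gb) _; rewrite lee_fin.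
    apply: ler_wpM2l; first by rewrite ltW // !mulr_gt0.
    apply: le_trans (vol_double z 4 r2); apply: vol_le => //.
    have [_ [dE _]] := dm; rewrite (proj2 (dE z z)) //.
    have E16 : 2 ^+ 4 = 16 :> R by ring.
    by rewrite E16; lra.
  rewrite sumEFin lee_fin -mulr_sumr -mulr_sumr.
  have -> : K * rad i = 10 * CP * rad i * t * (Cd ^+ 4 * total) by rewrite /K; ring.
  apply: ler_wpM2l; first by rewrite ltW // !mulr_gt0.
  apply: ler_wpM2l; first by rewrite exprn_ge0 //; apply: le_trans Cd1.
  apply: le_trans (separated_sum (rad_gt0 i) (N_sep i)).
  rewrite /gN big_filter big_mkcond /=; apply: ler_sum => z _.
  by case: ifP => // _; rewrite ltW // vol_gt0.
have K0 : 0 <= K.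
  have Cd0 : 0 < Cd := lt_le_trans ltr01 Cd1.
  have tot := total_gt0.
  by rewrite ltW // /K !mulr_gt0 // exprn_gt0.
have rsum n : \sum_(0 <= i < n) rad i <= 2 * Dm.
  suff -> : \sum_(0 <= i < n) rad i = 2 * Dm - 2 * rad n.
    by have := rad_gt0 n; lra.
  elim: n => [|n IH]; first by rewrite big_nil /rad expr0 divr1 subrr.
  by rewrite big_nat_recr //= IH (radS n); lra.
have Sfin : (\int[mu]_x (\sum_(i <oo) f i x) < +oo)%E.
  rewrite integral_nneseries //.
  apply: (@le_lt_trans _ _ (K * (2 * Dm))%:E); last exact: ltry.
  apply: lime_le.
    by apply: is_cvg_nneseries => i _ _; apply: integral_ge0.
  apply: nearW => n; apply: (@le_trans _ _ (\sum_(0 <= i < n) (K * rad i)%:E)%E).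
    by apply: lee_sum => i _; exact: intf.
  by rewrite sumEFin lee_fin -mulr_sumr; apply: ler_wpM2l => //; exact: rsum.
have mS : measurable_fun setT (fun x => \sum_(i <oo) f i x)%E.
  by apply: ge0_emeasurable_sum => // i x _ _; exact: f0.
have iS : mu.-integrable setT (fun x => \sum_(i <oo) f i x)%E.
  apply/integrableP; split => //.
  rewrite (_ : (\int[mu]_x _)%E = (\int[mu]_x \sum_(i <oo) f i x)%E) //.
  by apply: eq_integral => x _; rewrite gee0_abs //; apply: nneseries_ge0.
apply: filterS (integrable_ae measurableT iS) => x /(_ I) xfin nb e e0.
have ffin i : f i x = (fine (f i x))%:E.
  by rewrite fineK //; apply/sum_fin_numP => z _ _; rewrite /h patchE; case: ifP.
pose phi i := fine (f i x).
have phi0 i : 0 <= phi i by exact: fine_ge0.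
have cvphi : phi @ \oo --> 0.
  apply: cvg_series_cvg_0; apply: nondecreasing_is_cvgn.
    by apply/nondecreasing_seqP => n; rewrite /series /= big_nat_recr //= lerDl.
  exists (fine (\sum_(i <oo) f i x)%E) => _ [n _ <-].
  rewrite -lee_fin fineK // /series /= -sumEFin.
  rewrite (eq_bigr (fun i => f i x)); last by move=> i _; rewrite -ffin.
  exact: nneseries_lim_ge.
have [i0 _ Hi0] : \forall i \near \oo, phi i < e.
  have := cvgr_lt 0 cvphi e e0; exact.
exists i0 => i z ii zN zx.
have gb := bad_setN nb zN zx.
apply: le_trans (ltW (Hi0 i ii)); rewrite -lee_fin -ffin /f.
have zg : z \in gN i by rewrite mem_filter zN andbT; apply/asboolPn.
rewrite (big_rem z zg) /=; apply: (@le_trans _ _ (h i z x)).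
  by rewrite /h patchE mem_set.
by rewrite leeDl // sume_ge0.
Qed.

(** Telescopes along net points [w j] tending to [x]; the partial geometric sums are written 2 rad i
    - rad (i + m) for the induction. Allowing distance 2 rad i lets one [z] serve two points at
    distance at most rad i. *)
Lemma net_avg_close x i z : ~ bad x -> avg_cvg x -> z \in N i -> good_ball i z ->
  d z x <= 2 * rad i -> `|u x - net_avg i z| <= 2 * chainK * t * rad i.
Proof.
have [d0 [dE [dS dT]]] := dm.
move=> nb cv zN gb zx.
have [w wP] : {w : nat -> X & forall j, w j \in N j /\ d (w j) x < rad j}.
  apply: (@choice _ _ (fun j y => y \in N j /\ d y x < rad j)) => j.
  by have [y yN yx] := N_cover j x; exists y.
have K0 : 0 <= chainK * t.
  have Cd0 : 0 < Cd := lt_le_trans ltr01 Cd1.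
  by rewrite ltW // /chainK !mulr_gt0 // exprn_gt0.
have step m : `|net_avg (i + m).+1 (w (i + m).+1) - net_avg i z| <=
    chainK * t * (2 * rad i - rad (i + m)).
  elim: m => [|m IH].
    rewrite addn0; apply: le_trans (net_avg_step gb _) _.
      have [_ wx] := wP i.+1; have := dT z x (w i.+1); have := dS x (w i.+1).
      by have := radS i; lra.
    by have -> : chainK * rad i * t = chainK * t * (2 * rad i - rad i) by ring.
  have [wN wx] := wP (i + m).+1; have [wN' wx'] := wP (i + m).+2.
  have gw := bad_setN nb wN wx.
  rewrite addnS; apply: le_trans (ler_distD (net_avg (i + m).+1 (w (i + m).+1)) _ _) _.
  have := net_avg_step gw (z' := w (i + m).+2).
  have H1 : d (w (i + m).+1) (w (i + m).+2) <= 5 / 2 * rad (i + m).+1.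
    have := dT (w (i + m).+1) x (w (i + m).+2); have := dS x (w (i + m).+2).
    by have := radS (i + m).+1; have := rad_gt0 (i + m).+1; lra.
  move=> /(_ H1) H2.
  have H3 : chainK * t * (2 * rad i - rad (i + m).+1) =
     chainK * t * (2 * rad i - rad (i + m)) + chainK * rad (i + m).+1 * t.
    by rewrite (radS (i + m)); ring.
  by rewrite H3 addrC; apply: lerD.
apply/ler_addgt0Pr => e e0; have [i0 cvi0] := cv e e0.
have [wN wx] := wP (i + i0).+1.
have H1 := cvi0 (i + i0).+1 (w (i + i0).+1) (leq_trans (leq_addl _ _) (leqnSn _)) wN wx.
apply: le_trans (ler_distD (net_avg (i + i0).+1 (w (i + i0).+1)) _ _) _.
have := step i0.
have : chainK * t * (2 * rad i - rad (i + i0)) <= 2 * chainK * t * rad i.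
  have -> : 2 * chainK * t * rad i = chainK * t * (2 * rad i) by ring.
  by apply: ler_wpM2l => //; have := rad_gt0 (i + i0); lra.
lra.
Qed.

Lemma good_lipschitz x y : ~ bad x -> avg_cvg x -> ~ bad y -> avg_cvg y ->
  `|u x - u y| <= 8 * chainK * t * d x y.
Proof.
have [d0 [dE [dS dT]]] := dm.
move=> bx cx by_ cy.
have K0 : 0 <= chainK * t.
  have Cd0 : 0 < Cd := lt_le_trans ltr01 Cd1.
  by rewrite ltW // /chainK !mulr_gt0 // exprn_gt0.
have [xy|xy] := eqVneq (d x y) 0.
  by rewrite ((dE x y).1 xy) subrr normr0 mulr_ge0 // -mulrA mulrA -mulrA mulr_ge0 // mulr_ge0.
have dxy0 : 0 < d x y by rewrite lt_neqAle eq_sym xy d0.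
have [i [i1 i2]] := dyadic_band dxy0 (diam x y).
rewrite -/(rad i) in i1 i2.
have [z zN zx] := N_cover i x.
have gz := bad_setN bx zN zx.
have H1 : `|u x - net_avg i z| <= 2 * chainK * t * rad i.
  by apply: net_avg_close => //; have := rad_gt0 i; lra.
have H2 : `|u y - net_avg i z| <= 2 * chainK * t * rad i.
  by apply: net_avg_close => //; have := dT z x y; lra.
apply: le_trans (ler_distD (net_avg i z) _ _) _; rewrite [`|net_avg i z - _|]distrC.
apply: le_trans (lerD H1 H2) _.
have -> : 2 * chainK * t * rad i + 2 * chainK * t * rad i = chainK * t * (4 * rad i) by ring.
have -> : 8 * chainK * t * d x y = chainK * t * (8 * d x y) by ring.
by apply: ler_wpM2l => //; lra.
Qed.

End Oscillation.
End PoincareChain.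

End Doubling.

(** * Inner regularity *)

Section Regularity.
Context (R : realType) (dX : measure_display) (X : measurableType dX).
Variables (d : X -> X -> R) (mu : {measure set X -> \bar R}).
Hypothesis dm : is_metric d.
Hypothesis br : borel_regular d mu.
Hypothesis mufin : (mu setT < +oo)%E.

Let borel_meas A : borel_sets d A -> measurable A. Proof. by case: br => H _; exact: H. Qed.

Lemma d_open_measurable A : d_open d A -> measurable A.
Proof. by move=> oA; apply: borel_meas; exact: borel_open. Qed.

Lemma d_closed_measurable A : d_open d (~` A) -> measurable A.
Proof. by move=> oA; rewrite -[A]setCK; apply: measurableC; exact: d_open_measurable. Qed.

Lemma d_open_bigcup (F : nat -> set X) : (forall i, d_open d (F i)) -> d_open d (\bigcup_i F i).
Proof.
move=> oF x [i _ Fx]; have [r r0 rF] := oF i x Fx.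
by exists r => // y yr; exists i => //; exact: rF.
Qed.

Lemma d_openI A B : d_open d A -> d_open d B -> d_open d (A `&` B).
Proof.
move=> oA oB x [/oA[r r0 rA] /oB[s s0 sB]]; exists (Num.min r s); first by rewrite lt_min r0.
by move=> y; rewrite /dball /= lt_min => /andP[yr ys]; split; [exact: rA | exact: sB].
Qed.

Let fin A : measurable A -> (mu A < +oo)%E.
Proof. by move=> mA; apply: le_lt_trans mufin; apply: le_measure; rewrite ?inE. Qed.

Lemma decreasing_measure_lt (D : nat -> set X) (e : R) :
  (forall n, measurable (D n)) -> nonincreasing_seq D ->
  (mu (\bigcap_n D n) < e%:E)%E -> exists n, (mu (D n) < e%:E)%E.
Proof.
move=> mD nD lt; have cv : mu \o D @ \oo --> mu (\bigcap_n D n).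
  by apply: nonincreasing_cvg_mu => //; [exact: fin | exact: bigcapT_measurable].
apply: contrapT => no; suff : (e%:E <= mu (\bigcap_n D n))%E by rewrite leNgt lt.
rewrite -(cvg_lim _ cv) //; apply: lime_ge; first by apply/cvg_ex; eexists; exact: cv.
by apply: nearW => n /=; rewrite leNgt; apply/negP => ltn; apply: no; exists n.
Qed.

Definition approximable (A : set X) := forall e : R, 0 < e -> exists F O,
  [/\ d_open d (~` F), d_open d O, F `<=` A, A `<=` O & (mu (O `\` F) < e%:E)%E].

(** The points at distance at least 1 / (k+1) from the complement form closed sets that exhaust
    [O]. *)
Lemma open_approximable O : d_open d O -> approximable O.
Proof.
have [d0 [dE [dS dT]]] := dm.
move=> oO e e0; pose F (k : nat) := [set x | forall y, ~ O y -> k.+1%:R^-1 <= d x y].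
have cF k : d_open d (~` F k).
  move=> x /existsNP[y /not_implyP[Oy /negP]]; rewrite -ltNge => xy.
  exists (k.+1%:R^-1 - d x y); first by rewrite subr_gt0.
  move=> z; rewrite /dball /= => xz /(_ y Oy) zy.
  suff : d z y < k.+1%:R^-1 by rewrite ltNge zy.
  move: (k.+1%:R^-1 : R) xz {zy} => q xz.
  by have := dT z x y; have := dS x z; lra.
have FO k : F k `<=` O.
  move=> x Fx; apply: contrapT => /Fx.
  by rewrite (proj2 (dE x x)) // leNgt invr_gt0 ltr0n.
have [| | |n lt] := @decreasing_measure_lt (fun k => O `\` F k) e.
- by move=> k; apply: measurableD; [exact: d_open_measurable | exact: d_closed_measurable].
- move=> k l kl; apply/subsetPset => x [Ox nF]; split => // Fx; apply: nF => y /Fx.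
  by apply: le_trans; rewrite lef_pV2 ?posrE ?ltr0n // ler_nat.
- rewrite (_ : \bigcap_n _ = set0) ?measure0 ?lte_fin //.
  apply/seteqP; split => // x H; have [Ox _] := H 0%N I.
  have [r r0 rO] := oO x Ox.
  have [k kr] : exists k : nat, k.+1%:R^-1 < r.
    exists (Num.bound r^-1); rewrite -[ltRHS]invrK ltf_pV2 ?posrE ?invr_gt0 ?ltr0n //.
    apply: lt_trans (archi_boundP _) _; first by rewrite invr_ge0 ltW.
    by rewrite ltr_nat.
  have [_] := H k I; apply => y nOy; apply: le_trans (ltW kr) _.
  by rewrite leNgt; apply/negP => lt; apply: nOy; exact: rO.
- by exists (F n), O; split.
Qed.

(** For a countable union the errors of the pieces sum to e / 2; since only finite unions of the
    closed sets stay closed, continuity from above has to absorb the tail. *)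
Lemma approximable_sigma_algebra : sigma_algebra setT approximable.
Proof.
split.
- move=> e e0; exists set0, set0; split => //; rewrite ?setD0 ?measure0 ?lte_fin //.
  by rewrite setC0 => x _; exists 1.
- move=> A aA e e0; have [F [W [cF oW FA sAW ltF]]] := aA e e0.
  exists (~` W), (~` F); rewrite setCK setTD; split => //; try exact: subsetC.
  by rewrite setDE setCK setIC -setDE.
- move=> A aA e e0.
  have e2 i : 0 < e / 2 / (2 ^ i.+1)%:R by rewrite !divr_gt0 // ltr0n expn_gt0.
  have [F FP] := choice (fun i => aA i _ (e2 i)).
  have [W OP] := choice FP.
  pose OO := \bigcup_i W i; pose D n := OO `\` \big[setU/set0]_(i < n) F i.
  have oOO : d_open d OO by apply: d_open_bigcup => i; have [] := OP i.
  have cFn n : d_open d (~` \big[setU/set0]_(i < n) F i).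
    elim: n => [|n IH]; first by rewrite big_ord0 setC0 => x _; exists 1.
    by rewrite big_ord_recr setCU; apply: d_openI => //; have [] := OP n.
  have mF i : measurable (F i) by apply: d_closed_measurable; have [] := OP i.
  have mO i : measurable (W i) by apply: d_open_measurable; have [] := OP i.
  have [| | |n lt] := @decreasing_measure_lt D e.
  + by move=> n; apply: measurableD; [exact: d_open_measurable | exact: d_closed_measurable].
  + move=> k l kl; apply/subsetPset; apply: setDS; exact: subset_bigsetU.
  + apply: (@le_lt_trans _ _ (e / 2)%:E); last by rewrite lte_fin ltr_pdivrMr // ltr_pMr // ltr1n.
    apply: (@le_trans _ _ (\sum_(i <oo) mu (W i `\` F i))%E).
      apply: measure_sigma_subadditive.
      * by move=> i; exact: measurableD.
      * apply: bigcapT_measurable => n; apply: measurableD.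
          exact: d_open_measurable.
        exact: d_closed_measurable.
      * move=> x H; have [[i _ Ox] _] := H 0%N I.
        exists i => //; split => // Fx; have [_] := H i.+1 I; apply.
        by rewrite -bigcup_mkord; exists i => /=.
    apply: le_trans (epsilon_trick0 _ _); last by rewrite divr_ge0 // ltW.
    by apply: lee_nneseries => // i _; apply: ltW; have [] := OP i.
  + exists (\big[setU/set0]_(i < n) F i), OO; split => //.
      rewrite -bigcup_mkord => x [i /= _ Fx]; exists i => //.
      by have [_ _ FA _ _] := OP i; exact: FA.
    by move=> x [i _ Ax]; exists i => //; have [_ _ _ AO _] := OP i; exact: AO.
Qed.

(** As [E] need not be Borel, the approximation is applied to a Borel hull [B] of its complement: an
    open set around [B] has a closed complement inside [E], and the overlap of [E] with [B] is
    null. *)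
Lemma closed_inner_regular (E : set X) (e : R) : measurable E -> 0 < e ->
  exists F, [/\ d_open d (~` F), F `<=` E & (mu (E `\` F) < e%:E)%E].
Proof.
move=> mE e0; have [_ [_ hull]] := br.
have [B [bB [EB muB]]] := hull (~` E) (measurableC mE).
have mB := borel_meas bB.
have aB : approximable B.
  apply: (smallest_sub approximable_sigma_algebra _ bB).
  exact: open_approximable.
have [F [W [cF oW FB BW lt]]] := aB e e0.
have mW := d_open_measurable oW; have mF := d_closed_measurable cF.
exists (~` W); split; first by rewrite setCK.
  by apply: subset_trans (subsetC BW) _; rewrite -[E]setCK; exact: subsetC.
have -> : E `\` ~` W = (E `&` B) `|` (E `&` (W `\` B)).
  apply/seteqP; split => x.
    by move=> [Ex /contrapT Wx]; have [Bx|nBx] := pselect (B x); [left | right].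
  by move=> [[Ex Bx]|[Ex [Wx _]]]; split => //; apply; exact: BW.
have mEB : measurable (E `&` B) by exact: measurableI.
have mWB : measurable (W `\` B) by exact: measurableD.
apply: (@le_lt_trans _ _ (mu (E `&` B) + mu (E `&` (W `\` B)))%E).
  by apply: measureU2 => //; exact: measurableI.
have -> : mu (E `&` B) = 0%E.
  have -> : E `&` B = B `\` ~` E by rewrite setDE setCK setIC.
  transitivity (mu B - mu (B `&` ~` E))%E.
    by apply: measureD => //; [exact: measurableC | exact: fin].
  rewrite (_ : B `&` ~` E = ~` E); last exact/setIidPr.
  by rewrite -muB subee // ge0_fin_numE // fin //; exact: measurableC.
rewrite add0e; apply: le_lt_trans lt; apply: le_measure; rewrite ?inE.
- exact: measurableI.
- exact: measurableD.
- by move=> x [_ [Wx nBx]]; split => // /FB.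
Qed.

End Regularity.

Section PowerSum.
Variable R : realType.

Lemma powR_sum_le (p a b : R) : 0 <= p -> 0 <= a -> 0 <= b ->
  (a + b) `^ p <= 2 `^ p * (a `^ p + b `^ p).
Proof.
move=> p0 a0 b0; wlog ab : a b a0 b0 / a <= b.
  move=> H; have [/H|/ltW/H] := leP a b; first exact.
  by rewrite addrC [X in _ * X]addrC; apply.
apply: (@le_trans _ _ ((2 * b) `^ p)).
  by apply: ge0_ler_powR => //; rewrite ?nnegrE; lra.
rewrite powRM // ler_wpM2l ?powR_ge0 // lerDr powR_ge0 //.
Qed.

Lemma poweR_sum_le (p b : R) (a : \bar R) : 1 <= p -> (0 <= a)%E -> 0 <= b ->
  (poweR (a + b%:E) p <= (2 `^ p)%:E * (poweR a p + (b `^ p)%:E))%E.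
Proof.
move=> p1; have p0 : 0 < p by apply: lt_le_trans p1.
case: a => [a| |] // a0 b0.
  rewrite -EFinD !poweR_EFin -EFinD -EFinM lee_fin; apply: powR_sum_le => //; exact: ltW.
rewrite addye // poweRyr ?gt_eqF // addye // gt0_muley ?leey //.
Qed.

Lemma le_1DpowR (p a : R) : 1 <= p -> 0 <= a -> a <= 1 + a `^ p.
Proof.
move=> p1 a0; have [a1|a1] := leP a 1; first by rewrite (le_trans a1) // lerDl powR_ge0.
apply: (@le_trans _ _ (a `^ p)); last by rewrite lerDr.
by rewrite -[leLHS]powRr1 // ler_powR // ltW.
Qed.

End PowerSum.

(** * Strong measurability and upper gradients of maps into a normed space *)

Section StrongMeasurability.
Context (R : realType) (dX : measure_display) (X : measurableType dX).
Variables (d : X -> X -> R) (mu : {measure set X -> \bar R}).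
Hypothesis dm : is_metric d.
Hypothesis br : borel_regular d mu.
Variable (V : normedModType R).

Lemma finite_range_measurable (s : X -> V) (q : V -> X -> \bar R) :
  finite_set (range s) -> (forall v, measurable (s @^-1` [set v])) ->
  (forall v, measurable_fun setT (q v)) -> measurable_fun setT (fun x => q (s x) x).
Proof.
move=> fs ms mq _ B mB; rewrite setTI.
have -> : (fun x => q (s x) x) @^-1` B =
    \bigcup_(v in range s) (s @^-1` [set v] `&` q v @^-1` B).
  apply/seteqP; split => x /=; first by move=> Bx; exists (s x) => //; exists x.
  by move=> [v _ [<-]].
apply: fin_bigcup_measurable => // v _; apply: measurableI => //.
by rewrite -[X in measurable X]setTI; exact: mq.
Qed.

(** With [w] replaced by functions of finite range, the distance is measurable piece by piece; the
    limit holds almost everywhere, and completeness of [mu] absorbs the null set. *)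
Lemma strongly_measurable_dist (w w' : X -> V) : strongly_measurable mu w ->
  (forall c, measurable_fun setT (fun x => `|c - w' x|)) ->
  measurable_fun setT (fun x => `|w x - w' x|).
Proof.
move=> [s [sfin scv]] mw'.
have cmu : measure_is_complete mu.
  by move=> A [B [mB B0 AB]]; have [_ [H _]] := br; exact: (H B).
apply/measurable_EFinP.
apply: (ae_measurable_fun cmu (f := fun x => limn_esup (fun k => (`|s k x - w' x|)%:E))).
  apply: filterS scv => x sx _ /=.
  have cv : (fun k => (`|s k x - w' x|)%:E) @ \oo --> (`|w x - w' x|)%:E.
    apply: cvg_EFin; first exact: nearW.
    by apply: cvg_norm; apply: cvgB => //; exact: cvg_cst.
  by rewrite is_cvg_limn_esupE ?(cvg_lim _ cv) //; apply/cvg_ex; eexists; exact: cv.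
apply: measurable_fun_limn_esup => k; have [f1 f2] := sfin k.
apply: (finite_range_measurable (q := fun v x => (`|v - w' x|)%:E)) => // v.
exact/measurable_EFinP.
Qed.

Lemma strongly_measurable_norm (w : X -> V) c : strongly_measurable mu w ->
  measurable_fun setT (fun x => `|w x - c|).
Proof. by move=> sw; apply: (strongly_measurable_dist (w' := fun=> c)). Qed.

Lemma find_measurable (r : R) (s : seq X) (i : nat) :
  measurable [set x | find (fun z => d z x < r) s = i].
Proof.
have mb z : measurable (dball d z r).
  by apply: dball_measurable => //; case: br.
elim: s i => [|z s IH] [|i] /=.
- by rewrite (_ : [set _ | _] = setT) //; apply/seteqP; split.
- by rewrite (_ : [set _ | _] = set0) //; apply/seteqP; split.
- rewrite (_ : [set _ | _] = dball d z r) //.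
  by apply/seteqP; split => x; rewrite /dball /=; case: ifP.
- rewrite (_ : [set _ | _] = ~` dball d z r `&` [set x | find (fun z => d z x < r) s = i]).
    by apply: measurableI => //; exact: measurableC.
  apply/seteqP; split => x; rewrite /dball /=; have [dz|/negP dz] := boolP (d z x < r) => //.
  + by move=> [].
  + by move=> [].
  + by move=> [_ ->].
Qed.

(** The k-th approximation takes the value of [f] at the first net point within rad k; its range is
    finite because the nets are. *)
Lemma lipschitz_strongly_measurable (f : X -> V) (L Dm : R) (N : nat -> seq X) :
  0 < Dm -> (forall i x, exists2 z, z \in N i & d z x < rad Dm i) ->
  (forall x y, `|f x - f y| <= L * d x y) -> strongly_measurable mu f.
Proof.
have [d0 [dE [dS dT]]] := dm.
move=> Dm0 cov fL.
have L1 : L <= `|L| + 1 by apply: le_trans (ler_norm _) _; rewrite lerDl.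
have L0 : 0 < `|L| + 1 by rewrite ltr_wpDl.
pose ix k x := find (fun z => d z x < rad Dm k) (N k).
pose s k x := f (nth point (N k) (ix k x)).
have ixP k x : d (nth point (N k) (ix k x)) x < rad Dm k.
  have [z zN zx] := cov k x.
  by apply: (nth_find point (a := fun z => d z x < rad Dm k)); apply/hasP; exists z.
exists s; split.
  move=> k; split.
    apply: (@sub_finite_set _ _ ((fun i => f (nth point (N k) i)) @` `I_(size (N k)).+1)).
      by move=> _ [x _ <-]; exists (ix k x) => //=; rewrite ltnS find_size.
    exact: finite_image.
  move=> v; rewrite (_ : _ @^-1` _ = \bigcup_(i in [set i | f (nth point (N k) i) = v])
    [set x | ix k x = i]).
    by apply: bigcup_measurable => i _; exact: find_measurable.
  by apply/seteqP; split => x /=; [move=> sx; exists (ix k x) | move=> [i /= <- <-]].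
apply: aeW => x; apply/cvgrPdist_lt => e e0.
have [m Hm] : exists m : nat, Dm * (`|L| + 1) / e < m%:R.
  exists (Num.bound (Dm * (`|L| + 1) / e)); apply: archi_boundP.
  by rewrite divr_ge0 ?mulr_ge0 // ltW.
exists m => // k /= mk; rewrite distrC.
apply: le_lt_trans (fL _ _) _.
apply: (@le_lt_trans _ _ ((`|L| + 1) * rad Dm k)).
  apply: (@le_trans _ _ ((`|L| + 1) * d (nth point (N k) (ix k x)) x)).
    by apply: ler_wpM2r.
  by rewrite ler_pM2l // ltW.
have k2 : m%:R <= 2 ^+ k :> R.
  rewrite -natrX ler_nat; apply: leq_trans mk _.
  by apply: ltnW; exact: ltn_expl.
have p2 : 0 < 2 ^+ k :> R by rewrite exprn_gt0.
rewrite /rad mulrA ltr_pdivrMr // mulrC.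
by move: Hm; rewrite ltr_pdivrMr // => /lt_le_trans; apply; rewrite mulrC ler_pM2l.
Qed.

Lemma constant_upper_gradient (f : X -> V) (L : R) : 0 <= L ->
  (forall x y, `|f x - f y| <= L * d x y) -> upper_gradient d setT f (cst L%:E).
Proof.
have [d0 [dE [dS dT]]] := dm.
move=> L0 fL; split; first by apply/borel_onT; exact: measurable_cst.
split => // gam a b rect _ gt gtE; have [ab _] := rect.
rewrite -/(clen d gam a b) integral_cst //= lebesgue_measure_itv /= lte_fin.
have c0 := clen_ge0 dm rect (lexx a) ab (lexx b).
have dc := dist_le_clen dm rect (lexx a) ab (lexx b).
case: ifP => [_|/negbT]; first rewrite -EFinB subr0 -EFinM lee_fin.
  by apply: le_trans (fL _ _) _; rewrite dS ler_wpM2l.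
rewrite -leNgt => c0'; have E : d (gam b) (gam a) = 0.
  by apply/eqP; rewrite eq_le d0 andbT dS; lra.
by rewrite mule0 lee_fin; have := fL (gam b) (gam a); rewrite E mulr0.
Qed.

Lemma upper_gradient_comp (W : normedModType R) (u : X -> V) (w : X -> W) g :
  (forall x y, `|w x - w y| <= `|u x - u y|) ->
  upper_gradient d setT u g -> upper_gradient d setT w g.
Proof.
move=> wu [bg [g0 ug]]; split => //; split => // gam a b rect gU gt gtE.
by apply: le_trans (ug gam a b rect gU gt gtE); rewrite lee_fin.
Qed.

End StrongMeasurability.

(** * Large closed sets on which a Sobolev map is Lipschitz *)

Section SobolevGoodSets.
Context (R : realType) (dX : measure_display) (X : measurableType dX).
Variables (d : X -> X -> R) (mu : {measure set X -> \bar R}) (p : R).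
Variables (Y : Type) (dY : Y -> Y -> R) (V : normedModType R) (lam : Y -> V).
Hypothesis dm : is_metric d.
Hypothesis br : borel_regular d mu.
Variable Dm : R.
Hypothesis Dm0 : 0 < Dm.
Hypothesis diam : forall x y, d x y <= Dm.
Hypothesis p1 : 1 <= p.
Hypothesis dYm : is_metric dY.
Hypothesis lamE : isometric_embedding dY lam.

Let borel_meas A : borel_sets d A -> measurable A. Proof. by case: br => H _; exact: H. Qed.

Lemma upper_gradient_measurable (W : normedModType R) (u : X -> W) (g : X -> \bar R) :
  upper_gradient d setT u g -> measurable_fun setT g.
Proof. by move=> [bg _] _ B mB; apply: borel_meas; exact: bg. Qed.

Lemma dense_sequence : separable dY -> Y ->
  exists z : nat -> Y, forall y (e : R), 0 < e -> exists m, dY y (z m) < e.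
Proof.
move=> [D [/countable_injP[f finj] dense]] y0.
have [z zP] : {z : nat -> Y & forall m, (exists2 y, D y & f y = m) -> D (z m) /\ f (z m) = m}.
  apply: (@choice _ _ (fun m y => (exists2 y, D y & f y = m) -> D y /\ f y = m)) => m.
  have [[y Dy fy]|no] := pselect (exists2 y, D y & f y = m); first by exists y.
  by exists y0 => /no.
exists z => y e e0; have [w [Dw lt]] := dense y e e0; exists (f w).
have [|Dz fz] := zP (f w); first by exists w.
suff -> : z (f w) = w by [].
by apply: finj => //; rewrite inE.
Qed.

Lemma dY_lipschitz x y z : `|dY x z - dY y z| <= dY x y.
Proof.
have [d0 [dE [dS dT]]] := dYm; rewrite ler_norml.
by have := dT x y z; have := dT y x z; have := dS x y => H1 H2 H3; apply/andP; split; lra.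
Qed.

Lemma dist_integrable (u : X -> Y) (z : Y) : (mu setT < +oo)%E ->
  in_Lp mu p (lam \o u) -> mu.-integrable setT (EFin \o (fun x => dY (u x) z)).
Proof.
move=> mufin [su Lp].
have mw c : measurable_fun setT (fun x => `|lam (u x) - c|).
  exact: (strongly_measurable_norm br c su).
have mlam : measurable_fun setT (fun x => `|lam (u x)|).
  by have := mw 0; under eq_fun do rewrite subr0.
have mpow : measurable_fun setT (fun x => (`|lam (u x)| `^ p)%:E).
  apply/measurable_EFinP; exact: (measurableT_comp (measurable_powR p) mlam).
have dYE x : dY (u x) z = `|lam (u x) - lam z| by rewrite lamE.
apply/integrableP; split.
  by apply/measurable_EFinP; under eq_fun do rewrite dYE; exact: mw.
apply: (@le_lt_trans _ _ (\int[mu]_x ((`|lam (u x)| `^ p)%:E + (1 + `|lam z|)%:E))%E).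
  apply: ge0_le_integral => //.
  - apply/measurable_EFinP; apply: measurableT_comp => //.
    by under eq_fun do rewrite dYE; exact: mw.
  - by apply: emeasurable_funD.
  - move=> x _ /=; rewrite -EFinD lee_fin dYE normr_id.
    apply: le_trans (ler_normB _ _) _.
    by have := le_1DpowR p1 (normr_ge0 (lam (u x))); rewrite addrA [_ + 1]addrC; lra.
rewrite ge0_integralD // lte_add_pinfty //.
rewrite [ltLHS](_ : _ = ((1 + `|lam z|)%:E * mu setT)%E); last exact: integral_cst.
by rewrite lte_mul_pinfty // lee_fin addr_ge0.
Qed.

Lemma lipschitz_on_closed_subset : doubling d mu -> poincare d mu p -> separable dY ->
  exists2 K : R, 0 <= K & forall u : X -> Y, in_N1pY d mu p lam u ->
  forall e : R, 0 < e -> exists2 t0 : R, 0 < t0 & forall t, t0 <= t ->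
  exists F : set X, [/\ d_open d (~` F),
    forall x y, F x -> F y -> dY (u x) (u y) <= K * t * d x y &
    ((t `^ p)%:E * mu (~` F) <= e%:E)%E].
Proof.
have [dY0 [dYE [dYS dYT]]] := dYm.
move=> [mu_ball [Cd Cd1 mu_doub]] [CP CP0 [sig sig1 poin]] sepY.
have Cd0 : 0 < Cd := lt_le_trans ltr01 Cd1.
exists (8 * chainK Cd CP); first by rewrite ltW // /chainK !mulr_gt0 // exprn_gt0.
move=> u [uLp [g [ug gfin]]] e e0.
have muT : (mu setT < +oo)%E by exact: (mu_fin Dm0 diam mu_ball).
have [N NP] := choice (fun i => net_exists dm borel_meas Dm0 diam mu_ball Cd1 mu_doub (rad_gt0 Dm0 i)).
have N_sep i : separated d (rad Dm i) (N i) by case: (NP i).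
have N_cov i x : exists2 z, z \in N i & d z x < rad Dm i.
  have [_ H] := NP i; have [z zN xz] := H x; exists z => //.
  by have [_ [_ [dS _]]] := dm; rewrite dS.
pose G x := poweR (g x) p.
have mg := upper_gradient_measurable ug.
have mG : measurable_fun setT G by exact: (measurableT_comp (measurable_poweR p) mg).
have G0 x : (0 <= G x)%E by exact: poweR_ge0.
have kap1 : 1 <= sig * 5 by lra.
have e20 : 0 < e / 2 by rewrite divr_gt0.
have [T0 T00 small] := bad_set_small dm borel_meas Dm0 diam mu_ball Cd1 mu_doub N
   kap1 mG G0 gfin e20.
have p0 : 0 < p by apply: lt_le_trans p1.
exists (T0 `^ p^-1); first by rewrite powR_gt0.
move=> t tt0; have t0 : 0 < t by apply: lt_le_trans tt0; rewrite powR_gt0.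
have Tt : T0 <= t `^ p.
  have -> : T0 = (T0 `^ p^-1) `^ p.
    by rewrite -powRrM mulVf ?powRr1 ?gt_eqF // ltW.
  by apply: ge0_ler_powR => //; rewrite ?nnegrE ?powR_ge0 // ltW.
have Tp : 0 < t `^ p by rewrite powR_gt0.
have [z zdense] := dense_sequence sepY (u point).
pose w m x := dY (u x) (z m).
have iw m : mu.-integrable setT (EFin \o w m) by exact: dist_integrable.
have ugw m : upper_gradient d setT (w m) g.
  apply: upper_gradient_comp ug => x y /=; rewrite lamE; exact: dY_lipschitz.
pose bad := bad_set d mu Dm N (sig * 5) G (t `^ p).
have mbad : measurable bad by exact: bad_set_measurable.
(* The bad set is common to all m, while the exceptional null sets of the countably many w m are
   united into [A]. *)
have [A [mA A0 subA]] := ae_foralln (fun m =>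
  avg_cvg_ae dm borel_meas Dm0 diam mu_ball Cd1 mu_doub N_sep p1 CP0 sig1 poin t0 (iw m) (ugw m)).
pose E := ~` bad `&` ~` A.
have mE : measurable E by apply: measurableI; exact: measurableC.
have eT : 0 < e / 2 / (t `^ p) by rewrite divr_gt0.
have [F [cF FE muF]] := closed_inner_regular dm br muT mE eT.
have mF := d_closed_measurable br cF.
exists F; split => //.
  move=> x y /FE[bx Ax] /FE[by_ Ay].
  have good x' : ~ A x' -> ~ bad x' -> forall m, avg_cvg d mu Dm N (w m) x'.
    move=> nA nb m; apply: contrapT => nc; apply: nA; apply: subA => H.
    by apply: nc; exact: H.
  have Kd m : `|w m x - w m y| <= 8 * chainK Cd CP * t * d x y.
    by apply: (good_lipschitz dm borel_meas Dm0 diam mu_ball Cd1 mu_doub N_cov p1 CP0 sig1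
      poin t0 (iw m) (ugw m)) => //; exact: good.
  (* For z m within eta / 2 of u y, the difference w m x - w m y is at least dY (u x) (u y) -
     eta. *)
  apply/ler_addgt0Pr => eta eta0.
  have eta2 : 0 < eta / 2 by rewrite divr_gt0.
  have [m lt] := zdense (u y) _ eta2.
  have := Kd m; rewrite ler_norml /w => /andP[_ H].
  have := dYT (u x) (z m) (u y); rewrite (dYS (z m)); lra.
have cover : ~` F `<=` bad `|` (A `|` (E `\` F)).
  move=> x nF; have [bx|nb] := pselect (bad x); first by left.
  have [Ax|nA] := pselect (A x); first by right; left.
  by right; right; split.
have mEF : measurable (E `\` F) by exact: measurableD.
have mAEF : measurable (A `|` (E `\` F)) by exact: measurableU.
have le1 : (mu (~` F) <= mu bad + (e / 2 / (t `^ p))%:E)%E.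
  apply: (@le_trans _ _ (mu (bad `|` (A `|` (E `\` F))))).
    by apply: le_measure; rewrite ?inE //; [exact: measurableC | exact: measurableU].
  apply: le_trans (measureU2 mu mbad mAEF) _; apply: leeD => //.
  apply: le_trans (measureU2 mu mA mEF) _.
  by rewrite [X in (X + _)%E](_ : _ = 0)%E ?add0e //; exact: ltW.
have := small _ Tt; rewrite -/bad.
have bfin : (mu bad < +oo)%E by exact: (mu_fin Dm0 diam mu_ball).
move=> smallb.
apply: (@le_trans _ _ ((t `^ p)%:E * (mu bad + (e / 2 / (t `^ p))%:E))%E).
  by apply: lee_wpmul2l => //; rewrite lee_fin ltW.
move: bfin smallb; rewrite -ge0_fin_numE //; case: (mu bad) => // b _.
rewrite -EFinM lee_fin => H.
rewrite -EFinD -EFinM lee_fin mulrDr [t `^ p * (_ / _)]mulrC divfK ?gt_eqF //; lra.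
Qed.

End SobolevGoodSets.

Lemma lip_connected_le (R : realType) (Y : Type) (dY : Y -> Y -> R) (m n : nat) :
  (m <= n)%N -> lip_connected dY n -> lip_connected dY m.
Proof.
by move=> mn [gam g1 H]; exists gam => // k km; apply: H; exact: leq_trans mn.
Qed.

(** * Density of Lipschitz maps *)

(** Common estimate for both parts of the Sobolev norm of u - f, with [B] the complement of the good
    closed set and [psi] either |lam u|^p or g^p. *)
Lemma ge0_integral_le_on (R : realType) (dX : measure_display) (X : measurableType dX)
    (mu : {measure set X -> \bar R}) (B : set X) (phi psi : X -> \bar R) (k c a b : R) :
  measurable B -> measurable_fun setT phi -> measurable_fun setT psi ->
  (forall x, (0 <= phi x)%E) -> (forall x, (0 <= psi x)%E) -> 0 <= k -> 0 <= c ->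
  (forall x, ~ B x -> phi x = 0%E) ->
  (forall x, B x -> (phi x <= k%:E * (psi x + c%:E))%E) ->
  (\int[mu]_(x in B) psi x <= a%:E)%E -> (c%:E * mu B <= b%:E)%E ->
  (\int[mu]_x phi x <= (k * (a + b))%:E)%E.
Proof.
move=> mB mphi mpsi phi0 psi0 k0 c0 off on psia cb.
have -> : (\int[mu]_x phi x = \int[mu]_(x in B) phi x)%E.
  rewrite [RHS]integral_mkcond; apply: eq_integral => x _; rewrite patchE.
  by case: ifPn => // /negP nB; apply: off => Bx; apply: nB; rewrite inE.
have mpsiB : measurable_fun B psi by exact: measurable_funTS.
have mphiB : measurable_fun B phi by exact: measurable_funTS.
have msum : measurable_fun B (fun x => (psi x + c%:E)%E) by apply: emeasurable_funD.
apply: (@le_trans _ _ (\int[mu]_(x in B) (k%:E * (psi x + c%:E)))%E).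
  apply: ge0_le_integral => //; exact: measurable_funeM.
rewrite ge0_integralZl_EFin //; last by move=> x _; rewrite adde_ge0 ?lee_fin.
rewrite EFinM; apply: lee_wpmul2l; first by rewrite lee_fin.
rewrite ge0_integralD // EFinD; apply: leeD => //.
by rewrite (_ : (\int[mu]_(x in B) _ = c%:E * mu B)%E) //; exact: integral_cst.
Qed.

Theorem theorem1p16 (R : realType) (dX : measure_display) (X : measurableType dX)
    (d : X -> X -> R) (mu : {measure set X -> \bar R}) (p : R) (n : nat)
    (Y : Type) (dY : Y -> Y -> R) (V : completeNormedModType R) (lam : Y -> V) :
  is_metric d -> borel_regular d mu -> finite_diam d -> doubling d mu ->
  1 <= p -> (1 <= n)%N ->
  poincare d mu p -> nagata_dim_le d n ->
  is_metric dY -> separable dY -> isometric_embedding dY lam ->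
  lip_connected dY n.-1 ->
  lip_dense d mu p dY lam.
Proof.
move=> dm br [D0 diam0] doub p1 _ poin [m [mn nag]] dYm sepY lamE lipc u uN e e0.
have [d0 [dE [dS dT]]] := dm; have [dY0 [dYE [dYS dYT]]] := dYm.
(* The maximum with 1 keeps the largest scale positive even when [X] is a single point. *)
pose Dm := Num.max 1 D0.
have Dm0 : 0 < Dm by rewrite lt_max ltr01.
have diam x y : d x y <= Dm by rewrite le_max diam0 orbT.
have [mu_ball [Cd Cd1 mu_doub]] := doub.
have borel_meas : forall A, borel_sets d A -> measurable A by case: br.
have muT : (mu setT < +oo)%E by exact: (mu_fin Dm0 diam mu_ball).
have tot0 : 0 < total mu by exact: (total_gt0 Dm0 diam mu_ball).
have totE : mu setT = (total mu)%:E by exact: (totalE Dm0 diam mu_ball).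
have p0 : 0 < p by apply: lt_le_trans p1.
have [K K0 good] := lipschitz_on_closed_subset dm br Dm0 diam p1 dYm lamE doub poin sepY.
have [C C0 col] := nagata_colourable dm nag.
have lipc' : lip_connected dY m.-1.
  by apply: lip_connected_le lipc; rewrite -!subn1 leq_sub2r.
have [Kx Kx0 ext] := lipschitz_extension dm diam dYm C0 col lipc'.
have [N NP] := choice (fun i =>
  net_exists dm borel_meas Dm0 diam mu_ball Cd1 mu_doub (rad_gt0 Dm0 i)).
have N_cov i x : exists2 z, z \in N i & d z x < rad Dm i.
  have [_ H] := NP i; have [z zN xz] := H x; exists z => //.
  by rewrite dS.
have [[su Lpfin] [g [ug gfin]]] := uN.
have [_ [g0 _]] := ug.
have mg := upper_gradient_measurable br ug.
pose G x := poweR (g x) p.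
have mG : measurable_fun setT G by exact: (measurableT_comp (measurable_poweR p) mg).
have G0 x : (0 <= G x)%E by exact: poweR_ge0.
have mnorm (W : X -> V) : strongly_measurable mu W -> measurable_fun setT (fun x => `|W x|).
  move=> sW; have := strongly_measurable_norm br 0 sW.
  by under eq_fun do rewrite subr0.
have mpow (h : X -> R) : measurable_fun setT h -> measurable_fun setT (fun x => (h x `^ p)%:E).
  by move=> mh; apply/measurable_EFinP; exact: (measurableT_comp (measurable_powR p) mh).
pose H x : \bar R := (`|lam (u x)| `^ p)%:E.
have mH : measurable_fun setT H by apply: mpow; exact: mnorm su.
have H0 x : (0 <= H x)%E by rewrite lee_fin powR_ge0.
pose Kf := Kx * K; have Kf0 : 0 <= Kf by rewrite mulr_ge0.
pose C1 := Kf `^ p; pose C2 := (1 + Kf * Dm) `^ p.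
have C10 : 0 <= C1 by exact: powR_ge0.
have C20 : 0 <= C2 by exact: powR_ge0.
have KD0 : 0 <= 1 + Kf * Dm by rewrite addr_ge0 // mulr_ge0 // ltW.
(* Each part of the norm will be at most e / 3, which leaves room for the strict inequality; e1 is
   the share of e3 given to each integral over the complement of [F] and to t^p times its
   measure. *)
pose e3 := (e / 3) `^ p; have e30 : 0 < e3 by apply: powR_gt0; apply: divr_gt0.
have two0 : 0 < 2 `^ p :> R by rewrite powR_gt0.
have Q0 : 0 < 1 + C1 + C2 by lra.
pose e1 := e3 / (2 `^ p * (1 + C1 + C2)).
have e10 : 0 < e1 by rewrite divr_gt0 // mulr_gt0.
have e1E : 2 `^ p * (e1 + (C1 + C2) * e1) = e3.
  by rewrite /e1; field; rewrite !gt_eqF // mulr_gt0.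
have [del1 del10 small1] := ge0_integral_small mG G0 gfin e10.
have [del2 del20 small2] := ge0_integral_small mH H0 Lpfin e10.
have [t0 t00 goodt] := good u uN e1 e10.
pose J := fine (\int[mu]_x H x).
have JE : (\int[mu]_x H x = J%:E)%E.
  by rewrite /J fineK // ge0_fin_numE //; exact: integral_ge0.
have J0 : 0 <= J by apply: fine_ge0; exact: integral_ge0.
(* A Chebyshev level: |lam u|^p reaches [a] on less than half of the total mass. *)
pose a := 2 * J / total mu + 1.
have a0 : 0 < a by rewrite ltr_wpDl // divr_ge0 ?mulr_ge0 // ltW.
pose S := [set x | (a%:E <= H x)%E].
have mS : measurable S.
  by rewrite -[S]setTI; exact: emeasurable_fun_c_infty.
have muS : (mu S < (total mu / 2)%:E)%E.
  have := le_integral_abse mu measurableT mH a0.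
  rewrite (_ : (\int[mu]_x `|H x| = J%:E)%E); last first.
    by rewrite -JE; apply: eq_integral => x _; rewrite gee0_abs.
  rewrite (_ : setT `&` _ = S); last first.
    by rewrite setTI; apply/seteqP; split => x; rewrite /S /mkset gee0_abs.
  have : (mu S < +oo)%E by exact: (mu_fin Dm0 diam mu_ball).
  rewrite -ge0_fin_numE //; case: (mu S) => // s _.
  rewrite -EFinM !lee_fin lte_fin => as_le.
  rewrite -(ltr_pM2l a0); apply: le_lt_trans as_le _.
  have -> : a * (total mu / 2) = J + total mu / 2.
    by rewrite /a; field; rewrite gt_eqF.
  by rewrite ltrDl divr_gt0.
pose del := Num.min (Num.min del1 del2) (total mu / 2).
have del0 : 0 < del by rewrite !lt_min del10 del20 /=; apply: divr_gt0.
(* Three demands on t: existence of [F], t^p >= a for the choice of [x0], and t^p > e1 / del, so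
   that t^p mu <= e1 forces the complement of [F] to have measure below [del]. *)
pose t := Num.max t0 (Num.max (a `^ p^-1) ((e1 / del + 1) `^ p^-1)).
have tt0 : t0 <= t by rewrite le_max lexx.
have tp0 : 0 < t by apply: lt_le_trans tt0.
have tpow (b : R) : 0 <= b -> b `^ p^-1 <= t -> b <= t `^ p.
  move=> b0 bt; have -> : b = (b `^ p^-1) `^ p.
    by rewrite -powRrM mulVf ?powRr1 // gt_eqF.
  by apply: ge0_ler_powR => //; rewrite ?nnegrE ?powR_ge0 // ltW.
have Tp : 0 < t `^ p by rewrite powR_gt0.
have [F [cF uF muF]] := goodt t tt0.
have mF := d_closed_measurable br cF.
have mCF : measurable (~` F) by exact: measurableC.
have CFdel : (mu (~` F) < del%:E)%E.
  have te1 : e1 / del + 1 <= t `^ p.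
    by apply: tpow; [rewrite addr_ge0 // divr_ge0 // ltW | rewrite !le_max lexx !orbT].
  have : (mu (~` F) < +oo)%E by exact: (mu_fin Dm0 diam mu_ball).
  rewrite -ge0_fin_numE //; move: muF; case: (mu (~` F)) => // s.
  rewrite -EFinM lee_fin lte_fin => ts _.
  rewrite -(ltr_pM2l Tp); apply: le_lt_trans ts _.
  by rewrite -ltr_pdivrMr //; apply: lt_le_trans te1; rewrite ltrDl.
(* The complement of [F] and the set [S] each have less than half of the mass, so they cannot cover
   [X]. *)
have [x0 [Fx0 ux0]] : exists x0, F x0 /\ `|lam (u x0)| <= t.
  apply: contrapT => no; suff : (mu setT < mu setT)%E by rewrite ltxx.
  have sub : setT `<=` ~` F `|` S.
    move=> x _; have [Fx|] := pselect (F x); last by left.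
    right; rewrite /S /=; rewrite leNgt; apply/negP => lt; apply: no; exists x; split => //.
    move: lt; rewrite lte_fin => lt.
    have ta : a `^ p^-1 <= t by rewrite !le_max lexx !orbT.
    apply: le_trans ta; rewrite -[leLHS]powRr1 // -(mulfV (lt0r_neq0 p0)) powRrM.
    apply: ge0_ler_powR; rewrite ?nnegrE ?powR_ge0 ?invr_ge0 //; exact: ltW.
  apply: (@le_lt_trans _ _ (mu (~` F) + mu S)%E).
    apply: (@le_trans _ _ (mu (~` F `|` S))).
      by apply: le_measure; rewrite ?inE //; exact: measurableU.
    by apply: measureU2.
  have -> : mu setT = ((total mu / 2)%:E + (total mu / 2)%:E)%E.
    by rewrite totE -EFinD; congr (_%:E); lra.
  apply: lteD => //; apply: lt_le_trans CFdel _.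
  by rewrite lee_fin ge_min lexx orbT.
have Kt0 : 0 <= K * t by rewrite mulr_ge0 // ltW.
have [|f [fF fL]] := ext F _ cF u (K * t) Kt0 uF; first by exists x0.
pose L := Kf * t.
have LE : Kx * (K * t) = L by rewrite /L /Kf mulrA.
rewrite LE in fL.
have L0 : 0 <= L by rewrite mulr_ge0 // ltW.
have lfL x y : `|(lam \o f) x - (lam \o f) y| <= L * d x y by rewrite /= lamE.
(* The value at [x0] plus the oscillation of [f] over the diameter. It is a constant times t, so M^p
   times the measure of the complement of [F] is as small as the energy term. *)
pose M := t * (1 + Kf * Dm).
have M0 : 0 <= M by rewrite mulr_ge0 // ltW.
have lfM x : `|lam (f x)| <= M.
  have -> : lam (f x) = lam (u x0) + (lam (f x) - lam (f x0)).
    by rewrite (fF x0 Fx0) addrC subrK.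
  apply: le_trans (ler_normD _ _) _; rewrite /M mulrDr mulr1; apply: lerD => //.
  rewrite lamE; apply: le_trans (fL _ _) _.
  have -> : t * (Kf * Dm) = L * Dm by rewrite /L; ring.
  exact: ler_wpM2l.
have sf : strongly_measurable mu (lam \o f).
  exact: (lipschitz_strongly_measurable dm br Dm0 N_cov lfL).
have cst_fin (c : R) : 0 <= c -> (\int[mu]_x (cst c%:E x) < +oo)%E.
  by move=> c0; rewrite integral_cst // lte_mul_pinfty.
exists f; split; [by exists L | split].
  split.
    split; first exact: sf.
    apply: le_lt_trans (cst_fin (M `^ p) (powR_ge0 _ _)).
    apply: ge0_le_integral => //.
    - by apply: mpow; exact: (mnorm _ sf).
    - move=> x _; rewrite lee_fin /=; apply: ge0_ler_powR; rewrite ?nnegrE //; exact: ltW.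
  exists (cst L%:E); split; first exact: constant_upper_gradient.
  exact: (cst_fin (L `^ p) (powR_ge0 _ _)).
have uf x : F x -> (lam \o u) x = (lam \o f) x by move=> Fx /=; rewrite fF.
have ugh := upper_gradient_off_closed dm L0 lfL cF uf ug.
have tF (c : R) : 0 <= c -> ((c * t `^ p)%:E * mu (~` F) <= (c * e1)%:E)%E.
  move=> c0; rewrite EFinM -muleA [leRHS]EFinM; apply: lee_wpmul2l => //.
have root (i : \bar R) : (0 <= i)%E -> (i <= e3%:E)%E -> (poweR i p^-1 <= (e / 3)%:E)%E.
  move=> i0 ie; have -> : (e / 3)%:E = poweR e3%:E p^-1.
    by rewrite poweR_EFin /e3 -powRrM mulfV ?powRr1 ?gt_eqF // ltW // divr_gt0.
  apply: gt0_ler_poweR => //; first by rewrite invr_ge0 ltW.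
    by rewrite in_itv /= i0 leey.
  by rewrite in_itv /= lee_fin ltW //= leey.
have part1 : (Lp_normV mu p (fun x => (lam (u x) - lam (f x))%R) <= (e / 3)%:E)%E.
  apply: root; first by apply: integral_ge0 => x _; rewrite lee_fin powR_ge0.
  apply: (@le_trans _ _ (2 `^ p * (e1 + C2 * e1))%:E); last first.
    rewrite -e1E lee_fin ler_pM2l // lerD2l ler_pM2r // ?lerDl ?lerDr //.
  apply: (ge0_integral_le_on (B := ~` F) (psi := H) (c := C2 * t `^ p)) => //.
  - apply: mpow; apply: (strongly_measurable_dist br su) => c.
    have := strongly_measurable_norm br c sf.
    by under eq_fun do rewrite distrC.
  - by rewrite mulr_ge0 // powR_ge0.
  - by move=> x /contrapT Fx; rewrite fF // subrr normr0 powR0 // gt_eqF.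
  - move=> x _; rewrite -EFinD -EFinM lee_fin.
    have -> : C2 * t `^ p = M `^ p by rewrite /C2 /M powRM ?(ltW tp0) // mulrC.
    apply: le_trans (powR_sum_le (ltW p0) (normr_ge0 _) M0).
    apply: ge0_ler_powR; rewrite ?nnegrE ?addr_ge0 //; first exact: ltW.
    by apply: le_trans (ler_normB _ _) _; rewrite lerD2l.
  - apply: ltW; apply: small2 => //; apply: lt_le_trans CFdel _.
    by rewrite lee_fin !ge_min lexx !orbT.
  - exact: tF.
have part2 : (ereal_inf [set z | exists g, upper_gradient d setT
    (fun x => (lam (u x) - lam (f x))%R) g /\ z = Lp_normE mu p g] <= (e / 3)%:E)%E.
  apply: ge_ereal_inf; eexists; first by eexists; split; [exact: ugh | reflexivity].
  apply: root; first by apply: integral_ge0 => x _; exact: poweR_ge0.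
  apply: (@le_trans _ _ (2 `^ p * (e1 + C1 * e1))%:E); last first.
    rewrite -e1E lee_fin ler_pM2l // lerD2l ler_pM2r // ?lerDl ?lerDr //.
  apply: (ge0_integral_le_on (B := ~` F) (psi := G) (c := C1 * t `^ p)) => //.
  - apply: (measurableT_comp (measurable_poweR p)).
    exact: (upper_gradient_measurable br ugh).
  - by move=> x; exact: poweR_ge0.
  - by rewrite mulr_ge0 // powR_ge0.
  - by move=> x /contrapT Fx; rewrite asboolT // poweR0r // gt_eqF.
  - move=> x nF; rewrite asboolF //.
    have -> : C1 * t `^ p = L `^ p by rewrite /C1 /L powRM ?(ltW tp0).
    by apply: poweR_sum_le => //; exact: g0.
  - apply: ltW; apply: small1 => //; apply: lt_le_trans CFdel _.
    by rewrite lee_fin !ge_min lexx.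
  - exact: tF.
apply: (@le_lt_trans _ _ ((e / 3)%:E + (e / 3)%:E)%E); first exact: leeD.
by rewrite -EFinD lte_fin; lra.
Qed.
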